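(* Let $q$ be a probability mass function on $\mathbb{Z}$ satisfying the standing assumptions below, and let $S=(S_n)_{n\ge 0}$ be the random walk with $S_0=0$ and i.i.d. increments of law $q$. Let $\theta:\mathbb{Z}\to[0,1]$ be such that $\{z:\theta(z)\neq 0\}$ is finite. Let $X=(X_n)_{n\ge0}$ be the sequence of coin tosses generated by the walk: conditionally on $S$, the $X_n$ are independent $\{-1,1\}$-valued with $E[X_n\mid S]=\theta(S_n)$. Then there exist functions $\theta_n:\{-1,1\}^n\to\mathbb{R}^{\mathbb{Z}}$, not depending on $\theta$, such that almost surely there is a map $T:\mathbb{Z}\to\mathbb{Z}$ of the form $T(z)=z+c$ or $T(z)=-z+c$ for some $c\in\mathbb{Z}$ ($T$ may depend on $\theta$) with $$\lim_{n\to\infty}\theta_n(X_1,\dots,X_n)(z)=\theta(T(z))\quad\text{for all } z\in\mathbb{Z}.$$ That is, the biases can be recovered up to a shift and reflection of $\mathbb{Z}$ from the coin tosses alone, without observing the path $S$.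
   Context: A coin toss with bias $\theta$ is a $\{-1,1\}$-valued random variable with expectation $\theta$. Standing assumptions on $q$: $\sum_z z\,q(z)=0$; $\sum_z z^2q(z)<\infty$; $q(z)=q(-z)$ for all $z$; $\gcd\{n\ge1: q^{*n}(0)>0\}=1$, where $q^{*n}$ is the $n$-fold convolution of $q$; and the additive subgroup generated by the support of $q$ is $\mathbb{Z}$. *)

(* Defs.v *)
From HB Require Import structures.
From mathcomp Require Import all_boot all_order all_algebra.
From mathcomp Require Import all_classical all_reals all_analysis.
Set Implicit Arguments. Unset Strict Implicit. Unset Printing Implicit Defensive.
Import Order.TTheory GRing.Theory Num.Theory.
Local Open Scope classical_set_scope.
Local Open Scope ring_scope.

Fixpoint conv_pow (R : realType) (q : int -> R) (n : nat) : int -> \bar R :=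
  match n with
  | O => fun z => ((z == 0)%:R)%:E
  | S m => fun z => (\esum_(y in [set: int]) (conv_pow q m y * (q (z - y))%:E))%E
  end.

Definition standing_assumptions (R : realType) (q : int -> R) : Prop :=
  (forall z, 0 <= q z) /\
  (\esum_(z in [set: int]) (q z)%:E = 1)%E /\
  (\esum_(z in [set: int]) ((z%:~R ^+ 2) * q z)%R%:E < +oo)%E /\
  (* mean zero: positive part of the (absolutely convergent) first moment
     equals the negative part *)
  (\esum_(z in [set z : int | (0 < z)%R]) (z%:~R * q z)%R%:E =
   \esum_(z in [set z : int | (z < 0)%R]) ((- z)%:~R * q z)%R%:E)%E /\
  (forall z, q z = q (- z)) /\
  (forall d : nat, (forall n : nat, (0 < n)%N -> (0 < conv_pow q n 0)%E -> (d %| n)%N) ->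
     d = 1%N) /\
  (forall G : set int, G 0 -> (forall x y, G x -> G y -> G (x - y)) ->
     (forall z, 0 < q z -> G z) -> G = [set: int]).

Definition sgnb (R : realType) (b : bool) : R := if b then 1 else -1.

(* Joint law of the walk S (S_0 = 0, i.i.d. increments of law q) and of the
   coin tosses X (conditionally on S independent, {-1,1}-valued, with
   E[X_k | S] = theta (S_k)), given through its finite-dimensional
   distributions, which determine it. *)
Definition walk_coin_law (R : realType) (d : measure_display)
  (Omega : measurableType d) (P : probability Omega R)
  (q theta : int -> R) (S : Omega -> nat -> int) (X : Omega -> nat -> bool) : Prop :=
  (forall k s, measurable [set w | S w k = s]) /\
  (forall k b, measurable [set w | X w k = b]) /\
  (forall (n : nat) (s : nat -> int) (x : nat -> bool),
     P [set w | forall k, (k <= n)%N -> S w k = s k /\ X w k = x k] =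
     ((s 0%N == 0)%:R
      * \prod_(k < n) q (s k.+1 - s k)
      * \prod_(k < n.+1) ((1 + sgnb R (x k) * theta (s k)) / 2))%:E).

(* Main.v *)
(** Let [Q] be the step operator of the walk and [w t] the law of the walk
   after [2 t] steps. Products of tosses at times [2 g1], [2 (g1 + g2)], ...
   have expectation equal to a finite sum of products of [w]'s and [theta]'s.

   Signal to noise: [Y_t = X_t X_(t+r1) X_(t+r1+r2) ...], averaged over a block of
   [N] times with normalisation [sum w_t(0)], which is at least of order
   [sqrt N] by finite variance, has expectation tending to
   [A(r1, r2, ...) = sum theta(z0) w_r1(z1 - z0) theta(z1) ...] and bounded
   second moment. Blocks that are long enough compared with their starting time
   are asymptotically uncorrelated, since [w_(t+a)(z) / w_t(0) -> 1], so
   averages over many blocks converge to [A] in mean square.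

   Inversion: with [alpha_k(t)] the value at [0] of the [k]-th power of the
   discrete Laplacian applied to [w_t], one has [alpha_(k+1)(t) / alpha_k(t) -> 0].
   Hence the functions [t -> w_t(z)], [0 <= z <= J], are linearly independent, and
   linear combinations of the [A]'s give the sums of
   [theta(z0) ... theta(zk)] over chains of sites with prescribed distances. The
   chains which traverse the whole support determine [theta] on the support up
   to reflection.

   The limits along [w] use positive definiteness of [(s, t, z) -> u_(s+t)(z)],
   where [u_n] is the law after [n] steps, in place of Fourier analysis: the
   ratio [alpha_k(t+1) / alpha_k(t)] is nondecreasing by log-convexity, and its
   limit is [1] because [alpha_k] decays at most polynomially. *)

Require Import Defs.
From HB Require Import structures.
From mathcomp Require Import all_boot all_order all_algebra.
From mathcomp Require Import all_classical all_reals all_analysis.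
From mathcomp Require Import zify ring lra.
Import Order.TTheory GRing.Theory Num.Theory numFieldNormedType.Exports.
Local Open Scope classical_set_scope.
Local Open Scope ring_scope.

Set Implicit Arguments.
Unset Strict Implicit.
Unset Printing Implicit Defensive.

(** * Sums over the integers *)

(** Only even times are used, because positive definiteness controls [u] at time [r + r]: there the
    value at [0] is the largest, it is log-convex in [r], and being relatively close to it is stable
    under adding sites. Aperiodicity enters as an odd closed path of steps, which allows passing
    from sums of two steps to single steps. The estimators must be fixed before [theta] is known.
    Every estimate is therefore uniform over all sceneries supported in a window; stage [j] takes
    radius [j], which covers any given finite support from some stage on. Mean-square bounds give
    failure probabilities at most [2^-j], and Borel-Cantelli applies. Chain sums do not see
    translations or reflections, so an origin and an orientation have to be chosen. One end of the
    support is placed at [0]. Chains with the longest step yield the symmetric part of the profile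
    and the products of two values of its antisymmetric part; a square root at the first site where
    the latter is nonzero fixes its sign at all sites at once. *)

Definition zr (n : nat) : seq int := [seq i%:Z - n%:Z | i <- iota 0 n.*2.+1].

Lemma mem_zr n z : (z \in zr n) = (`|z| <= n)%N.
Proof.
apply/mapP/idP => [[i]|zn].
  by rewrite mem_iota => /andP[_ ?] ->; lia.
exists (absz (z + n%:Z)%R); last by lia.
by rewrite mem_iota; lia.
Qed.

Lemma zr_uniq n : uniq (zr n).
Proof. by rewrite map_inj_uniq ?iota_uniq// => i j; lia. Qed.

Lemma size_zr n : size (zr n) = n.*2.+1.
Proof. by rewrite size_map size_iota. Qed.

Section SumsOverInt.
Variable R : realType.
Implicit Types f g : int -> R.

Lemma sum_zr_opp n f : \sum_(y <- zr n) f (- y) = \sum_(y <- zr n) f y.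
Proof.
rewrite -(big_map (fun y => - y) xpredT f).
apply/perm_big/uniq_perm; rewrite ?zr_uniq//.
  by rewrite map_inj_uniq ?zr_uniq//; exact: oppr_inj.
move=> z; rewrite mem_zr; apply/mapP/idP => [[y]|zn].
  by rewrite mem_zr => ? ->; lia.
by exists (- z); rewrite ?mem_zr ?opprK//; lia.
Qed.

Lemma sum_zr_split m n f : (m <= n)%N ->
  \sum_(y <- zr n) f y =
  \sum_(y <- zr m) f y + \sum_(y <- zr n | (m < `|y|)%N) f y.
Proof.
move=> mn; rewrite (bigID (fun y : int => (`|y| <= m)%N))/=; congr (_ + _).
  rewrite -big_filter; apply/perm_big/uniq_perm;
    rewrite ?zr_uniq ?filter_uniq ?zr_uniq//.
  by move=> z; rewrite mem_filter !mem_zr; lia.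
by apply: eq_bigl => y; rewrite ltnNge.
Qed.

Lemma le_sum_zr m n f : (forall z, 0 <= f z) -> (m <= n)%N ->
  \sum_(y <- zr m) f y <= \sum_(y <- zr n) f y.
Proof. by move=> f0 mn; rewrite (sum_zr_split f mn) lerDl sumr_ge0. Qed.

Lemma sum_zr1 n (x : int) f : (`|x| <= n)%N ->
  \sum_(y <- zr n) (y == x)%:R * f y = f x.
Proof.
move=> xn; rewrite (bigD1_seq x) ?mem_zr ?zr_uniq//= eqxx mul1r big1 ?addr0//.
by move=> y /negbTE ->; rewrite mul0r.
Qed.

Lemma le_sum_seq_zr (s : seq int) n f : uniq s -> (forall z, 0 <= f z) ->
  {in s, forall z : int, (`|z| <= n)%N} ->
  \sum_(y <- s) f y <= \sum_(y <- zr n) f y.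
Proof.
move=> us f0 sn; rewrite [leRHS](bigID (mem s))/=.
have -> : \sum_(y <- zr n | y \in s) f y = \sum_(y <- s) f y.
  rewrite -big_filter; apply/perm_big/uniq_perm;
    rewrite ?filter_uniq ?zr_uniq//.
  move=> z; rewrite mem_filter mem_zr; apply/andP/idP => [[]//|zs].
  by split=> //; exact: sn.
by rewrite lerDl sumr_ge0.
Qed.

Lemma esum_ge_zr f n : (forall z, 0 <= f z) ->
  ((\sum_(y <- zr n) f y)%:E <= \esum_(z in [set: int]) (f z)%:E)%E.
Proof.
move=> f0; apply: esum_ge; exists [set` zr n].
  by rewrite /fsets/=; split => //; exact: finite_seq.
by rewrite -fsbig_seq ?zr_uniq//= sumEFin lexx.
Qed.

Lemma esum_le_zr f (l : R) : (forall z, 0 <= f z) ->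
  (forall n, \sum_(y <- zr n) f y <= l) ->
  (\esum_(z in [set: int]) (f z)%:E <= l%:E)%E.
Proof.
move=> f0 fl; apply: ub_ereal_sup => _ [A [finA _] <-].
rewrite fsbig_finite//= sumEFin lee_fin.
set s := finmap.enum_fset _.
have us : uniq s by exact: finmap.fset_uniq.
pose n := \max_(z <- s) `|z|%N.
apply: (le_trans _ (fl n)); apply: le_sum_seq_zr => // z zs.
exact: (@leq_bigmax_seq _ s xpredT (fun z : int => `|z|%N)).
Qed.

End SumsOverInt.

(** * The step operator *)

Section StepOperator.
Variable R : realType.
Implicit Types f g q : int -> R.

(** Infinite sums are phrased through the symmetric windows [zr n], for which reflection is exact at
    every finite stage; [s2] is any upper bound for the variance. *)
Record step_law q (s2 : R) : Prop := StepLaw {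
  step_ge0 : forall z, 0 <= q z ;
  step_opp : forall z, q (- z) = q z ;
  step_sum1 : \sum_(y <- zr n) q y @[n --> \oo] --> (1 : R) ;
  step_var : forall n, \sum_(y <- zr n) y%:~R ^+ 2 * q y <= s2 }.

Definition bnd f := exists M, forall z, `|f z| <= M.

Lemma bndP f : bnd f -> exists2 M, 0 <= M & forall z, `|f z| <= M.
Proof.
by case=> M fM; exists M => //; exact: le_trans (normr_ge0 _) (fM 0).
Qed.

Lemma bnd_cst (c : R) : bnd (fun=> c).
Proof. by exists `|c|. Qed.

Lemma bndD f g : bnd f -> bnd g -> bnd (fun z => f z + g z).
Proof.
move=> [M fM] [N gN]; exists (M + N) => z.
by rewrite (le_trans (ler_normD _ _)) ?lerD.
Qed.

Lemma bndM f g : bnd f -> bnd g -> bnd (fun z => f z * g z).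
Proof.
move=> [M fM] [N gN]; exists (M * N) => z.
by rewrite normrM ler_pM.
Qed.

Lemma bnd_sum (I : Type) (s : seq I) (F : I -> int -> R) :
  (forall i, bnd (F i)) -> bnd (fun z => \sum_(i <- s) F i z).
Proof.
move=> bF; elim: s => [|i s IH].
  by exists 0 => z; rewrite big_nil normr0.
have [M hM] := bndD (bF i) IH.
by exists M => z; rewrite big_cons.
Qed.

Lemma bndZ (c : R) f : bnd f -> bnd (fun z => c * f z).
Proof. by move=> bf; apply: bndM => //; exact: bnd_cst. Qed.

Lemma bndB f g : bnd f -> bnd g -> bnd (fun z => f z - g z).
Proof.
move=> bf bg; have [M hM] := bndD bf (bndZ (-1) bg).
by exists M => z; have := hM z; rewrite mulN1r.
Qed.

Lemma bnd_shift (a : int) f : bnd f -> bnd (fun z => f (z + a)).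
Proof. by move=> [M fM]; exists M. Qed.

Lemma bnd_bool (P : int -> bool) : bnd (fun z => (P z)%:R).
Proof. by exists 1 => z; case: (P z); rewrite ?normr1 ?normr0. Qed.

(** The expectation of [f] after one step from [z]. Since [limn] has a default value when there is
    no limit, linearity and monotonicity are established for [bnd] functions. *)
Definition Q q f (z : int) : R :=
  limn (fun n => \sum_(y <- zr n) q y * f (z + y)).

Definition delta (z : int) : R := (z == 0)%:R.

Definition u q (n : nat) : int -> R := iter n (Q q) delta.

Variables (q : int -> R) (s2 : R).
Hypothesis Hq : step_law q s2.

Let q0 := step_ge0 Hq.

Lemma step_sum_le1 n : \sum_(y <- zr n) q y <= 1.
Proof.
rewrite -(cvg_lim (@Rhausdorff R) (step_sum1 Hq)).
apply: nondecreasing_cvgn_le.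
  by move=> m k mk; exact: le_sum_zr.
by apply/cvg_ex; exists 1; exact: step_sum1 Hq.
Qed.

(** Adding the bound [M] makes the summands nonnegative and the window sums monotone; the correction
    is [M] times the window sums of [q], which converge. *)
Lemma Q_cvg f z : bnd f ->
  \sum_(y <- zr n) q y * f (z + y) @[n --> \oo] --> Q q f z.
Proof.
move=> /bndP[M M0 fM]; rewrite /Q.
suff : cvgn (fun n => \sum_(y <- zr n) q y * f (z + y)) by [].
have -> : (fun n => \sum_(y <- zr n) q y * f (z + y)) =
    (fun n => \sum_(y <- zr n) q y * (f (z + y) + M)) \-
    (fun n => (\sum_(y <- zr n) q y) * M).
  apply/funext => n /=; rewrite mulr_suml -sumrB; apply: eq_bigr => y _.
  by rewrite mulrDr addrK.
have fM0 x : 0 <= f x + M by have := fM x; rewrite ler_norml; lra.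
have fM2 x : f x + M <= M + M by have := fM x; rewrite ler_norml; lra.
apply: is_cvgB; last first.
  apply: is_cvgM; last exact: is_cvg_cst.
  by apply/cvg_ex; exists 1; exact: step_sum1 Hq.
apply: nondecreasing_is_cvgn.
  by move=> m k mk; apply: le_sum_zr => // y; rewrite mulr_ge0.
exists (M + M) => _ [n _ <-].
apply: (@le_trans _ _ ((\sum_(y <- zr n) q y) * (M + M))).
  by rewrite mulr_suml; apply: ler_sum => y _; rewrite ler_wpM2l.
by rewrite ler_piMl ?step_sum_le1// addr_ge0.
Qed.

Lemma Q_eq f z (l : R) :
  \sum_(y <- zr n) q y * f (z + y) @[n --> \oo] --> l -> Q q f z = l.
Proof. by move/(cvg_lim (@Rhausdorff R)). Qed.

Lemma Q_le f g z : bnd f -> bnd g -> (forall y, f y <= g y) ->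
  Q q f z <= Q q g z.
Proof.
move=> bf bg fg; apply: ler_lim.
- by apply/cvg_ex; exists (Q q f z); exact: Q_cvg.
- by apply/cvg_ex; exists (Q q g z); exact: Q_cvg.
- by apply: nearW => n; apply: ler_sum => y _; rewrite ler_wpM2l.
Qed.

Lemma Q_cst (c : R) z : Q q (fun=> c) z = c.
Proof.
apply: Q_eq; under eq_fun do rewrite -mulr_suml.
have := @cvgM _ _ _ _ _ _ _ _ (step_sum1 Hq) (cvg_cst c).
by rewrite mul1r; apply.
Qed.

Lemma QD f g z : bnd f -> bnd g ->
  Q q (fun x => f x + g x) z = Q q f z + Q q g z.
Proof.
move=> bf bg; apply: Q_eq.
under eq_fun do (under eq_bigr do rewrite mulrDr; rewrite big_split/=).
by apply: cvgD; exact: Q_cvg.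
Qed.

Lemma QZ (c : R) f z : bnd f -> Q q (fun x => c * f x) z = c * Q q f z.
Proof.
move=> bf; apply: Q_eq.
under eq_fun do (under eq_bigr do rewrite mulrCA; rewrite -mulr_sumr).
by apply: cvgM; [exact: cvg_cst|exact: Q_cvg].
Qed.

Lemma QB f g z : bnd f -> bnd g ->
  Q q (fun x => f x - g x) z = Q q f z - Q q g z.
Proof.
move=> bf bg; apply: Q_eq.
under eq_fun do (under eq_bigr do rewrite mulrBr; rewrite sumrB).
by apply: cvgB; exact: Q_cvg.
Qed.

Lemma Q_opp f z : bnd f -> Q q (fun x => f (- x)) z = Q q f (- z).
Proof.
move=> bf; apply: Q_eq.
under eq_fun => n.
  rewrite -sum_zr_opp.
  under eq_bigr do rewrite (step_opp Hq) opprD opprK.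
  over.
exact: Q_cvg.
Qed.

Lemma Q_shift (a : int) f z : Q q (fun x => f (x + a)) z = Q q f (z + a).
Proof. by rewrite /Q; under eq_fun do under eq_bigr do rewrite addrAC. Qed.

Lemma bndQ f : bnd f -> bnd (Q q f).
Proof.
move=> bf; have [M M0 fM] := bndP bf; exists M => z.
have bc := bnd_cst M; have bc' := bnd_cst (- M).
rewrite ler_norml; apply/andP; split.
  rewrite -(Q_cst (- M) z); apply: Q_le => // y.
  by have := fM y; rewrite ler_norml => /andP[].
rewrite -[leRHS](Q_cst M z); apply: Q_le => // y.
by have := fM y; rewrite ler_norml => /andP[].
Qed.

Lemma Q_ge_term f z y : bnd f -> (forall x, 0 <= f x) ->
  q y * f (z + y) <= Q q f z.
Proof.
move=> bf f0; apply: limr_ge.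
  by apply/cvg_ex; exists (Q q f z); exact: Q_cvg.
exists `|y|%N => //= n /= yn.
rewrite -(@sum_zr1 _ n y (fun y => q y * f (z + y)))//.
apply: ler_sum => x _; have qf : 0 <= q x * f (z + x) by rewrite mulr_ge0.
by case: eqP; rewrite ?mul1r ?mul0r.
Qed.

Lemma bndQn n f : bnd f -> bnd (iter n (Q q) f).
Proof. by move=> bf; elim: n => //= n; exact: bndQ. Qed.

Lemma Qn_le n f g z : bnd f -> bnd g -> (forall y, f y <= g y) ->
  iter n (Q q) f z <= iter n (Q q) g z.
Proof.
move=> bf bg fg; elim: n z => [|n IH] z //=.
by apply: Q_le; [exact: bndQn|exact: bndQn|exact: IH].
Qed.

Lemma Qn_cst n (c : R) z : iter n (Q q) (fun=> c) z = c.
Proof.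
elim: n z => //= n IH z; rewrite -[RHS](Q_cst c z).
by congr (Q q _ z); apply/funext => y; exact: IH.
Qed.

Lemma QnD n f g z : bnd f -> bnd g ->
  iter n (Q q) (fun x => f x + g x) z = iter n (Q q) f z + iter n (Q q) g z.
Proof.
move=> bf bg; elim: n z => //= n IH z.
rewrite -QD; [|exact: bndQn|exact: bndQn].
by congr (Q q _ z); apply/funext => y; exact: IH.
Qed.

Lemma QnZ n (c : R) f z : bnd f ->
  iter n (Q q) (fun x => c * f x) z = c * iter n (Q q) f z.
Proof.
move=> bf; elim: n z => //= n IH z; rewrite -QZ; last exact: bndQn.
by congr (Q q _ z); apply/funext => y; exact: IH.
Qed.

Lemma QnB n f g z : bnd f -> bnd g ->
  iter n (Q q) (fun x => f x - g x) z = iter n (Q q) f z - iter n (Q q) g z.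
Proof.
move=> bf bg; elim: n z => //= n IH z.
rewrite -QB; [|exact: bndQn|exact: bndQn].
by congr (Q q _ z); apply/funext => y; exact: IH.
Qed.

Lemma Qn_sum n (I : Type) (s : seq I) (F : I -> int -> R) z :
  (forall i, bnd (F i)) ->
  iter n (Q q) (fun x => \sum_(i <- s) F i x) z =
  \sum_(i <- s) iter n (Q q) (F i) z.
Proof.
move=> bF; elim: s => [|i s IH].
  rewrite big_nil -[RHS](Qn_cst n 0 z); congr (iter n _ _ z).
  by apply/funext => x; rewrite big_nil.
rewrite big_cons -IH -QnD//; last exact: bnd_sum.
by congr (iter n _ _ z); apply/funext => x; rewrite big_cons.
Qed.

Lemma Qn_opp n f z : bnd f ->
  iter n (Q q) (fun x => f (- x)) z = iter n (Q q) f (- z).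
Proof.
move=> bf; elim: n z => //= n IH z; rewrite -Q_opp; last exact: bndQn.
by congr (Q q _ z); apply/funext => y; exact: IH.
Qed.

Lemma Qn_shift n (a : int) f z :
  iter n (Q q) (fun x => f (x + a)) z = iter n (Q q) f (z + a).
Proof.
elim: n z => //= n IH z; rewrite -Q_shift.
by congr (Q q _ z); apply/funext => y; exact: IH.
Qed.

Lemma bnd_delta : bnd delta.
Proof. exact: bnd_bool. Qed.

Lemma bnd_u n : bnd (u q n).
Proof. exact/bndQn/bnd_delta. Qed.

Lemma u_ge0 n z : 0 <= u q n z.
Proof.
rewrite -(Qn_cst n 0 z); apply: Qn_le; [exact: bnd_cst|exact: bnd_delta|].
by move=> y; rewrite /delta; case: eqP.
Qed.

Lemma u_opp n z : u q n (- z) = u q n z.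
Proof.
rewrite /u -Qn_opp; last exact: bnd_delta.
by congr (iter n _ _ z); apply/funext => x; rewrite /delta oppr_eq0.
Qed.

Lemma Qn_point n (y z : int) :
  iter n (Q q) (fun x => (x == y)%:R) z = u q n (z - y).
Proof.
rewrite /u -Qn_shift; congr (iter n _ _ z).
by apply/funext => x; rewrite /delta subr_eq0.
Qed.

Lemma uD m n z : u q (m + n) z = iter m (Q q) (u q n) z.
Proof. by rewrite /u iterD. Qed.

(** A finitely supported function is a combination of point masses, each carried by [n] steps to a
    translate of [u q n]. This is what turns expectations involving [th] into finite sums. *)
Lemma Qn_finsupp n (s : seq int) f z : uniq s ->
  (forall x, x \notin s -> f x = 0) ->
  iter n (Q q) f z = \sum_(y <- s) u q n (z - y) * f y.
Proof.
move=> us fs.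
have -> : f = fun x => \sum_(y <- s) f y * (x == y)%:R.
  apply/funext => x; case xs : (x \in s).
    rewrite (bigD1_seq x)//= eqxx mulr1 big1 ?addr0// => y.
    by rewrite eq_sym => /negbTE ->; rewrite mulr0.
  rewrite fs ?xs// big_seq big1// => y ys; case: eqP => [xy|]; last first.
    by rewrite mulr0.
  by rewrite xy ys in xs.
rewrite Qn_sum; last by move=> y; apply: bndZ; exact: bnd_bool.
apply: eq_bigr => y _; rewrite QnZ; last exact: bnd_bool.
rewrite Qn_point mulrC; congr (_ * _).
have [ys|ys] := boolP (y \in s).
  rewrite (bigD1_seq y)//= eqxx mulr1 big1 ?addr0// => x.
  by rewrite eq_sym => /negbTE ->; rewrite mulr0.
rewrite fs// big_seq big1// => x xs; case: eqP => [yx|]; last first.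
  by rewrite mulr0.
by rewrite yx xs in ys.
Qed.

Lemma sum_u_le1 n (s : seq int) z : uniq s -> \sum_(y <- s) u q n (z - y) <= 1.
Proof.
move=> us; have -> : \sum_(y <- s) u q n (z - y) =
    iter n (Q q) (fun x => (x \in s)%:R) z.
  rewrite (Qn_finsupp _ _ us); last by move=> x /negbTE ->.
  by rewrite big_seq [RHS]big_seq; apply: eq_bigr => y ->; rewrite mulr1.
rewrite -[leRHS](Qn_cst n 1 z); apply: Qn_le; [exact: bnd_bool|exact: bnd_cst|].
by move=> y; rewrite lern1 leq_b1.
Qed.

End StepOperator.

(** * Positive definiteness of the transition kernel *)

Section Kernels.
Variable R : realType.
Implicit Types f g q : int -> R.

Lemma div_nat_small (C e : R) : 0 < e ->
  exists2 N0, (0 < N0)%N & forall N, (N0 <= N)%N -> C / N%:R <= e.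
Proof.
move=> e0; exists (Num.bound (`|C| / e)).+1 => // N hN.
have N0 : 0 < N%:R :> R by rewrite ltr0n; lia.
rewrite ler_pdivrMr//; apply: le_trans (ler_norm _) _.
rewrite -ler_pdivrMl// mulrC.
apply: (@le_trans _ _ ((Num.bound (`|C| / e))%:R)).
  by apply/ltW/archi_boundP; rewrite divr_ge0// ltW.
by rewrite ler_nat; lia.
Qed.

Lemma cvg_sum_seq (I : Type) (s : seq I) (F : I -> nat -> R) (l : I -> R) :
  (forall i, F i n @[n --> \oo] --> l i) ->
  \sum_(i <- s) F i n @[n --> \oo] --> \sum_(i <- s) l i.
Proof.
move=> Fl; elim: s => [|i s IH].
  by rewrite big_nil; under eq_fun do rewrite big_nil; exact: cvg_cst.
by rewrite big_cons; under eq_fun do rewrite big_cons; exact: cvgD.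
Qed.

Lemma sum_sqr_le (I : eqType) (s : seq I) (f : I -> R) :
  (\sum_(i <- s) f i) ^+ 2 <= (size s)%:R * \sum_(i <- s) f i ^+ 2.
Proof.
elim: s => [|i s IH]; first by rewrite !big_nil expr0n mulr0.
rewrite !big_cons /= -natr1.
set A := \sum_(_ <- _) _ in IH *; set B := \sum_(_ <- _) _ in IH *.
have S0 : 0 <= (size s)%:R :> R by [].
have B0 : 0 <= B by apply: sumr_ge0 => j _; exact: sqr_ge0.
set S := (size s)%:R in IH S0 *; set x := f i.
have [S1|Sneq] := eqVneq S 0.
  have A0 : A = 0 by apply/eqP; rewrite -sqrf_eq0 eq_le sqr_ge0 andbT;
    move: IH; rewrite S1 mul0r.
  by rewrite A0 S1; nra.
have Sp : 0 < S by rewrite lt_neqAle eq_sym Sneq.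
have h : 2 * x * A <= S * x ^+ 2 + B.
  rewrite -(ler_pM2l Sp); have := sqr_ge0 (S * x - A); nra.
nra.
Qed.

(** A truncated square, serving Chebyshev's inequality inside the bounded functions: it equals 1
    from distance [N] on, and its mean grows by at most [s2 / N^2] per step. *)
Definition tail (N : nat) (z : int) : R :=
  Num.min (z%:~R ^+ 2 / N%:R ^+ 2) 1.

Lemma bnd_tail N : bnd (tail N).
Proof.
exists 1 => z; rewrite /tail ler_norml; apply/andP; split.
  by rewrite le_min; apply/andP; split; [|lra]; apply: le_trans (_ : 0 <= _);
     [lra|rewrite divr_ge0// sqr_ge0].
by rewrite ge_min lexx orbT.
Qed.

Lemma tail_eq1 N (z : int) : (0 < N)%N -> (N <= `|z|)%N -> tail N z = 1.
Proof.
move=> N0 Nz; rewrite /tail min_r// ler_pdivlMr ?exprn_gt0 ?ltr0n// mul1r.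
rewrite -(real_normK (num_real z%:~R)) ler_sqr ?nnegrE//.
by rewrite -intr_norm -[N%:R]/((N%:Z)%:~R) ler_int; lia.
Qed.

(** An entry of [l] is a coefficient, a time and a site. *)
Definition psd (F : nat -> int -> R) := forall l : seq (R * nat * int),
  0 <= \sum_(a <- l) \sum_(b <- l)
         a.1.1 * b.1.1 * F (a.1.2 + b.1.2)%N (a.2 - b.2).

Definition lap (F : nat -> int -> R) n z :=
  2 * F n z - F n (z + 1) - F n (z - 1).

(** Replacing each site [z] by the signed pair [z + 1], [z] turns the quadratic form of [F] into
    that of [lap F]. *)
Lemma psd_lap F : psd F -> psd (lap F).
Proof.
move=> pF l.
have := pF ([seq (a.1.1, a.1.2, a.2 + 1) | a <- l] ++
            [seq (- a.1.1, a.1.2, a.2) | a <- l]).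
rewrite big_cat !big_map/= -big_split/=; congr (_ <= _).
apply: eq_bigr => a _; rewrite !big_cat !big_map/= -!big_split/=.
apply: eq_bigr => b _; rewrite /lap.
have -> : a.2 + 1 - (b.2 + 1) = a.2 - b.2 by ring.
have -> : a.2 + 1 - b.2 = a.2 - b.2 + 1 by ring.
have -> : a.2 - (b.2 + 1) = a.2 - b.2 - 1 by ring.
ring.
Qed.

Section Psd.
Variable F : nat -> int -> R.
Hypothesis pF : psd F.
Hypothesis oF : forall n z, F n (- z) = F n z.

Lemma psd_norm_le r z : `|F (r + r) z| <= F (r + r) 0.
Proof.
have h (c : R) := pF [:: (1, r, 0); (c, r, z)].
have := h 1; have := h (-1).
rewrite !big_cons !big_nil/= !subrr sub0r subr0 oF ler_norml; lra.
Qed.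

(** The test vector gives [D * (A * D - B^2) >= 0], and the positive factor [D] is cancelled. *)
Lemma psd_logconvex r : 0 < F (r.+2 + r.+2) 0 ->
  F (r.+1 + r.+1) 0 ^+ 2 <= F (r + r) 0 * F (r.+2 + r.+2) 0.
Proof.
move=> F0; set D := F (r.+2 + r.+2) 0 in F0 *.
set B := F (r.+1 + r.+1) 0; set A := F (r + r) 0.
have := pF [:: (D, r, 0); (- B, r.+2, 0)].
rewrite !big_cons !big_nil/= !subrr.
have -> : (r + r.+2 = r.+1 + r.+1)%N by lia.
have -> : (r.+2 + r = r.+1 + r.+1)%N by lia.
rewrite -/A -/B -/D => h; rewrite -(ler_pM2l F0); nra.
Qed.

(** Coefficients 1, -2, 1 at the sites [0], [x], [x + y]. This is [(a + b)^2 <= 2 a^2 + 2 b^2] for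
    distances in the associated Hilbert space. *)
Lemma psd_triangle r x y :
  F (r + r) 0 - F (r + r) (x + y) <=
  2 * (F (r + r) 0 - F (r + r) x) + 2 * (F (r + r) 0 - F (r + r) y).
Proof.
have := pF [:: (1, r, 0); (-2, r, x); (1, r, x + y)].
rewrite !big_cons !big_nil/= !subrr !sub0r !subr0 !oF.
have -> : x - (x + y) = - y by ring.
have -> : x + y - x = y by ring.
rewrite oF; lra.
Qed.

End Psd.

Variables (q : int -> R) (s2 : R).
Hypothesis Hq : step_law q s2.
Let q0 := step_ge0 Hq.

Lemma step_var_ge0 : 0 <= s2.
Proof.
by apply: le_trans (step_var Hq 0); apply: sumr_ge0 => y _; rewrite mulr_ge0// sqr_ge0.
Qed.

(* Symmetry of [q] cancels the first-order term of [(z + y)^2]. *)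
Lemma Q_tail N z : (0 < N)%N -> Q q (tail N) z <= tail N z + s2 / N%:R ^+ 2.
Proof.
move=> N0; have N2 : 0 < N%:R ^+ 2 :> R by rewrite exprn_gt0// ltr0n.
apply: limr_le.
  by apply/cvg_ex; exists (Q q (tail N) z); apply: (Q_cvg Hq); exact: bnd_tail.
apply: nearW => n.
set S := \sum_(y <- _) _.
have S2 : S + S = \sum_(y <- zr n) q y * (tail N (z + y) + tail N (z - y)).
  rewrite {2}/S -sum_zr_opp -big_split/=; apply: eq_bigr => y _.
  by rewrite (step_opp Hq) mulrDr.
suff : S + S <= 2 * (tail N z + s2 / N%:R ^+ 2) by lra.
rewrite S2; apply: (@le_trans _ _ (\sum_(y <- zr n)
   (q y * (2 * tail N z) + 2 / N%:R ^+ 2 * (y%:~R ^+ 2 * q y)))).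
  apply: ler_sum => y _.
  have -> : q y * (2 * tail N z) + 2 / N%:R ^+ 2 * (y%:~R ^+ 2 * q y) =
    q y * (2 * tail N z + 2 * (y%:~R ^+ 2 / N%:R ^+ 2)) by ring.
  rewrite ler_wpM2l// /tail rmorphD rmorphB /=.
  set a : R := z%:~R; set b : R := y%:~R; set i := (N%:R ^+ 2)^-1.
  have i0 : 0 < i by rewrite invr_gt0.
  have [h|h] := leP (a ^+ 2 * i) 1.
    apply: (@le_trans _ _ ((a + b) ^+ 2 * i + (a - b) ^+ 2 * i)); last by nra.
    by rewrite lerD// ge_min lexx.
  apply: (@le_trans _ _ (1 + 1)); first by rewrite lerD// ge_min lexx orbT.
  by have := sqr_ge0 b; nra.
rewrite big_split/= -mulr_suml -mulr_sumr mulrDr lerD//.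
  rewrite ler_piMl ?(step_sum_le1 Hq)// mulr_ge0// le_min ler01 andbT.
  by rewrite divr_ge0 ?sqr_ge0.
rewrite -mulrA ler_wpM2l// mulrC ler_wpM2r ?invr_ge0 ?(ltW N2)//.
exact: step_var Hq n.
Qed.

Lemma Qn_tail r N z : (0 < N)%N ->
  iter r (Q q) (tail N) z <= tail N z + r%:R * (s2 / N%:R ^+ 2).
Proof.
move=> N0; elim: r z => [|r IH] z /=; first by rewrite mul0r addr0.
have bt := bnd_tail N; set c := s2 / _ in IH *.
have bc : bnd (fun=> r%:R * c) by exact: bnd_cst.
apply: (@le_trans _ _ (Q q (fun x => tail N x + r%:R * c) z)).
  by apply: (Q_le Hq) => //; [exact: (bndQn Hq)|exact: bndD].
rewrite (QD Hq)// (Q_cst Hq) -natr1 mulrDl mul1r addrA addrAC lerD2r.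
exact: Q_tail.
Qed.

(** Cutting [f] off outside [zr N] changes it by at most [M * tail N], whose mean after [r] steps is
    of order [1 / N]. *)
Lemma Qn_cvg r f z : bnd f ->
  \sum_(y <- zr N) u q r (z - y) * f y @[N --> \oo] --> iter r (Q q) f z.
Proof.
move=> bf; have [M M0 fM] := bndP bf.
apply/cvgrPdist_le => e e0.
have [N0 N00 hN0] := div_nat_small (M * (z%:~R ^+ 2 + r%:R * s2)) e0.
exists N0 => // N /= NN0; have Np : (0 < N)%N by lia.
have bi : bnd (fun x : int => f x * (`|x| <= N)%N%:R).
  by apply: bndM => //; exact: bnd_bool.
rewrite [X in _ - X](_ : _ = iter r (Q q) (fun x : int => f x * (`|x| <= N)%N%:R) z).
  2: { rewrite (Qn_finsupp Hq _ _ (zr_uniq N)).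
       - rewrite big_seq [RHS]big_seq; apply: eq_bigr => y.
         by rewrite mem_zr => ->; rewrite mulr1.
       - by move=> x; rewrite mem_zr => /negbTE ->; rewrite mulr0. }
rewrite -(QnB Hq)//.
have bt : bnd (fun x => M * tail N x) by apply: bndZ; exact: bnd_tail.
have h1 : `|iter r (Q q) (fun x : int => f x - f x * (`|x| <= N)%N%:R) z| <=
          iter r (Q q) (fun x => M * tail N x) z.
  have bd := bndB bf bi.
  have pt x : `|f x - f x * (`|x| <= N)%N%:R| <= M * tail N x.
    case: (leqP `|x| N) => h; last first.
      by rewrite mulr0 subr0 tail_eq1 ?mulr1// ltnW.
    rewrite mulr1 subrr normr0 mulr_ge0// /tail le_min ler01 andbT.
    by rewrite divr_ge0 ?sqr_ge0.
  rewrite ler_norml; apply/andP; split.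
    rewrite -mulN1r -(QnZ Hq)//; apply: (Qn_le Hq) => //; first exact: bndZ.
    by move=> x; have := pt x; rewrite ler_norml mulN1r => /andP[].
  apply: (Qn_le Hq) => // x.
  by have := pt x; rewrite ler_norml => /andP[].
apply: (le_trans h1); rewrite (QnZ Hq); last exact: bnd_tail.
apply: le_trans (hN0 _ NN0); rewrite -mulrA ler_wpM2l//.
apply: (le_trans (Qn_tail r z Np)).
have NR : 1 <= N%:R :> R by rewrite ler1n.
have i1 : (N%:R ^+ 2)^-1 <= N%:R^-1 :> R.
  by rewrite lef_pV2 ?posrE ?exprn_gt0 ?ltr0n//; nra.
rewrite mulrDl lerD//.
  by apply: (@le_trans _ _ (z%:~R ^+ 2 / N%:R ^+ 2)); rewrite ?ge_min ?lexx//
    ler_wpM2l ?sqr_ge0.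
by rewrite mulrA ler_wpM2l ?mulr_ge0// step_var_ge0.
Qed.

(** Chapman-Kolmogorov, written as an inner product thanks to the symmetry of [u]. *)
Lemma u_conv_cvg r s (z w : int) :
  \sum_(y <- zr N) u q r (z - y) * u q s (w - y) @[N --> \oo] -->
  u q (r + s) (z - w).
Proof.
rewrite uD -(Qn_shift q r (- w) (u q s)).
have -> : (fun x => u q s (x - w)) = (fun x => u q s (w - x)).
  by apply/funext => x; rewrite -(u_opp Hq) opprB.
by apply: Qn_cvg; exists 1 => x; have [] := bnd_u Hq s;
  rewrite ger0_norm ?(u_ge0 Hq)// => *; have := @sum_u_le1 _ _ _ Hq s [:: x] w isT;
  rewrite big_seq1.
Qed.

(** By [u_conv_cvg] the quadratic form is a limit of sums over [y] of squares. *)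
Lemma psd_u : psd (u q).
Proof.
move=> l.
have h : \sum_(a <- l) \sum_(b <- l) a.1.1 * b.1.1 *
      (\sum_(y <- zr N) u q a.1.2 (a.2 - y) * u q b.1.2 (b.2 - y))
    @[N --> \oo] --> \sum_(a <- l) \sum_(b <- l)
         a.1.1 * b.1.1 * u q (a.1.2 + b.1.2)%N (a.2 - b.2).
  apply: (@cvg_sum_seq _ _ (fun a N => \sum_(b <- l) a.1.1 * b.1.1 *
      (\sum_(y <- zr N) u q a.1.2 (a.2 - y) * u q b.1.2 (b.2 - y)))) => a.
  apply: (@cvg_sum_seq _ _ (fun b N => a.1.1 * b.1.1 *
      (\sum_(y <- zr N) u q a.1.2 (a.2 - y) * u q b.1.2 (b.2 - y)))) => b.
  by apply: cvgM; [exact: cvg_cst|exact: u_conv_cvg].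
rewrite -(cvg_lim (@Rhausdorff R) h); apply: limr_ge.
  by apply/cvg_ex; eexists; exact: h.
apply: nearW => N.
rewrite [leRHS](_ : _ = \sum_(y <- zr N)
    (\sum_(a <- l) a.1.1 * u q a.1.2 (a.2 - y)) ^+ 2).
  by apply: sumr_ge0 => y _; exact: sqr_ge0.
under [RHS]eq_bigr do rewrite expr2 mulr_suml.
rewrite [RHS]exchange_big/=; apply: eq_bigr => a _.
under [RHS]eq_bigr do rewrite mulr_sumr.
rewrite [RHS]exchange_big/=; apply: eq_bigr => b _.
by rewrite mulr_sumr; apply: eq_bigr => y _; ring.
Qed.

Lemma sqrt_approx r : (0 < r)%N -> exists m, (r <= m * m <= 4 * r)%N.
Proof.
case: r => // r _; elim: r => [|r [m /andP[h1 h2]]]; first by exists 1.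
have [h|h] := leqP r.+2 (m * m); first by exists m; rewrite h; lia.
by exists m.+1; nia.
Qed.

(** By Chebyshev, mass at least 1/2 of the law after [r] steps lies within a distance of order
    [sqrt r]. Cauchy-Schwarz then bounds the sum of its squares from below, and that sum is at most
    [u q (r + r) 0]. The squared form avoids roots. *)
Lemma u_diag_lower : exists2 c : R, 0 < c &
  forall r, (0 < r)%N -> c <= r%:R * u q (r + r) 0 ^+ 2.
Proof.
(* With [k^2 >= 2 * s2] and [r <= m^2 <= 4 r], the radius [k * m] loses mass at most 1/2. The
   constant 576 is [16 * 36]: 16 from squaring 1/4, and 36 from squaring the window bound [3 * M]
   and using [m^2 <= 4 r]. *)
pose k := (Num.bound (2 * s2)).+1.
have s20 := step_var_ge0.
have k1 : 1 <= k%:R :> R by rewrite ler1n.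
have ks : 2 * s2 <= k%:R ^+ 2 :> R.
  have : 2 * s2 < (Num.bound (2 * s2))%:R by apply: archi_boundP; lra.
  have : (Num.bound (2 * s2))%:R <= k%:R :> R by rewrite ler_nat.
  nra.
exists (576 * k%:R ^+ 2)^-1; first by rewrite invr_gt0; nra.
move=> r r0; have [m /andP[rm mr]] := sqrt_approx r0.
pose M := (k * m)%N; have m0 : (0 < m)%N by case: m rm {mr M}; lia.
have M0 : (0 < M)%N by rewrite /M muln_gt0 m0.
have bi : bnd (fun x : int => ((`|x| <= M)%N)%:R : R) by exact: bnd_bool.
have MR : 1 <= M%:R :> R by rewrite ler1n.
have rR : 1 <= r%:R :> R by rewrite ler1n.
have h1 : 1 / 2 <= \sum_(y <- zr M) u q r (0 - y).
  have -> : \sum_(y <- zr M) u q r (0 - y) =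
      iter r (Q q) (fun x : int => ((`|x| <= M)%N)%:R) 0.
    rewrite (Qn_finsupp Hq _ _ (zr_uniq M)).
      rewrite big_seq [RHS]big_seq; apply: eq_bigr => y.
      by rewrite mem_zr => ->; rewrite mulr1.
    by move=> x; rewrite mem_zr => /negbTE ->.
  have bt := bnd_tail M; have b1 := bnd_cst (1 : R).
  apply: (@le_trans _ _ (iter r (Q q) (fun x => 1 - tail M x) 0)).
    rewrite (QnB Hq)// (Qn_cst Hq); have := Qn_tail r 0 M0.
    rewrite {2}/tail expr0n/= mul0r min_l// add0r => h.
    suff : r%:R * (s2 / M%:R ^+ 2) <= 1 / 2 by lra.
    rewrite mulrA ler_pdivrMr; last by rewrite exprn_gt0// ltr0n.
    rewrite /M natrM exprMn.
    have : r%:R <= m%:R ^+ 2 :> R by rewrite -natrX ler_nat -mulnn.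
    have : 0 <= m%:R ^+ 2 :> R by exact: sqr_ge0.
    nra.
  apply: (Qn_le Hq) => //; first exact: bndB.
  move=> x; case: (leqP `|x| M) => h; last by rewrite tail_eq1 ?subrr// ltnW.
  rewrite lerBlDr lerDl /tail le_min ler01 andbT.
  by rewrite divr_ge0 ?sqr_ge0.
have h2 : \sum_(y <- zr M) u q r (0 - y) ^+ 2 <= u q (r + r) 0.
  have hc := @u_conv_cvg r r 0 0; rewrite subr0 in hc.
  rewrite -(cvg_lim (@Rhausdorff R) hc); apply: limr_ge.
    by apply/cvg_ex; eexists; exact: hc.
  exists M => //= N /= MN; under eq_bigr do rewrite expr2.
  by apply: le_sum_zr => // y; rewrite mulr_ge0// (u_ge0 Hq).
have h3 := @sum_sqr_le _ (zr M) (fun y => u q r (0 - y)).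
rewrite size_zr in h3.
set S := \sum_(y <- zr M) _ in h1 h3; set U := u q (r + r) 0 in h2 *.
set T := \sum_(y <- zr M) _ in h2 h3.
have MM : (M.*2.+1)%:R <= 3 * M%:R :> R.
  by rewrite -muln2 -natr1 natrM; lra.
have h4 : 1 / 4 <= 3 * M%:R * U.
  apply: (@le_trans _ _ (S ^+ 2)); first by nra.
  apply: (le_trans h3); apply: ler_pM => //.
  by apply: sumr_ge0 => y _; exact: sqr_ge0.
have mr' : m%:R ^+ 2 <= 4 * r%:R :> R.
  by rewrite -natrX -natrM ler_nat -mulnn.
have U0 : 0 <= U by exact: (u_ge0 Hq).
have h5 : 1 / 16 <= 9 * (k%:R * m%:R) ^+ 2 * U ^+ 2.
  by rewrite /M natrM in h4; set A := k%:R * m%:R in h4 *; nra.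
have k2 : 0 < k%:R ^+ 2 :> R by nra.
have h6 : 9 * (k%:R * m%:R) ^+ 2 * U ^+ 2 <= 36 * k%:R ^+ 2 * (r%:R * U ^+ 2).
  rewrite exprMn; have : 0 <= k%:R ^+ 2 * U ^+ 2 by rewrite mulr_ge0 ?sqr_ge0.
  set A := k%:R ^+ 2; set B := U ^+ 2; set C := m%:R ^+ 2 in mr' * => AB; nra.
rewrite -[leLHS]mul1r ler_pdivrMr; last by nra.
by set A := r%:R * _ in h6 *; set K := k%:R ^+ 2 in h6 h5 *; nra.
Qed.

End Kernels.

(** * Ratio limits *)

Section RatioLimits.
Variable R : realType.
Implicit Types f g q : int -> R.

Lemma ler_eq (x y : R) : x = y -> x <= y.
Proof. by move->. Qed.

Definition l1 f (C : R) := forall s : seq int, uniq s -> \sum_(y <- s) `|f y| <= C.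

Lemma l1_shift f C (a : int) : l1 f C -> l1 (fun z => f (z + a)) C.
Proof.
move=> fC s us; rewrite -(big_map (fun y => y + a) xpredT (fun y => `|f y|)).
by apply: fC; rewrite map_inj_uniq//; exact: addIr.
Qed.

Lemma l1D f g C D : l1 f C -> l1 g D -> l1 (fun z => f z + g z) (C + D).
Proof.
move=> fC gD s us; apply: (@le_trans _ _ (\sum_(y <- s) (`|f y| + `|g y|))).
  by apply: ler_sum => y _; exact: ler_normD.
by rewrite big_split lerD ?fC ?gD.
Qed.

Lemma l1N f C : l1 f C -> l1 (fun z => - f z) C.
Proof. by move=> fC s us; under eq_bigr do rewrite normrN; exact: fC. Qed.

(** A value [M] that changes by at most [e] per site stays above [M / 2] over about [M / (2 e)]
    sites, so the absolute sum is at least of order [M^2 / e]. *)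
Lemma l1_slow_sup f C e : 0 < e -> l1 f C ->
  (forall z, `|f (z + 1) - f z| <= e) -> forall z, f z ^+ 2 <= 8 * C * e.
Proof.
move=> e0 fC fe z.
have fM : `|f z| <= C by have := fC [:: z] isT; rewrite big_seq1.
have far (i : nat) : `|f z| - i%:R * e <= `|f (z + i%:Z)|.
  elim: i => [|i IH]; first by rewrite mul0r subr0 addr0.
  have := fe (z + i%:Z); have -> : z + i%:Z + 1 = z + i.+1%:Z by lia.
  rewrite -natr1 mulrDl mul1r distrC.
  have := lerB_dist (f (z + i%:Z)) (f (z + i.+1%:Z)).
  lra.
have win (m : nat) : m%:R * (`|f z| - m%:R * e) <= C.
  have us : uniq [seq z + i%:Z | i <- iota 0 m].
    by rewrite map_inj_uniq ?iota_uniq// => i j; lia.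
  apply: le_trans (fC _ us); rewrite big_map.
  have -> : m%:R * (`|f z| - m%:R * e) =
      \sum_(i <- iota 0 m) (`|f z| - m%:R * e).
    by rewrite big_const_seq count_predT size_iota iter_addr_0 [LHS]mulr_natl.
  rewrite big_seq [leRHS]big_seq; apply: ler_sum => i; rewrite mem_iota => /andP[_ im].
  apply: le_trans (far i); rewrite lerD2l lerN2 ler_wpM2r ?(ltW e0)// ler_nat; lia.
rewrite -(real_normK (num_real (f z))); set M := `|f z| in fM far win *.
have M0 : 0 <= M by exact: normr_ge0.
have C0 : 0 <= C by exact: le_trans fM.
have [Me|Me] := ltP M (2 * e); first by nra.
pose x := M / (2 * e); pose m := Num.truncn x.
have x1 : 1 <= x by rewrite ler_pdivlMr ?mul1r//; lra.
have /andP[mx xm] := truncn_itv (le_trans ler01 x1).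
have Mx : M = x * (2 * e) by rewrite /x divfK// gt_eqF//; lra.
rewrite -/m -natr1 in mx xm.
have m1 : 1 <= m%:R :> R by rewrite ler1n truncn_gt0.
have := win m; rewrite Mx; set k := m%:R in mx xm m1 *.
have : x <= 2 * k by lra.
move=> xk h; have h2 : k * (x * e) <= C.
  apply: le_trans h.
  have : 0 <= k * (e * (x - k)).
    by apply: mulr_ge0; [lra|apply: mulr_ge0; [exact: ltW|lra]].
  lra.
have : x * (x * e) <= 2 * C.
  apply: (@le_trans _ _ (2 * k * (x * e))); last by lra.
  by rewrite ler_wpM2r// mulr_ge0 ?(ltW e0)//; lra.
by move=> h3; have := ler_wpM2r (ltW e0) h3; lra.
Qed.

(** The slow-variation bound is applied twice: to the difference of [f], with constant [2 * C], and
    then to [f] with the resulting step bound. Hence the fourth power, and [64 * 16 = 4^5]. *)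
Lemma l1_lap_sup f C e : 0 < e -> 0 < C -> l1 f C ->
  (forall z, `|2 * f z - f (z + 1) - f (z - 1)| <= e) ->
  forall z, f z ^+ 4 <= 4 ^+ 5 * C ^+ 3 * e.
Proof.
move=> e0 C0 fC fe z.
pose g z := f (z + 1) - f z.
have gC : l1 g (C + C) by apply: l1D; [exact: l1_shift|exact: l1N].
have g1 x : `|g (x + 1) - g x| <= e.
  have := fe (x + 1); rewrite addrK /g -normrN; congr (`|_| <= _); ring.
have g2 := l1_slow_sup e0 gC g1.
pose G := Num.sqrt (16 * C * e).
have G2 : G ^+ 2 = 16 * C * e by rewrite sqr_sqrtr// !mulr_ge0// ltW.
have G0 : 0 < G by rewrite sqrtr_gt0 !mulr_gt0.
have g3 x : `|f (x + 1) - f x| <= G.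
  rewrite -/(g x) -sqrtr_sqr ler_sqrt; last by rewrite !mulr_ge0// ltW.
  by have := g2 x; lra.
have := l1_slow_sup G0 fC g3 z => h.
have -> : f z ^+ 4 = (f z ^+ 2) ^+ 2 by rewrite -exprM.
apply: (@le_trans _ _ ((8 * C * G) ^+ 2)).
  by rewrite ler_sqr ?nnegrE ?sqr_ge0// !mulr_ge0// ltW.
by rewrite !exprMn G2; apply: ler_eq; ring.
Qed.

(** Bernoulli's inequality gives [x^j <= 1 / (j d)]; for [n = (m + 1) j] there are [m + 1] such
    factors against [m] powers of [n], which leaves order [1 / j]. *)
Lemma poly_geometric_small (x : R) m (e : R) : 0 <= x < 1 -> 0 < e ->
  exists2 n, (0 < n)%N & n%:R ^+ m * x ^+ n < e.
Proof.
move=> /andP[x0 x1] e0; have [->|xn] := eqVneq x 0.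
  by exists 1 => //; rewrite expr1 mulr0.
have xp : 0 < x by rewrite lt_neqAle eq_sym xn.
pose d := x^-1 - 1; have d0 : 0 < d by rewrite subr_gt0 invf_gt1.
have bern (j : nat) : j%:R * d <= x^-1 ^+ j.
  have -> : x^-1 = 1 + d by rewrite /d; ring.
  suff : 1 + j%:R * d <= (1 + d) ^+ j by lra.
  elim: j => [|j IH]; first by rewrite mul0r addr0 expr0.
  rewrite exprS -natr1; have h : 0 <= j%:R * d by rewrite mulr_ge0// ltW.
  by set J := j%:R in IH h *; set P := _ ^+ j in IH *; nra.
have e2 : 0 < e / 2 by lra.
have [j j0 hj] := div_nat_small ((m.+1)%:R ^+ m / d ^+ m.+1) e2.
have {}hj := hj _ (leqnn j).
exists (m.+1 * j)%N; first by lia.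
have jp : 0 < j%:R :> R by rewrite ltr0n.
apply: (@le_lt_trans _ _ (e / 2)); last by lra.
apply: le_trans hj; rewrite natrM exprMn.
have xj : x ^+ (m.+1 * j) <= (j%:R * d)^-1 ^+ m.+1.
  rewrite mulnC exprM; apply: lerXn2r; rewrite ?nnegrE ?exprn_ge0//.
    by rewrite invr_ge0 mulr_ge0// ltW.
  by rewrite -[leLHS]invrK lef_pV2 ?posrE ?invr_gt0 ?exprn_gt0 ?mulr_gt0// -exprVn.
apply: (@le_trans _ _ (m.+1%:R ^+ m * j%:R ^+ m * (j%:R * d)^-1 ^+ m.+1)).
  by rewrite ler_wpM2l// mulr_ge0// exprn_ge0.
apply: ler_eq; rewrite invfM exprMn !exprVn [j%:R ^+ m.+1]exprS.
by field; rewrite !expf_neq0 ?gt_eqF// ?andbT.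
Qed.

Variables (q : int -> R) (s2 : R).
Hypothesis Hq : step_law q s2.
Let q0 := step_ge0 Hq.

Definition al (k : nat) : nat -> int -> R := iter k (@lap R) (u q).

Lemma psd_al k : psd (al k).
Proof. by elim: k => [|k IH]; [exact: psd_u Hq|exact: psd_lap]. Qed.

Lemma al_opp k n z : al k n (- z) = al k n z.
Proof.
elim: k z => [|k IH] z; first exact: u_opp Hq n z.
rewrite /= /lap IH; have -> : - z + 1 = - (z - 1) by ring.
have -> : - z - 1 = - (z + 1) by ring.
by rewrite !IH; ring.
Qed.

Lemma bnd_al k n : bnd (al k n).
Proof.
elim: k => [|k IH]; first exact: bnd_u Hq n.
by apply: bndB; [apply: bndB; [exact: bndZ|]|]; exact: bnd_shift.
Qed.

Lemma al_step k n z : al k n.+1 z = Q q (al k n) z.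
Proof.
elim: k z => [|k IH] z //=; have b := bnd_al k n.
have b1 := bnd_shift 1 b; have b2 := bnd_shift (- 1) b; have b3 := bndZ 2 b.
rewrite /lap !IH /= (QB Hq)//; last exact: bndB.
by rewrite (QB Hq)// (QZ Hq)// !Q_shift.
Qed.

Lemma l1_al k n : l1 (al k n) (4 ^+ k).
Proof.
elim: k => [|k IH] /=.
  move=> s us; rewrite expr0; apply: le_trans (sum_u_le1 Hq n 0 us).
  by apply: ler_sum => y _; rewrite sub0r (u_opp Hq) ger0_norm// (u_ge0 Hq).
have := l1D (l1D (l1D IH IH) (l1N (l1_shift 1 IH))) (l1N (l1_shift (- 1) IH)).
rewrite exprS => h s us; have := h s us.
have -> : 4 ^+ k + 4 ^+ k + 4 ^+ k + 4 ^+ k = 4 * 4 ^+ k :> R by ring.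
by congr (_ <= _); apply: eq_bigr => y _; congr `|_|; rewrite /lap/=; ring.
Qed.

Definition alpha k r := al k (r + r) 0.

Lemma al_norm_le k r z : `|al k (r + r) z| <= alpha k r.
Proof. exact: psd_norm_le (psd_al k) (al_opp k) r z. Qed.

Lemma al_le k r z : al k (r + r) z <= alpha k r.
Proof. exact: le_trans (ler_norm _) (al_norm_le k r z). Qed.

Lemma al_step2 k r z : al k (r.+1 + r.+1) z = Q q (Q q (al k (r + r))) z.
Proof.
have -> : (r.+1 + r.+1 = (r + r).+2)%N by lia.
rewrite al_step; congr (Q q _ z); apply/funext => x; exact: al_step.
Qed.

Lemma alpha_noninc k r : alpha k r.+1 <= alpha k r.
Proof.
rewrite {1}/alpha al_step2 -[leRHS](Qn_cst Hq 2 _ 0).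
apply: (@Qn_le _ _ _ Hq 2) => [||y]; [exact: bnd_al|exact: bnd_cst|].
exact: al_le.
Qed.

(** The Laplacian of [al k (r + r)] is everywhere at most [alpha k.+1 r] in absolute value, so with
    the summability bound [4^k] a small [alpha k.+1 r] forces a small [alpha k r]. The loss is a
    fourth power, which multiplies the exponent by 4 at each [k]. *)
Lemma alpha_lower k : exists m c, 0 < c /\
  forall r, (0 < r)%N -> c <= r%:R ^+ m * alpha k r.
Proof.
elim: k => [|k [m [c [c0 hc]]]].
  have [c c0 hc] := u_diag_lower Hq; exists 1%N, c; split => // r r0.
  apply: (le_trans (hc r r0)); rewrite expr1 ler_wpM2l//.
  have U0 : 0 <= u q (r + r) 0 by exact: u_ge0 Hq _ _.
  have : u q (r + r) 0 <= 1.
    by have := @sum_u_le1 _ _ _ Hq (r + r) [:: 0] 0 isT; rewrite big_seq1 subrr.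
  by rewrite /alpha/=; nra.
pose C : R := 4 ^+ 5 * (4 ^+ k) ^+ 3; have C0 : 0 < C by rewrite mulr_gt0 ?exprn_gt0.
exists (m * 4)%N, (c ^+ 4 / C); split; first by rewrite divr_gt0// exprn_gt0.
move=> r r0; have rp : 0 < r%:R :> R by rewrite ltr0n.
have key e : 0 < e -> alpha k.+1 r <= e -> alpha k r ^+ 4 <= C * e.
  move=> e0 ae; apply: (l1_lap_sup e0 _ (@l1_al k (r + r))); first exact: exprn_gt0.
  by move=> z; apply: le_trans ae; exact: al_norm_le k.+1 r z.
have a0 : 0 <= alpha k.+1 r by exact: le_trans (normr_ge0 _) (al_norm_le _ _ 0).
have ak4 : alpha k r ^+ 4 <= C * alpha k.+1 r.
  (* The bound [key] needs a positive [e]; a vanishing [alpha k.+1 r] is treated with arbitrarily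
     small ones. *)
  have [a1|an] := eqVneq (alpha k.+1 r) 0; last first.
    by apply: key => //; rewrite lt_neqAle eq_sym an.
  rewrite a1 mulr0; apply/ler_addgt0Pr => e e0; rewrite add0r.
  have eC : 0 < e / C by exact: divr_gt0.
  have := key _ eC; rewrite a1 mulrCA divff ?gt_eqF// mulr1; apply; exact: ltW.
rewrite ler_pdivrMr// exprM.
apply: (@le_trans _ _ ((r%:R ^+ m * alpha k r) ^+ 4)).
  by apply: lerXn2r; rewrite ?nnegrE ?hc// ltW// (lt_le_trans c0 (hc r r0)).
by rewrite exprMn -[leRHS]mulrA ler_wpM2l ?exprn_ge0// [leRHS]mulrC.
Qed.

Lemma alpha_gt0 k r : 0 < alpha k r.
Proof.
have [m [c [c0 hc]]] := alpha_lower k.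
have h s : (0 < s)%N -> 0 < alpha k s.
  move=> s0; have sp : 0 < s%:R ^+ m :> R by rewrite exprn_gt0// ltr0n.
  by rewrite -(pmulr_rgt0 _ sp); exact: lt_le_trans (hc s s0).
case: r => [|r]; last exact: h.
exact: lt_le_trans (h 1%N isT) (alpha_noninc k 0).
Qed.

Lemma alpha_ratio k e : 0 < e ->
  exists r0, forall r, (r0 <= r)%N -> alpha k r - alpha k r.+1 <= e * alpha k r.
Proof.
wlog e1 : e / e < 1 => [hw e0|].
  have [e1|e1] := ltP e 1; first exact: hw.
  have [r0 hr0] : exists r0, forall r, (r0 <= r)%N ->
      alpha k r - alpha k r.+1 <= 1 / 2 * alpha k r by apply: hw; lra.
  exists r0 => r /hr0 h; apply: (le_trans h); rewrite ler_wpM2r//; last lra.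
  exact/ltW/alpha_gt0.
move=> e0.
have mono r : alpha k r.+1 * alpha k r.+1 <= alpha k r * alpha k r.+2.
  rewrite -expr2; apply: (@psd_logconvex _ _ (psd_al k)); exact: alpha_gt0 k r.+2.
have prop r : (1 - e) * alpha k r <= alpha k r.+1 ->
    (1 - e) * alpha k r.+1 <= alpha k r.+2.
  move=> h; have := mono r; have a0 := alpha_gt0 k r; have a1 := alpha_gt0 k r.+1.
  move=> hm; rewrite -(ler_pM2l a0); apply: le_trans hm; nra.
have [[r0 hr0]|hn] := pselect (exists r, (1 - e) * alpha k r <= alpha k r.+1).
  exists r0 => r rr0.
  suff : (1 - e) * alpha k r <= alpha k r.+1 by lra.
  by rewrite -(subnK rr0); elim: (r - r0)%N => // n; rewrite addSn; exact: prop.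
have dec r : alpha k r <= (1 - e) ^+ r * alpha k 0.
  elim: r => [|r IH]; first by rewrite expr0 mul1r.
  have : alpha k r.+1 < (1 - e) * alpha k r.
    by rewrite ltNge; apply/negP => h; apply: hn; exists r.
  rewrite exprS -mulrA => /ltW/le_trans; apply; rewrite ler_wpM2l//; lra.
have [m [c [c0 hc]]] := alpha_lower k.
have a0 := alpha_gt0 k 0.
have [||n n0] := @poly_geometric_small (1 - e) m (c / alpha k 0).
- by apply/andP; split; lra.
- exact: divr_gt0.
rewrite ltr_pdivlMr// => h; exfalso.
have := hc n n0; rewrite leNgt => /negP; apply; apply: le_lt_trans h.
by rewrite -mulrA ler_wpM2l// exprn_ge0.
Qed.

Hypothesis Hodd : exists l : seq int,
  [/\ odd (size l), (forall x, x \in l -> 0 < q x) & \sum_(x <- l) x = 0].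
Hypothesis Hgen : forall G : set int, G 0 ->
  (forall x y, G x -> G y -> G (x - y)) -> (forall z, 0 < q z -> G z) ->
  G = [set: int].

(** The sites with this property form a subgroup [G], closed under sums by [psd_triangle]. If [x]
    and [y] are steps of positive probability, then [x + y] lies in [G]: the mean of the nonnegative
    defect after two steps is [alpha k r - alpha k r.+1], negligible by [alpha_ratio]. *)
Lemma al_ratio k z e : 0 < e ->
  exists r0, forall r, (r0 <= r)%N -> alpha k r - al k (r + r) z <= e * alpha k r.
Proof.
pose G : set int := [set z | forall e, 0 < e ->
  exists r0, forall r, (r0 <= r)%N -> alpha k r - al k (r + r) z <= e * alpha k r].
suff GT : G = [set: int].
  by have Gz : G z by [rewrite GT]; exact: Gz.
have GD x y : G x -> G y -> G (x + y).
  move=> Gx Gy d d0; have d4 : 0 < d / 4 by lra.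
  have [r1 h1] := Gx _ d4; have [r2 h2] := Gy _ d4.
  exists (maxn r1 r2) => r; rewrite geq_max => /andP[/h1 {}h1 /h2 {}h2].
  have := @psd_triangle _ _ (psd_al k) (al_opp k) r x y.
  rewrite -/(alpha k r); lra.
have GN x : G x -> G (- x).
  by move=> Gx d /Gx[r0 h]; exists r0 => r /h; rewrite al_opp.
have G0 : G 0.
  move=> d d0; exists 0%N => r _; rewrite -/(alpha k r) subrr.
  by rewrite mulr_ge0 ?ltW// alpha_gt0.
have G2 x y : 0 < q x -> 0 < q y -> G (x + y).
  move=> qx qy d d0; have dq : 0 < d * (q x * q y) by rewrite !mulr_gt0.
  have [r0 h] := alpha_ratio k dq.
  exists r0 => r /h {}h.
  pose f z := alpha k r - al k (r + r) z.
  have bf : bnd f by apply: bndB; [exact: bnd_cst|exact: bnd_al].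
  have f0 t : 0 <= f t by rewrite subr_ge0 al_le.
  have hf : iter 2 (Q q) f 0 = alpha k r - alpha k r.+1.
    rewrite (QnB Hq); [|exact: bnd_cst|exact: bnd_al].
    by rewrite (Qn_cst Hq) /= -al_step2.
  have Qf0 t : 0 <= Q q f t.
    by have := Q_le Hq t (bnd_cst 0) bf f0; rewrite (Q_cst Hq).
  have t1 : q x * Q q f (0 + x) <= iter 2 (Q q) f 0.
    by apply: (Q_ge_term Hq) => //; exact: bndQ Hq _ bf.
  have t2 : q y * f (0 + x + y) <= Q q f (0 + x) by exact: (Q_ge_term Hq).
  rewrite !add0r in t1 t2.
  have qxy : 0 < q x * q y by exact: mulr_gt0.
  rewrite -/(f (x + y)) -(ler_pM2l qxy).
  apply: (@le_trans _ _ (alpha k r - alpha k r.+1)).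
    rewrite -hf; apply: le_trans t1; rewrite -mulrA ler_wpM2l//.
  apply: (le_trans h); apply: ler_eq; ring.
have Geven n (l : seq int) : size l = n.*2 -> (forall x, x \in l -> 0 < q x) ->
    G (\sum_(x <- l) x).
  elim: n l => [|n IH] [|x [|y l]]//= sl ql; first by rewrite big_nil.
  rewrite !big_cons addrA; apply: GD.
    by apply: G2; apply: ql; rewrite !inE eqxx ?orbT.
  by apply: IH => [|t tl]; [lia|apply: ql; rewrite !inE tl !orbT].
apply: Hgen => // [x y Gx Gy|x qx]; first by apply: GD => //; exact: GN.
(* Prepending [x] to an odd closed path gives an even number of steps with sum [x], so single steps
   lie in [G] too. *)
have [l [ol ql l0]] := Hodd.
have := Geven (uphalf (size l)) (x :: l); rewrite big_cons l0 addr0; apply.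
  by rewrite /= uphalfE -(odd_double_half (size l).+1) /= ol /=; lia.
by move=> y; rewrite inE => /orP[/eqP->//|/ql].
Qed.

(** By evenness [alpha k.+1 r] is twice the defect at the site 1. *)
Lemma alpha_succ_small k e : 0 < e ->
  exists r0, forall r, (r0 <= r)%N -> alpha k.+1 r <= e * alpha k r.
Proof.
move=> e0; have e2 : 0 < e / 2 by lra.
have [r0 h] := al_ratio k 1 e2.
exists r0 => r /h {}h; rewrite {1}/alpha/= /lap -/(alpha k r) add0r sub0r.
by rewrite al_opp; lra.
Qed.

End RatioLimits.

(** * Linear independence of the return kernels *)

Section ReturnKernel.
Variable R : realType.
Implicit Types q : int -> R.

Definition ev (l : seq (R * nat)) (f : nat -> R) := \sum_(a <- l) a.1 * f a.2.

(** A lag of zero would square one toss instead of multiplying two distinct ones. *)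
Definition pos_times (l : seq (R * nat)) := all (fun a : R * nat => 0 < a.2)%N l.

Definition evscale (c : R) (l : seq (R * nat)) := [seq (c * a.1, a.2) | a <- l].

Lemma ev_cat l l' f : ev (l ++ l') f = ev l f + ev l' f.
Proof. by rewrite /ev big_cat. Qed.

Lemma ev_scale c l f : ev (evscale c l) f = c * ev l f.
Proof.
rewrite /ev big_map mulr_sumr; apply: eq_bigr => a _ /=; by rewrite mulrA.
Qed.

Lemma ev_flatten ls f : ev (flatten ls) f = \sum_(l <- ls) ev l f.
Proof. by elim: ls => [|l ls IH]; rewrite ?big_cons -?IH /ev/= ?big_nil// big_cat. Qed.

Lemma pos_scale c l : pos_times (evscale c l) = pos_times l.
Proof. by rewrite /pos_times all_map. Qed.

Lemma pos_flatten ls : pos_times (flatten ls) = all pos_times ls.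
Proof. by elim: ls => //= l ls <-; rewrite /pos_times all_cat. Qed.

Definition lapf (f : int -> R) z := 2 * f z - f (z + 1) - f (z - 1).

Lemma iter_lapf_opp k f : (forall z, f (- z) = f z) ->
  forall z, iter k lapf f (- z) = iter k lapf f z.
Proof.
move=> ef; elim: k => [|k IH] z //=; rewrite /lapf IH.
have -> : - z + 1 = - (z - 1) by ring.
have -> : - z - 1 = - (z + 1) by ring.
by rewrite !IH; ring.
Qed.

Lemma iter_lapfB k f g z :
  iter k lapf (fun x => f x - g x) z = iter k lapf f z - iter k lapf g z.
Proof. by elim: k z => [|k IH] z //=; rewrite /lapf !IH; ring. Qed.

(** By induction [lapf f] vanishes on the smaller window; from [f 0 = 0] and evenness follows
    [f 1 = 0], and the second-order recurrence propagates the zeros outward. *)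
Lemma lapf_inj J f : (forall z, f (- z) = f z) ->
  (forall k, (k <= J)%N -> iter k lapf f 0 = 0) ->
  forall z : int, (`|z| <= J)%N -> f z = 0.
Proof.
elim: J f => [|J IH] f ef h.
  by move=> z z0; have -> : z = 0 by [lia]; exact: h 0%N isT.
have y0 : forall z : int, (`|z| <= J)%N -> lapf f z = 0.
  apply: IH; first exact: (iter_lapf_opp 1%N ef).
  by move=> k kJ; rewrite -iterSr; exact: h.
have f0 : f 0 = 0 by exact: h 0%N isT.
have f1 : f 1 = 0.
  have := y0 0 isT; rewrite /lapf f0 add0r sub0r ef; lra.
have fn (n : nat) : (n <= J.+1)%N -> f n%:Z = 0.
  elim/ltn_ind: n => -[|[|n]] IHn nJ //.
  have := y0 n.+1%:Z nJ; rewrite /lapf.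
  have -> : n.+1%:Z + 1 = n.+2%:Z by lia.
  have -> : n.+1%:Z - 1 = n%:Z by lia.
  rewrite (IHn n.+1) ?(IHn n); lia || lra.
move=> z zJ; have [z0|z0] := leP 0 z.
  have -> : z = `|z|%N%:Z by lia.
  exact: fn.
by rewrite -ef; have -> : - z = `|z|%N%:Z by [lia]; exact: fn.
Qed.

(** The properties of the even-time kernel on which the moment bounds rest. [rk_span] is the form in
    which linear independence is used. *)
Record return_kernel (w : nat -> int -> R) : Prop := ReturnKernel {
  rk_ge0 : forall t z, 0 <= w t z ;
  rk_opp : forall t z, w t (- z) = w t z ;
  rk_le : forall t z, w t z <= w t 0 ;
  rk_noninc : forall t, w t.+1 0 <= w t 0 ;
  rk_sum : forall t (s : seq int) z, uniq s -> \sum_(y <- s) w t (y - z) <= 1 ;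
  rk_ratio : forall a z e, 0 < e -> exists t0, forall t, (t0 <= t)%N ->
    `|w (t + a)%N z - w t 0| <= e * w t 0 ;
  rk_lower : exists2 c : R, 0 < c &
    forall t, (0 < t)%N -> c <= t%:R * w t 0 ^+ 2 ;
  rk_span : forall J (f : int -> R), (forall z, f (- z) = f z) ->
    exists2 l, pos_times l &
      forall z : int, (`|z| <= J)%N -> ev l (fun t => w t z) = f z }.

Variables (q : int -> R) (s2 : R).
Hypothesis Hq : step_law q s2.
Hypothesis Hodd : exists l : seq int,
  [/\ odd (size l), (forall x, x \in l -> 0 < q x) & \sum_(x <- l) x = 0].
Hypothesis Hgen : forall G : set int, G 0 ->
  (forall x y, G x -> G y -> G (x - y)) -> (forall z, 0 < q z -> G z) ->
  G = [set: int].

Lemma alpha_far_small k0 k e : 0 < e -> exists r0, forall r, (r0 <= r)%N ->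
  alpha q (k0 + k.+1) r <= e * alpha q k0 r.
Proof.
elim: k e => [|k IH] e e0; first by rewrite addn1; exact: (alpha_succ_small Hq Hodd Hgen).
have [r1 h1] := IH _ e0.
have [r2 h2] := alpha_succ_small Hq Hodd Hgen (k0 + k.+1) ltr01.
exists (maxn r1 r2) => r; rewrite geq_max => /andP[/h1 {}h1 /h2 {}h2].
by rewrite addnS; apply: (le_trans h2); rewrite mul1r.
Qed.

Lemma alpha_far_small_unif k0 n e : 0 < e -> exists2 r, (0 < r)%N &
  forall k, (k < n)%N -> alpha q (k0 + k.+1) r <= e * alpha q k0 r.
Proof.
move=> e0; suff [r0 h] : exists r0, forall r, (r0 <= r)%N -> forall k, (k < n)%N ->
    alpha q (k0 + k.+1) r <= e * alpha q k0 r.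
  by exists r0.+1 => // k kn; exact: h.
elim: n => [|n [r1 h1]]; first by exists 0%N.
have [r2 h2] := alpha_far_small k0 n e0.
exists (maxn r1 r2) => r; rewrite geq_max => /andP[/h1 {}h1 /h2 {}h2] k.
by rewrite ltnS leq_eqVlt => /orP[/eqP->//|/h1].
Qed.

(* The sequences [alpha k], [alpha (k+1)], ... decay at strictly increasing
   rates, so evaluation at one late time isolates the first of them. *)
Lemma alpha_span n k0 (v : nat -> R) : exists2 l, pos_times l &
  forall k, (k < n)%N -> ev l (alpha q (k0 + k)) = v k.
Proof.
elim: n k0 v => [|n IH] k0 v; first by exists [::].
have /choice[L hL] : forall k, exists l, pos_times l /\
    forall j, (j < n)%N -> ev l (alpha q (k0.+1 + j)) = (j == k)%:R.
  by move=> k; have [l pl hl] := IH k0.+1 (fun j => (j == k)%:R); exists l.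
pose X := \sum_(k <- iota 0 n) `|ev (L k) (alpha q k0)|.
have X0 : 0 <= X by exact: sumr_ge0.
(* This choice keeps the correction terms in [ev l0 (alpha q k0)] at most 1/2, so that this value
   cannot vanish. *)
pose e : R := (2 * (X + 1))^-1.
have e0 : 0 < e by rewrite invr_gt0; lra.
have [r r0 hr] := alpha_far_small_unif k0 n e0.
have a0 : 0 < alpha q k0 r := alpha_gt0 Hq k0 r.
pose eps k := alpha q (k0 + k.+1) r / alpha q k0 r.
have eps_e k : (k < n)%N -> `|eps k| <= e.
  move=> kn; rewrite ger0_norm; last by rewrite divr_ge0// ltW// (alpha_gt0 Hq).
  by rewrite ler_pdivrMr//; exact: hr.
(* Evaluation at [r], normalised on [alpha q k0], minus the dual functionals [L k] with the weights
   that annihilate the higher sequences. *)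
pose l0 := ((alpha q k0 r)^-1, r) ::
  flatten [seq evscale (- eps k) (L k) | k <- iota 0 n].
have pl0 : pos_times l0.
  rewrite /l0 /pos_times/= r0/= -/(pos_times _) pos_flatten all_map.
  by apply/allP => k _ /=; rewrite pos_scale; have [] := hL k.
have evl0 f : ev l0 f = f r / alpha q k0 r -
    \sum_(k <- iota 0 n) eps k * ev (L k) f.
  rewrite /l0 /ev big_cons/= -/(ev _ f) ev_flatten big_map mulrC; congr (_ + _).
  by rewrite -sumrN; apply: eq_bigr => k _; rewrite ev_scale mulNr.
have l0_0 j : (j < n)%N -> ev l0 (alpha q (k0.+1 + j)) = 0.
  move=> jn; rewrite evl0 (bigD1_seq j) ?mem_iota ?iota_uniq//=.
  rewrite (hL j).2// eqxx mulr1 big_seq_cond big1 ?addr0.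
    by rewrite addSnnS subrr.
  move=> k; rewrite mem_iota => /andP[_ kj]; rewrite (hL k).2//.
  by rewrite eq_sym (negbTE kj) mulr0.
have l0_1 : ev l0 (alpha q k0) != 0.
  rewrite evl0 divff ?(gt_eqF a0)// subr_eq0; apply/eqP => E.
  suff : 1 <= 1 / 2 :> R by lra.
  rewrite {1}E; apply: (@le_trans _ _ (\sum_(k <- iota 0 n) e * `|ev (L k) (alpha q k0)|)).
    rewrite big_seq [leRHS]big_seq; apply: ler_sum => k; rewrite mem_iota => kn.
    apply: le_trans (ler_norm _) _; rewrite normrM ler_wpM2r//; apply: eps_e; lia.
  rewrite -mulr_sumr -/X /e mulrC ler_pdivrMr; last by lra.
  lra.
have [l1 pl1 hl1] := IH k0.+1 (fun k => v k.+1).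
pose c := (v 0%N - ev l1 (alpha q k0)) / ev l0 (alpha q k0).
exists (l1 ++ evscale c l0).
  by rewrite /pos_times all_cat -!/(pos_times _) pos_scale pl1.
move=> [_|k kn]; rewrite ev_cat ev_scale.
  by rewrite addn0 /c divfK// addrC subrK.
by rewrite -addSnnS hl1// l0_0// mulr0 addr0.
Qed.

(** It suffices to match the iterated Laplacians of [f] at [0], which [alpha_span] allows: by
    [lapf_inj] they determine an even function on the window. *)
Lemma u2_span J f : (forall z, f (- z) = f z) -> exists2 l, pos_times l &
  forall z : int, (`|z| <= J)%N -> ev l (fun t => u q (t + t) z) = f z.
Proof.
move=> ef; have [l pl hl] := alpha_span J.+1 0 (fun k => iter k lapf f 0).
exists l => // z zJ.
pose U z := ev l (fun t => u q (t + t) z).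
have eU x : U (- x) = U x.
  by apply: eq_bigr => a _; rewrite (u_opp Hq).
have itU k x : iter k lapf U x = ev l (fun t => al q k (t + t) x).
  elim: k x => [|k IH] x //=; rewrite /lapf !IH /ev mulr_sumr -!sumrB.
  by apply: eq_bigr => a _; rewrite /lap; ring.
apply/eqP; rewrite -subr_eq0; apply/eqP.
apply: (@lapf_inj J (fun x => U x - f x)) zJ => [x|k kJ]; first by rewrite eU ef.
by rewrite iter_lapfB itU -(hl k)// subrr.
Qed.

Lemma u2_ratio0 a e : 0 < e -> exists t0, forall t, (t0 <= t)%N ->
  u q (t + t) 0 - u q ((t + a) + (t + a)) 0 <= e * u q (t + t) 0.
Proof.
elim: a e => [|a IH] e e0.
  exists 0%N => t _; rewrite !addn0 subrr mulr_ge0 ?(ltW e0)//.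
  exact: u_ge0 Hq _ _.
have e2 : 0 < e / 2 by lra.
have [t1 h1] := IH _ e2; have [t2 h2] := alpha_ratio Hq 0 e2.
exists (maxn t1 t2) => t; rewrite geq_max => /andP[/h1 {}h1 tt].
have := h2 (t + a)%N (leq_trans tt (leq_addr _ _)); rewrite addnS.
have : alpha q 0 (t + a) <= alpha q 0 t.
  by elim: (a) => [|b IHb]; rewrite ?addn0// addnS;
    apply: le_trans IHb; exact: (alpha_noninc Hq).
rewrite /alpha /al/=; nra.
Qed.

Lemma return_kernel_u2 : return_kernel (fun t => u q (t + t)).
Proof.
split.
- by move=> t z; exact: u_ge0 Hq _ _.
- by move=> t z; exact: u_opp Hq _ _.
- by move=> t z; exact: al_le Hq 0 t z.
- by move=> t; exact: alpha_noninc Hq 0 t.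
- move=> t s z us; apply: le_trans (sum_u_le1 Hq (t + t) z us).
  by apply: ler_sum => y _; rewrite -(u_opp Hq) opprB.
- move=> a z e e0; have e2 : 0 < e / 2 by lra.
  have [t1 h1] := u2_ratio0 a e2.
  have [t2 h2] := al_ratio Hq Hodd Hgen 0 z e2.
  exists (maxn t1 t2) => t; rewrite geq_max => /andP[/h1 {}h1 tt].
  have := h2 (t + a)%N (leq_trans tt (leq_addr _ _)).
  have : alpha q 0 (t + a) <= alpha q 0 t.
    by elim: (a) => [|b IHb]; rewrite ?addn0// addnS;
      apply: le_trans IHb; exact: (alpha_noninc Hq).
  have := al_le Hq 0 (t + a) z.
  have := alpha_gt0 Hq 0 t.
  rewrite /alpha /al/= ler_norml => *; apply/andP; split; nra.
- exact: u_diag_lower Hq.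
- exact: u2_span.
Qed.

End ReturnKernel.

(** * Expectations of products of tosses *)

Section TossExpectation.
Variable R : realType.
Implicit Types q th : int -> R.

Definition tossw th (b : bool) (z : int) : R := (1 + sgnb R b * th z) / 2.

(* Expectation of [f] applied to the next [n] tosses, for a walk now at [z]. *)
Fixpoint tossE q th (n : nat) (f : seq bool -> R) (z : int) : R :=
  match n with
  | 0 => f [::]
  | m.+1 => Q q (fun y => tossw th true y * tossE q th m (fun xs => f (true :: xs)) y
      + tossw th false y * tossE q th m (fun xs => f (false :: xs)) y) z
  end.

(* Times are counted in double steps: [mong [:: g1; g2; ...]] multiplies the
   tosses at times [2 g1], [2 (g1 + g2)], ..., toss number [i] having index
   [i - 1]. *)
Fixpoint mong (gs : seq nat) (xs : seq bool) : R :=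
  match gs with
  | [::] => 1
  | g :: gs' => sgnb R (nth false xs (g + g).-1) * mong gs' (drop (g + g) xs)
  end.

Fixpoint mom (w : nat -> int -> R) th (L : nat) (gs : seq nat) (z : int) : R :=
  match gs with
  | [::] => 1
  | g :: gs' => \sum_(y <- zr L) w g (y - z) * (th y * mom w th L gs' y)
  end.

Variables (q : int -> R) (s2 : R) (th : int -> R).
Hypothesis Hq : step_law q s2.
Hypothesis th01 : forall z, 0 <= th z <= 1.

Local Notation E := (tossE q th).
Local Notation bias := (tossw th).

Lemma bias_ge0 b z : 0 <= bias b z.
Proof. by have := th01 z; rewrite /tossw /sgnb; case: b; lra. Qed.

Lemma biasD z : bias true z + bias false z = 1.
Proof. by rewrite /tossw /sgnb; field. Qed.

Lemma bnd_bias b : bnd (bias b).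
Proof.
exists 1 => z; rewrite ger0_norm ?bias_ge0//; have := th01 z.
by rewrite /tossw /sgnb; case: b; lra.
Qed.

Lemma bndE n f : bnd (E n f).
Proof.
elim: n f => [|n IH] f /=; first exact: bnd_cst.
by apply: (bndQ Hq); apply: bndD; apply: bndM => //; exact: bnd_bias.
Qed.

Lemma bndE1 n f b : bnd (fun y => bias b y * E n f y).
Proof. by apply: bndM; [exact: bnd_bias|exact: bndE]. Qed.

Lemma E_ext n f g z : (forall xs, size xs = n -> f xs = g xs) ->
  E n f z = E n g z.
Proof.
elim: n f g z => [|n IH] f g z fg /=; first exact: fg.
by congr (Q q _ z); apply/funext => y; congr (_ * _ + _ * _);
  apply: IH => xs xn; apply: fg; rewrite /= xn.
Qed.

Lemma E_le n f g z : (forall xs, size xs = n -> f xs <= g xs) ->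
  E n f z <= E n g z.
Proof.
elim: n f g z => [|n IH] f g z fg /=; first exact: fg.
apply: (Q_le Hq) => [||y]; [exact: bndD (bndE1 _ _ _) (bndE1 _ _ _)..|].
by rewrite lerD// ler_wpM2l ?bias_ge0//; apply: IH => xs xn; apply: fg; rewrite /= xn.
Qed.

Lemma ED n f g z : E n (fun xs => f xs + g xs) z = E n f z + E n g z.
Proof.
elim: n f g z => [|n IH] f g z //=.
rewrite -(QD Hq); [|exact: bndD (bndE1 _ _ _) (bndE1 _ _ _)..].
by congr (Q q _ z); apply/funext => y; rewrite !IH; ring.
Qed.

Lemma EZ n c f z : E n (fun xs => c * f xs) z = c * E n f z.
Proof.
elim: n f z => [|n IH] f z //=.
rewrite -(QZ Hq); last exact: bndD (bndE1 _ _ _) (bndE1 _ _ _).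
by congr (Q q _ z); apply/funext => y; rewrite !IH; ring.
Qed.

Lemma E_cst n c z : E n (fun=> c) z = c.
Proof.
elim: n z => [|n IH] z //=; rewrite -[RHS](Q_cst Hq c z).
congr (Q q _ z); apply/funext => y.
by rewrite !IH -mulrDl biasD mul1r.
Qed.

Lemma E_sum n (I : Type) (s : seq I) (F : I -> seq bool -> R) z :
  E n (fun xs => \sum_(i <- s) F i xs) z = \sum_(i <- s) E n (F i) z.
Proof.
elim: s => [|i s IH].
  rewrite big_nil -[RHS](E_cst n 0 z); apply: E_ext => xs _.
  by rewrite big_nil.
rewrite big_cons -IH -ED; apply: E_ext => xs _; by rewrite big_cons.
Qed.

(** Tosses that are not read are summed out, their two weights adding to 1; the toss that is read
    contributes [th] at the current site, and the rest restarts from there. *)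
Lemma E_sgn m n f z :
  E (m.+1 + n) (fun xs => sgnb R (nth false xs m) * f (drop m.+1 xs)) z =
  iter m.+1 (Q q) (fun y => th y * E n f y) z.
Proof.
elim: m z => [|m IH] z.
  rewrite add1n /=; congr (Q q _ z); apply/funext => y.
  rewrite -[E n f y]mul1r.
  have hb c : E n (fun xs => c * f (drop 0 xs)) y = c * E n f y.
    by rewrite -EZ; apply: E_ext => xs _; rewrite drop0.
  by rewrite !hb /tossw /sgnb; field.
rewrite addSn /= -[in RHS]iterS; congr (Q q _ z); apply/funext => y.
by rewrite -[RHS]IH -[RHS]mul1r -(biasD y) mulrDl.
Qed.

Variable L : nat.
Hypothesis thL : forall z : int, (L < `|z|)%N -> th z = 0.

Lemma E_mong n gs z : all (leq 1) gs -> (2 * sumn gs <= n)%N ->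
  E n (mong gs) z = mom (fun t => u q (t + t)) th L gs z.
Proof.
elim: gs n z => [|g gs IH] n z /=; first by rewrite E_cst.
move=> /andP[g0 gs0] gn.
have -> : n = ((g + g).-1.+1 + (n - (g + g)))%N by lia.
rewrite (_ : (fun xs => _) = fun xs => sgnb R (nth false xs (g + g).-1) *
   mong gs (drop (g + g).-1.+1 xs)); last first.
  by apply/funext => xs; rewrite prednK//; lia.
rewrite E_sgn prednK; last by lia.
rewrite (Qn_finsupp Hq _ _ (zr_uniq L)); last first.
  by move=> x; rewrite mem_zr -ltnNge => /thL ->; rewrite mul0r.
apply: eq_bigr => y _; rewrite -(u_opp Hq) opprB IH//; lia.
Qed.

Lemma size_mong_bound gs xs : `|mong gs xs| <= 1.
Proof.
elim: gs xs => [|g gs IH] xs /=; first by rewrite normr1.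
rewrite normrM mulr_ile1//; rewrite /sgnb; case: ifP => _; rewrite ?normrN normr1//.
Qed.

End TossExpectation.

Section MongProduct.
Variable R : realType.

Lemma mong_drop g (gs : seq nat) h xs : (0 < g)%N ->
  mong R (g :: gs) (drop (h + h) xs) = mong R ((h + g)%N :: gs) xs.
Proof.
move=> g0 /=; rewrite nth_drop drop_drop; congr (sgnb R (nth _ _ _) * mong R _ (drop _ _)).
  by lia.
by lia.
Qed.

(** If the second product starts after the last toss of the first, only the gap between them
    changes. Correlations thus become single moments. *)
Lemma mong_mul gs t rs xs : (sumn gs < t)%N ->
  mong R gs xs * mong R (t :: rs) xs = mong R (gs ++ (t - sumn gs)%N :: rs) xs.
Proof.
elim: gs t xs => [|g gs IH] t xs tg; first by rewrite mul1r subn0.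
have tE : t = (g + (t - g))%N by move: tg => /=; lia.
rewrite {1}tE -mong_drop; last by move: tg => /=; lia.
rewrite /= -mulrA; congr (_ * _); rewrite IH; last by move: tg => /=; lia.
by congr (mong R (_ ++ _ :: _) _); lia.
Qed.

End MongProduct.

(** * The law of a finite stretch of tosses *)

Section TossLaw.
Variables (R : realType) (q : int -> R) (s2 : R) (th : int -> R).
Hypothesis Hq : step_law q s2.
Hypothesis th01 : forall z, 0 <= th z <= 1.
Variables (d : measure_display) (Omega : measurableType d) (P : probability Omega R).
Variables (S : Omega -> nat -> int) (X : Omega -> nat -> bool).
Hypothesis HP : walk_coin_law P q th S X.

Let mS k s : measurable [set w | S w k = s] := HP.1 k s.
Let mX k b : measurable [set w | X w k = b] := HP.2.1 k b.

Lemma measurable_tosses a n (B : pred (seq bool)) :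
  measurable [set w | B [seq X w i | i <- iota a n]].
Proof.
elim: n a B => [|n IH] a B.
  case Bn : (B [::]); first by rewrite [X in measurable X](_ : _ = setT)//;
    apply/seteqP; split => w //=; rewrite Bn.
  by rewrite [X in measurable X](_ : _ = set0)//;
    apply/seteqP; split => w //=; rewrite Bn.
rewrite [X in measurable X](_ : _ =
  ([set w | X w a = true] `&` [set w | B (true :: [seq X w i | i <- iota a.+1 n])]) `|`
  ([set w | X w a = false] `&` [set w | B (false :: [seq X w i | i <- iota a.+1 n])])).
  apply: measurableU; apply: measurableI => //.
    exact: (IH a.+1 (fun xs => B (true :: xs))).
  exact: (IH a.+1 (fun xs => B (false :: xs))).
apply/seteqP; split => w /=.
  by case: (X w a) => h; [left|right].
by case=> -[->].
Qed.

Definition prefix_event (m : nat) (s : nat -> int) (x : nat -> bool) : set Omega :=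
  [set w | forall k, (k <= m)%N -> S w k = s k /\ X w k = x k].

Lemma measurable_prefix_event m s x : measurable (prefix_event m s x).
Proof.
elim: m => [|m IH].
  rewrite [X in measurable X](_ : _ = [set w | S w 0%N = s 0%N] `&` [set w | X w 0%N = x 0%N]).
    exact: measurableI.
  apply/seteqP; split => w /=; first by move=> /(_ 0%N isT).
  by move=> [h1 h2] [|k].
rewrite [X in measurable X](_ : _ = prefix_event m s x `&`
   ([set w | S w m.+1 = s m.+1] `&` [set w | X w m.+1 = x m.+1])).
  by apply: measurableI => //; exact: measurableI.
apply/seteqP; split => w /=.
  by move=> h; split => [k km|]; apply: h => //; exact: leqW.
move=> [h1 h2] k; rewrite leq_eqVlt => /orP[/eqP ->//|]; exact: h1.
Qed.

Definition prefix_weight (m : nat) (s : nat -> int) (x : nat -> bool) : R :=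
  (s 0%N == 0)%:R * \prod_(k < m) q (s k.+1 - s k) *
  \prod_(k < m.+1) tossw th (x k) (s k).

Definition upd (T : Type) (s : nat -> T) m (y : T) k := if k == m then y else s k.

Lemma prefix_weightS m s x y b :
  prefix_weight m.+1 (upd s m.+1 y) (upd x m.+1 b) =
  prefix_weight m s x * (q (y - s m) * tossw th b y).
Proof.
rewrite /prefix_weight !big_ord_recr/= /upd !eqxx.
have -> : (m == m.+1) = false by lia.
have e1 : \prod_(i < m) q ((if i.+1 == m.+1 then y else s i.+1) -
    (if (i : nat) == m.+1 then y else s i)) = \prod_(i < m) q (s i.+1 - s i).
  apply: eq_bigr => i _; have := ltn_ord i => im.
  by rewrite !ifF//; lia.
have e2 : \prod_(i < m) tossw th (if (i : nat) == m.+1 then b else x i)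
    (if (i : nat) == m.+1 then y else s i) = \prod_(i < m) tossw th (x i) (s i).
  apply: eq_bigr => i _; have := ltn_ord i => im.
  by rewrite !ifF//; lia.
by rewrite e1 e2; ring.
Qed.

Lemma measure_finite_partition (A : set Omega) (V : Omega -> int) (s : seq int)
    (r : int -> R) : measurable A -> (forall y, measurable [set w | V w = y]) ->
  uniq s -> (forall y, P (A `&` [set w | V w = y]) = (r y)%:E) ->
  P (A `&` [set w | V w \in s]) = (\sum_(y <- s) r y)%:E.
Proof.
move=> mA mV + hr; elim: s => [_|y s IH /= /andP[ys us]].
  by rewrite big_nil [X in P X](_ : _ = set0) ?measure0//; apply/seteqP; split => w //= -[].
have mVs : measurable [set w | V w \in s].
  elim: s {IH ys us} => [|t s IH].
    by rewrite [X in measurable X](_ : _ = set0)//; apply/seteqP; split => w.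
  rewrite [X in measurable X](_ : _ = [set w | V w = t] `|` [set w | V w \in s]).
    exact: measurableU.
  apply/seteqP; split => w /=; rewrite inE.
    by move=> /orP[/eqP|]; [left|right].
  by case=> [->|->]; rewrite ?eqxx ?orbT.
rewrite big_cons EFinD -hr -IH//.
rewrite -measureU; [|exact: measurableI|exact: measurableI|].
  congr (P _); apply/seteqP; split => w /=; rewrite inE.
    by move=> [Aw /orP[/eqP|]]; [left|right].
  by case=> -[Aw ->]; rewrite ?eqxx ?orbT.
by apply/seteqP; split => w //= -[[_ ->] [_]]; rewrite (negbTE ys).
Qed.

(** Induction on the number of tosses to come: splitting by the next site and the next toss
    lengthens the prefix by one. The infinitely many sites are exhausted by windows, with continuity
    of [P] from below. *)
Lemma prob_prefix_tosses n m s x (B : pred (seq bool)) :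
  P (prefix_event m s x `&` [set w | B [seq X w i | i <- iota 1 (m + n)]]) =
  (prefix_weight m s x *
   tossE q th n (fun ys => (B ([seq x i | i <- iota 1 m] ++ ys))%:R) (s m))%:E.
Proof.
have pre t y w : prefix_event m t y w ->
    [seq X w i | i <- iota 1 m] = [seq y i | i <- iota 1 m].
  move=> h; apply/eq_in_map => i; rewrite mem_iota => im.
  by have [//|] := h i; lia.
elim: n m s x pre => [|n IH] m s x pre.
  rewrite addn0 /= cats0; case Bn : (B _).
    rewrite mulr1 [X in P X](_ : _ = prefix_event m s x); first exact: HP.2.2.
    apply/seteqP; split => w /=; first by case.
    by move=> h; split => //; rewrite (pre s x).
  rewrite mulr0 [X in P X](_ : _ = set0) ?measure0//.
  by apply/seteqP; split => w //= -[h]; rewrite (pre s x)// Bn.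
set A := prefix_event _ _ _ `&` _.
have mA : measurable A.
  by apply: measurableI; [exact: measurable_prefix_event|exact: measurable_tosses].
pose W := prefix_weight m s x.
pose g y := tossw th true y * tossE q th n
    (fun ys => (B ([seq x i | i <- iota 1 m] ++ true :: ys))%:R) y +
  tossw th false y * tossE q th n
    (fun ys => (B ([seq x i | i <- iota 1 m] ++ false :: ys))%:R) y.
have bg : bnd g.
  by apply: bndD; apply: (bndE1 Hq th01).
have slice b y : P (A `&` [set w | S w m.+1 = y] `&` [set w | X w m.+1 = b]) =
    (W * (q (y - s m) * (tossw th b y * tossE q th n
    (fun ys => (B ([seq x i | i <- iota 1 m] ++ b :: ys))%:R) y)))%:E.
  have pre' t z w : prefix_event m.+1 t z w ->
      [seq X w i | i <- iota 1 m.+1] = [seq z i | i <- iota 1 m.+1].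
    move=> h; apply/eq_in_map => i; rewrite mem_iota => im.
    by have [//|] := h i; lia.
  have := IH m.+1 (upd s m.+1 y) (upd x m.+1 b) pre'.
  rewrite prefix_weightS -/W (_ : upd s m.+1 y m.+1 = y); last by rewrite /upd eqxx.
  have -> : [seq upd x m.+1 b i | i <- iota 1 m.+1] =
      rcons [seq x i | i <- iota 1 m] b.
    have -> : iota 1 m.+1 = rcons (iota 1 m) m.+1.
      by rewrite -[m.+1]addn1 iotaD /= cats1 addnC.
    rewrite map_rcons {2}/upd eqxx; congr rcons.
    by apply/eq_in_map => i; rewrite mem_iota /upd => im; rewrite ifF//; lia.
  have -> : (fun ys => (B ([seq x i | i <- iota 1 m] ++ b :: ys))%:R) =
      (fun ys => (B (rcons [seq x i | i <- iota 1 m] b ++ ys))%:R) :> (seq bool -> R).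
    by apply/funext => ys; rewrite cat_rcons.
  move=> H; rewrite [q _ * (_ * _)]mulrA [W * (_ * _)]mulrA -H.
  rewrite addSnnS; congr (P _); apply/seteqP; split => w /=.
    move=> [[[h1 h2] h3] h4]; split => // k; rewrite /upd.
    case: eqP => [->//|kn] km; apply: h1; lia.
  move=> [h1 h2]; have := h1 m.+1 (leqnn _); rewrite /upd eqxx => -[h3 h4].
  do 3! split => //; move=> k km; have := h1 k (leqW km).
  by rewrite /upd (_ : (k == m.+1) = false)//; lia.
have slice2 y : P (A `&` [set w | S w m.+1 - s m = y]) = (W * (q y * g (s m + y)))%:E.
  have -> : A `&` [set w | S w m.+1 - s m = y] = A `&` [set w | S w m.+1 = s m + y].
    by apply/seteqP; split => w /= -[Aw h]; split => //; lia.
  have mAy : measurable (A `&` [set w | S w m.+1 = s m + y]) by exact: measurableI.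
  rewrite [X in P X](_ : _ =
    (A `&` [set w | S w m.+1 = s m + y] `&` [set w | X w m.+1 = true]) `|`
    (A `&` [set w | S w m.+1 = s m + y] `&` [set w | X w m.+1 = false])).
    have -> : (W * (q y * g (s m + y)))%:E = adde
        (P (A `&` [set w | S w m.+1 = s m + y] `&` [set w | X w m.+1 = true]))
        (P (A `&` [set w | S w m.+1 = s m + y] `&` [set w | X w m.+1 = false])).
      rewrite !slice; congr EFin.
      have -> : s m + y - s m = y by ring.
      by rewrite /g; ring.
    rewrite -[adde]/(@GRing.add (\bar R)) -measureU//; [exact: measurableI|exact: measurableI|].
    by apply/seteqP; split => w //= -[[_ ->] [_]].
  apply/seteqP; split => w /=.
    by move=> h; case: (X w m.+1); [left|right].
  by case=> -[].
pose F N := A `&` [set w | S w m.+1 - s m \in zr N].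
have mV y : measurable [set w | S w m.+1 - s m = y].
  rewrite [X in measurable X](_ : _ = [set w | S w m.+1 = s m + y])//.
  by apply/seteqP; split => w /= h; lia.
have PF N : P (F N) = (W * \sum_(y <- zr N) q y * g (s m + y))%:E.
  rewrite (measure_finite_partition mA mV (zr_uniq N) slice2).
  by rewrite mulr_sumr.
have mF N : measurable (F N).
  rewrite /F [X in measurable X](_ : _ = A `&` \bigcup_(y in [set` zr N]) [set w | S w m.+1 - s m = y]).
    apply: measurableI => //; apply: fin_bigcup_measurable => //; exact: finite_seq.
  apply/seteqP; split => w /= -[Aw h]; split => //; first by exists (S w m.+1 - s m).
  by case: h => y /= yN ->.
have UF : \bigcup_N F N = A.
  apply/seteqP; split => w; first by case=> N _ [].
  by move=> Aw; exists `|S w m.+1 - s m|%N => //; split => //=; rewrite mem_zr.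
have c1 : P (F N) @[N --> \oo] --> P A.
  rewrite -UF; apply: nondecreasing_cvg_mu => //; first by rewrite UF.
  move=> N M NM; apply/subsetPset => w [Aw] /=; rewrite mem_zr => h; split => //=.
  by rewrite mem_zr (leq_trans h).
have c2 : P (F N) @[N --> \oo] --> (W * Q q g (s m))%:E.
  under eq_fun do rewrite PF.
  apply: cvg_EFin; first exact: nearW.
  by apply: cvgM; [exact: cvg_cst|exact: (Q_cvg Hq)].
by rewrite (cvg_unique _ c1 c2).
Qed.

(** The toss at time 0 is not listed, so its two outcomes are summed out; the starting site is
    concentrated at [0]. *)
Lemma prob_tosses n (B : pred (seq bool)) :
  P [set w | B [seq X w i | i <- iota 1 n]] =
  (tossE q th n (fun ys => (B ys)%:R) 0)%:E.
Proof.
set A := [set w | _]; have mA : measurable A by exact: measurable_tosses.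
pose e := tossE q th n (fun ys => (B ys)%:R) 0.
have h s b : P (A `&` [set w | S w 0%N = s] `&` [set w | X w 0%N = b]) =
    ((s == 0)%:R * tossw th b s * e)%:E.
  have := prob_prefix_tosses n 0 (fun=> s) (fun=> b) B.
  rewrite /prefix_weight big_ord0 big_ord1 /= mulr1 => H.
  rewrite [X in P X](_ : _ = prefix_event 0 (fun=> s) (fun=> b) `&`
      [set w | B [seq X w i | i <- iota 1 (0 + n)]]).
    by rewrite H; have [->|] := eqVneq s 0; rewrite ?mul0r.
  apply/seteqP; split => w /=.
    by move=> [[h1 h2] h3]; split => // -[|].
  by move=> [h1 h2]; have [h3 h4] := h1 0%N isT.
have h2 s : P (A `&` [set w | S w 0%N = s]) = ((s == 0)%:R * e)%:E.
  have mAy : measurable (A `&` [set w | S w 0%N = s]) by exact: measurableI.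
  rewrite [X in P X](_ : _ = (A `&` [set w | S w 0%N = s] `&` [set w | X w 0%N = true]) `|`
    (A `&` [set w | S w 0%N = s] `&` [set w | X w 0%N = false])).
    have -> : ((s == 0)%:R * e)%:E =
        adde (P (A `&` [set w | S w 0%N = s] `&` [set w | X w 0%N = true]))
        (P (A `&` [set w | S w 0%N = s] `&` [set w | X w 0%N = false])).
      by rewrite !h; congr EFin; rewrite -mulrDl -mulrDr biasD mulr1.
    rewrite -[adde]/(@GRing.add (\bar R)) -measureU//; [exact: measurableI|exact: measurableI|].
    by apply/seteqP; split => w //= -[[_ ->] [_]].
  apply/seteqP; split => w /=; first by move=> hw; case: (X w 0%N); [left|right].
  by case=> -[].
have UF : \bigcup_N (A `&` [set w | S w 0%N \in zr N]) = A.
  apply/seteqP; split => w; first by case=> N _ [].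
  by move=> Aw; exists `|S w 0%N|%N => //; split => //=; rewrite mem_zr.
have PF N : P (A `&` [set w | S w 0%N \in zr N]) = e%:E.
  rewrite (@measure_finite_partition A (fun w => S w 0%N) (zr N) _ mA (mS 0%N) (zr_uniq N) h2).
  by rewrite (@sum_zr1 _ N 0 (fun=> e)).
have c1 : P (A `&` [set w | S w 0%N \in zr N]) @[N --> \oo] --> P A.
  rewrite -{2}UF; apply: nondecreasing_cvg_mu => //.
  - move=> N; apply: measurableI => //.
    rewrite [X in measurable X](_ : _ = \bigcup_(y in [set` zr N]) [set w | S w 0%N = y]).
      apply: fin_bigcup_measurable => //; exact: finite_seq.
    apply/seteqP; split => w /=; first by move=> hw; exists (S w 0%N).
    by case=> y /= yN ->.
  - by rewrite UF.
  - move=> N M NM; apply/subsetPset => w [Aw] /=; rewrite mem_zr => hw; split => //=.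
    by rewrite mem_zr (leq_trans hw).
have c2 : P (A `&` [set w | S w 0%N \in zr N]) @[N --> \oo] --> e%:E.
  by under eq_fun do rewrite PF; exact: cvg_cst.
by rewrite (cvg_unique _ c1 c2).
Qed.

End TossLaw.

(** * Law of large numbers for windows of tosses *)

Section MomentBounds.
Variable R : realType.
Variable w : nat -> int -> R.
Hypothesis Hw : return_kernel w.
Variable L : nat.

Definition admissible (th : int -> R) : Prop :=
  (forall z, 0 <= th z <= 1) /\ (forall z : int, (L < `|z|)%N -> th z = 0).

(** [mom] with a terminal function, so that the moment of a concatenation factors through the site
    where the first part ends. *)
Fixpoint momt th (gs : seq nat) (h : int -> R) (z : int) : R :=
  match gs with
  | [::] => h z
  | g :: gs' => \sum_(y <- zr L) w g (y - z) * (th y * momt th gs' h y)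
  end.

Definition card : R := (size (zr L))%:R.

(** The limit [A] of block averages: the first site carries counting measure, the local limit of the
    normalised law of the walk. *)
Definition total th rs : R := \sum_(y <- zr L) th y * mom w th L rs y.

Lemma mom_cat th gs rs z :
  mom w th L (gs ++ rs) z = momt th gs (mom w th L rs) z.
Proof.
by elim: gs z => //= g gs IH z; apply: eq_bigr => y _; rewrite IH.
Qed.

Lemma mom_momt th gs z : mom w th L gs z = momt th gs (fun=> 1) z.
Proof. by rewrite -[gs in LHS]cats0 mom_cat. Qed.

Lemma momtD th gs h g z :
  momt th gs (fun y => h y + g y) z = momt th gs h z + momt th gs g z.
Proof.
elim: gs z => //= a gs IH z; rewrite -big_split/=.
by apply: eq_bigr => y _; rewrite IH; ring.
Qed.

Lemma momtZ th gs c h z :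
  momt th gs (fun y => c * h y) z = c * momt th gs h z.
Proof.
elim: gs z => //= a gs IH z; rewrite mulr_sumr.
by apply: eq_bigr => y _; rewrite IH; ring.
Qed.

Lemma momt_ext th gs h g z : (forall y, h y = g y) ->
  momt th gs h z = momt th gs g z.
Proof. by move=> hg; congr momt; apply/funext. Qed.

Lemma momt_sum (I : Type) (s : seq I) th gs (h : I -> int -> R) z :
  momt th gs (fun y => \sum_(i <- s) h i y) z = \sum_(i <- s) momt th gs (h i) z.
Proof.
elim: s => [|i s IH].
  rewrite big_nil; transitivity (momt th gs (fun y => 0 * 1) z).
    by apply: momt_ext => y; rewrite big_nil mul0r.
  by rewrite (momtZ th gs 0 (fun=> 1)) mul0r.
rewrite big_cons -IH -momtD; apply: momt_ext => y; by rewrite big_cons.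
Qed.

Lemma card_ge0 : 0 <= card.
Proof. by []. Qed.

Lemma sum_zr_le_card (f : int -> R) c : (forall y, y \in zr L -> f y <= c) ->
  \sum_(y <- zr L) f y <= card * c.
Proof.
move=> fc; apply: (@le_trans _ _ (\sum_(y <- zr L) c)).
  by rewrite big_seq [leRHS]big_seq; exact: ler_sum.
by rewrite big_const_seq count_predT iter_addr_0 /card [leRHS]mulr_natl.
Qed.

Lemma kernel_le1 t z : w t z <= 1.
Proof. by have := @rk_sum _ _ Hw t [:: z] 0 isT; rewrite big_seq1 subr0. Qed.

Lemma kernel_le t t' : (t <= t')%N -> w t' 0 <= w t 0.
Proof.
move=> tt; rewrite -(subnK tt); elim: (t' - t)%N => // n; rewrite addSn.
by apply: le_trans; exact: rk_noninc Hw _.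
Qed.

Section OneScenery.
Variable th : int -> R.
Hypothesis Hth : admissible th.

Let th0 z : 0 <= th z. Proof. by have /andP[] := Hth.1 z. Qed.
Let th1 z : th z <= 1. Proof. by have /andP[] := Hth.1 z. Qed.

(** Each layer is a sub-Markov kernel times a factor in [[0, 1]], hence a contraction for the sup
    norm on the window. *)
Lemma momt_norm_le gs h M z : (forall y, y \in zr L -> `|h y| <= M) ->
  z \in zr L -> `|momt th gs h z| <= M.
Proof.
move=> hM zL; elim: gs z zL => [|g gs IH] z zL /=; first exact: hM.
have M0 : 0 <= M by apply: le_trans (hM z zL).
apply: (@le_trans _ _ (\sum_(y <- zr L) w g (y - z) * M)); last first.
  by rewrite -mulr_suml ler_piMl// (rk_sum Hw)// zr_uniq.
apply: le_trans (ler_norm_sum _ _ _) _.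
rewrite big_seq [leRHS]big_seq; apply: ler_sum => y yL.
rewrite !normrM (ger0_norm (rk_ge0 Hw _ _)) ler_wpM2l ?(rk_ge0 Hw)//.
by rewrite (ger0_norm (th0 y)) -[leRHS]mul1r ler_pM// IH.
Qed.

Lemma mom_ge0 gs z : 0 <= mom w th L gs z.
Proof.
elim: gs z => //= g gs IH z; apply: sumr_ge0 => y _.
by rewrite !mulr_ge0// (rk_ge0 Hw).
Qed.

Lemma mom_le1 gs z : mom w th L gs z <= 1.
Proof.
elim: gs z => //= g gs IH z.
apply: le_trans (@rk_sum _ _ Hw g _ z (zr_uniq L)).
by apply: ler_sum => y _; rewrite ler_piMr ?(rk_ge0 Hw)// mulr_ile1// mom_ge0.
Qed.

Lemma total_ge0 rs : 0 <= total th rs.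
Proof. by apply: sumr_ge0 => y _; rewrite mulr_ge0// mom_ge0. Qed.

Lemma total_le rs : total th rs <= card.
Proof.
rewrite -[leRHS]mulr1; apply: sum_zr_le_card => y _.
by rewrite mulr_ile1// ?mom_ge0// mom_le1.
Qed.

Lemma mom_cons_le g gs M z : (forall y, y \in zr L -> mom w th L gs y <= M) ->
  0 <= M -> mom w th L (g :: gs) z <= card * (w g 0 * M).
Proof.
move=> hM M0; apply: sum_zr_le_card => y yL.
apply: ler_pM; rewrite ?mulr_ge0 ?mom_ge0 ?(rk_ge0 Hw) ?(rk_le Hw)//.
by rewrite -[leRHS]mul1r ler_pM ?mom_ge0// hM.
Qed.

(** Only the long gaps [t] and [g] are charged a factor [card * w _ 0]; the short lags in [rs]
    contract. *)
Lemma mom_pair_le t g rs z :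
  mom w th L (t :: rs ++ g :: rs) z <= card ^+ 2 * (w t 0 * w g 0).
Proof.
apply: le_trans (_ : card * (w t 0 * (card * (w g 0 * 1))) <= _).
  have gM y : mom w th L (g :: rs) y <= card * (w g 0 * 1).
    by apply: mom_cons_le => // x _; exact: mom_le1.
  have cM : 0 <= card * (w g 0 * 1) by rewrite mulr1 mulr_ge0 ?card_ge0// (rk_ge0 Hw).
  apply: mom_cons_le => // y yL.
  rewrite mom_cat; apply: le_trans (ler_norm _) _.
  apply: momt_norm_le => // x xL; rewrite ger0_norm//; exact: mom_ge0 (g :: rs) x.
by apply: ler_eq; ring.
Qed.

End OneScenery.

Lemma eventually_all (I : eqType) (l : seq I) (Pr : I -> nat -> Prop) :
  (forall i, exists N0, forall N, (N0 <= N)%N -> Pr i N) ->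
  exists N0, forall N, (N0 <= N)%N -> forall i, i \in l -> Pr i N.
Proof.
move=> H; elim: l => [|i l [N1 h1]]; first by exists 0%N.
have [N2 h2] := H i; exists (maxn N1 N2) => N; rewrite geq_max => /andP[hN1 hN2] j.
by rewrite inE => /orP[/eqP->|jl]; [exact: h2|exact: h1].
Qed.

(** * Renewal sums of the return probabilities *)

Section RenewalSums.
Variable p : nat.
Hypothesis p0 : (0 < p)%N.

Definition kap s := w (p * s) 0.
Definition Ksum N := \sum_(1 <= s < N.+1) kap s.

Lemma kap_ge0 s : 0 <= kap s. Proof. exact: rk_ge0 Hw _ _. Qed.
Lemma kap_le1 s : kap s <= 1. Proof. exact: kernel_le1. Qed.

Lemma Ksum_ge0 N : 0 <= Ksum N.
Proof. by apply: sumr_ge0 => s _; exact: kap_ge0. Qed.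

(** As [kap] is nonincreasing, [Ksum N] is at least [N * kap N]; [rk_lower] is used at time [p * N],
    which costs the factor [p]. *)
Lemma Ksum_lower : exists2 c : R, 0 < c & forall N, c * N%:R <= Ksum N ^+ 2.
Proof.
have [c c0 hc] := rk_lower Hw.
have pR : 0 < p%:R :> R by rewrite ltr0n.
exists (c / p%:R); first exact: divr_gt0.
case=> [|N]; first by rewrite mulr0 sqr_ge0.
have h1 : N.+1%:R * kap N.+1 <= Ksum N.+1.
  have -> : N.+1%:R * kap N.+1 = \sum_(1 <= s < N.+2) kap N.+1.
    by rewrite sumr_const_nat subn1 mulr_natl.
  rewrite /Ksum !big_nat; apply: ler_sum => s /andP[s1 sN].
  by apply: kernel_le; rewrite leq_mul2l -ltnS sN orbT.
have := hc (p * N.+1)%N; rewrite muln_gt0 p0 => /(_ isT); rewrite -/(kap _).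
rewrite natrM => h2; set M := N.+1%:R in h1 h2 *.
have M0 : 0 < M by rewrite ltr0n.
apply: (@le_trans _ _ ((M * kap N.+1) ^+ 2)).
  rewrite mulrAC ler_pdivrMr// exprMn expr2; set k2 := kap _ ^+ 2 in h2 *.
  by have := ler_wpM2l (ltW M0) h2; lra.
by apply: lerXn2r; rewrite ?nnegrE ?Ksum_ge0 ?mulr_ge0 ?kap_ge0 ?(ltW M0).
Qed.

Lemma Ksum_gt0 N : (0 < N)%N -> 0 < Ksum N.
Proof.
move=> N0; have [c c0 hc] := Ksum_lower.
rewrite lt_neqAle Ksum_ge0 andbT eq_sym; apply/eqP => K0.
have := hc N; rewrite K0 expr0n/=; apply/negP; rewrite -ltNge mulr_gt0// ltr0n//.
Qed.

Lemma Ksum_large (C e : R) : 0 < e ->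
  exists N0, forall N, (N0 <= N)%N -> C <= e * Ksum N.
Proof.
move=> e0; have [c c0 hc] := Ksum_lower.
have ec : 0 < e ^+ 2 * c by rewrite mulr_gt0// exprn_gt0.
exists (Num.bound (C ^+ 2 / (e ^+ 2 * c))) => N NN.
have h : C ^+ 2 <= e ^+ 2 * c * N%:R.
  rewrite -ler_pdivrMl// mulrC; apply: (@le_trans _ _ (Num.bound (C ^+ 2 / (e ^+ 2 * c)))%:R).
    by apply/ltW/archi_boundP; rewrite divr_ge0 ?sqr_ge0// ltW.
  by rewrite ler_nat.
have [C0|C0] := leP C 0.
  by apply: le_trans C0 _; rewrite mulr_ge0 ?Ksum_ge0// ltW.
rewrite -ler_sqr ?nnegrE ?mulr_ge0 ?Ksum_ge0 ?(ltW e0) ?(ltW C0)//.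
apply: (le_trans h); rewrite exprMn -mulrA ler_wpM2l ?sqr_ge0//.
Qed.

(** A Cesaro argument weighted by [kap]: before [t0] each term errs by at most 1, in total at most
    [t0], negligible against the diverging [Ksum N]. *)
Lemma avg_ratio a x e : 0 < e -> exists N0, forall N, (N0 <= N)%N ->
  (0 < N)%N /\
  `|(Ksum N)^-1 * (\sum_(1 <= s < N.+1) w (p * s + a)%N x) - 1| <= e.
Proof.
move=> e0; have e2 : 0 < e / 2 by lra.
have [t0 h0] := rk_ratio Hw a x e2.
have [N1 h1] := Ksum_large t0%:R e2.
exists N1.+1 => N NN; have N0 : (0 < N)%N by lia.
split => //; have K0 := Ksum_gt0 N0.
suff : `|\sum_(1 <= s < N.+1) w (p * s + a)%N x - Ksum N| <= e * Ksum N.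
  move=> h; rewrite -[X in _ - X](mulVf (lt0r_neq0 K0)) -mulrBr normrM.
  by rewrite (gtr0_norm (_ : 0 < (Ksum N)^-1)) ?invr_gt0// mulrC ler_pdivrMr.
rewrite /Ksum -sumrB.
have tot : \sum_(1 <= s < N.+1) (s < t0)%:R <= t0%:R :> R.
  have : (\sum_(1 <= s < N.+1) (s < t0)%N <= minn t0 N)%N.
    elim: N {NN N0 K0} => [|N IH]; first by rewrite big_geq.
    by rewrite big_nat_recr//=; case: (ltnP N.+1 t0) => h /=; lia.
  by move=> h; rewrite -natr_sum ler_nat; apply: leq_trans h _; exact: geq_minl.
apply: le_trans (ler_norm_sum _ _ _) _.
apply: (@le_trans _ _ (\sum_(1 <= s < N.+1) ((s < t0)%:R + e / 2 * kap s))).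
  rewrite !big_nat; apply: ler_sum => s /andP[s1 sN].
  have k0 : 0 <= e / 2 * kap s by rewrite mulr_ge0 ?kap_ge0// ltW.
  case: ltnP => st /=.
    apply: (@le_trans _ _ 1); last by lra.
    rewrite ler_norml; have := rk_ge0 Hw (p * s + a)%N x.
    have := kernel_le1 (p * s + a)%N x; have := kap_ge0 s; have := kap_le1 s; lra.
  rewrite add0r; apply: h0; apply: leq_trans st _; exact: leq_pmull.
rewrite big_split/= -mulr_sumr -/(Ksum N).
have := h1 N (ltnW NN); lra.
Qed.

Lemma kap_shift_sum_le N s : (s <= N)%N ->
  \sum_(1 <= s' < N.+1 | (s < s')%N) kap (s' - s - 1)%N <= 1 + Ksum N.
Proof.
move=> sN; rewrite (@big_cat_nat _ _ _ s.+1)//= big1_seq ?add0r; last first.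
  by move=> i /andP[h]; rewrite mem_index_iota; lia.
rewrite (_ : \sum_(s.+1 <= i < N.+1 | (s < i)%N) kap (i - s - 1)%N =
  \sum_(0 <= j < N - s) kap j).
  apply: (@le_trans _ _ (\sum_(0 <= j < N.+1) kap j)).
    rewrite [leRHS](@big_cat_nat _ _ _ (N - s))//=; last by lia.
    by rewrite lerDl sumr_ge0// => j _; exact: kap_ge0.
  by rewrite big_ltn// lerD2r kap_le1.
rewrite -{1}[s.+1]add0n big_addn; have -> : (N.+1 - s.+1 = N - s)%N by lia.
rewrite big_nat_cond [RHS]big_nat; apply: eq_big => j; first by lia.
by move=> _; congr kap; lia.
Qed.

End RenewalSums.
End MomentBounds.

(** * Mean-square estimation by blocks of windows *)

Section LawOfLargeNumbers.
Variables (R : realType) (q : int -> R) (s2 : R) (L : nat).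
Hypothesis Hq : step_law q s2.
Hypothesis Hw : return_kernel (fun t => u q (t + t)).
Local Notation w := (fun t => u q (t + t)).
Local Notation adm := (@admissible R L).

(** The statistic [m] is chosen before the scenery and serves all admissible ones and all longer
    observations; this order of quantifiers is what makes the final estimators independent of
    [theta]. *)
Definition estimable (Phi : (int -> R) -> R) := forall e : R, 0 < e ->
  exists H0 (m : seq bool -> R), forall th, adm th -> forall H, (H0 <= H)%N ->
    tossE q th H (fun xs => (m xs - Phi th) ^+ 2) 0 <= e.

Lemma estimable_ext Phi Psi : (forall th, adm th -> Phi th = Psi th) ->
  estimable Phi -> estimable Psi.
Proof.
move=> PP eP e /eP[H0 [m h]]; exists H0, m => th ath H HH.
by rewrite -PP//; exact: h.
Qed.

Lemma estimable0 : estimable (fun=> 0).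
Proof.
move=> e e0; exists 0%N, (fun=> 0) => th ath H _.
under [X in tossE _ _ _ X]funext do rewrite subrr expr0n.
by rewrite (E_cst _ Hq) ltW.
Qed.

Lemma estimable_lin c Phi Psi : estimable Phi -> estimable Psi ->
  estimable (fun th => c * Phi th + Psi th).
Proof.
move=> eP eS e e0.
have c1 : 0 < 1 + c ^+ 2 by have := sqr_ge0 c; lra.
have d0 : 0 < e / (4 * (1 + c ^+ 2)) by rewrite divr_gt0// mulr_gt0.
have e4 : 0 < e / 4 by lra.
have [H1 [m1 h1]] := eP _ d0; have [H2 [m2 h2]] := eS _ e4.
exists (maxn H1 H2), (fun xs => c * m1 xs + m2 xs) => th ath H.
rewrite geq_max => /andP[/(h1 _ ath) {}h1 /(h2 _ ath) {}h2].
have th01 := ath.1.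
apply: (@le_trans _ _ (tossE q th H (fun xs => 2 * c ^+ 2 * (m1 xs - Phi th) ^+ 2 +
    2 * (m2 xs - Psi th) ^+ 2) 0)).
  apply: (E_le Hq th01) => xs _.
  set a := m1 xs - Phi th; set b := m2 xs - Psi th.
  have -> : c * m1 xs + m2 xs - (c * Phi th + Psi th) = c * a + b.
    by rewrite /a /b; ring.
  by have := sqr_ge0 (c * a - b); nra.
rewrite (ED Hq th01) !(EZ Hq th01).
set A := tossE _ _ _ _ _ in h1 *; set B := tossE _ _ _ _ _ in h2 *.
have hA : A * (4 * (1 + c ^+ 2)) <= e by rewrite -ler_pdivlMr// mulr_gt0.
have A0 : 0 <= A.
  rewrite -(E_cst th Hq H 0 0); apply: (E_le Hq th01) => xs _; exact: sqr_ge0.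
nra.
Qed.

Definition evalm (l : seq (R * seq nat)) (xs : seq bool) : R :=
  \sum_(a <- l) a.1 * mong R a.2 xs.

Definition goodm (n : nat) (l : seq (R * seq nat)) :=
  all (fun a : R * seq nat => all (leq 1) a.2 && (sumn a.2 <= n)%N) l.

Variable rs : seq nat.
Hypothesis rs0 : all (leq 1) rs.
(** With this spacing consecutive windows read disjoint stretches of tosses. *)
Let p := (sumn rs).+1.
Let p0 : (0 < p)%N := ltn0Sn _.
Local Notation K := (Ksum w p).
Local Notation kp := (kap w p).

Definition window n s : seq nat := (n + p * s)%N :: rs.

Definition block n N (xs : seq bool) : R :=
  (K N)^-1 * \sum_(1 <= s < N.+1) mong R (window n s) xs.

Lemma sumn_window n s : (sumn (window n s) = n + p * s + sumn rs)%N.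
Proof. by []. Qed.

Section Scenery.
Variable th : int -> R.
Hypothesis ath : adm th.
Let th01 := ath.1.
Let thL := ath.2.
Local Notation E := (tossE q th).
Local Notation A := (total w L th rs).

Lemma E_mong_block n N H gs : all (leq 1) gs -> (sumn gs <= n)%N ->
  (2 * (n + p * N.+1) <= H)%N ->
  E H (fun xs => mong R gs xs * block n N xs) 0 =
  momt w L th gs (fun z => (K N)^-1 * \sum_(1 <= s < N.+1)
    mom w th L ((p * s + (n - sumn gs))%N :: rs) z) 0.
Proof.
move=> gs0 gsn HH; rewrite momtZ (@momt_sum _ w).
rewrite (_ : (fun xs => _) = fun xs => (K N)^-1 * \sum_(1 <= s < N.+1)
    (mong R gs xs * mong R (window n s) xs)); last first.
  by apply/funext => xs; rewrite /block mulrCA mulr_sumr.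
rewrite (EZ Hq th01) (E_sum Hq th01); congr (_ * _).
rewrite big_nat_cond [RHS]big_nat_cond; apply: eq_bigr => s /andP[/andP[s1 sN] _].
have ps : (p <= p * s)%N by rewrite leq_pmulr.
have psN : (p * s <= p * N)%N by rewrite leq_mul2l -ltnS sN orbT.
have pE : (sumn rs < p)%N by [].
transitivity (mom w th L (gs ++ (p * s + (n - sumn gs))%N :: rs) 0);
  last exact: mom_cat.
rewrite -(E_mong (s2 := s2) Hq th01 thL (n := H)).
- apply: E_ext => xs _; rewrite /window mong_mul; last by lia.
  by congr (mong R (_ ++ _ :: _) _); lia.
- by rewrite all_cat gs0 /= rs0 andbT; lia.
- by rewrite sumn_cat /=; nia.
Qed.

(** From any site of the window at the end of [gs], the mean of the block is within [card * e] of
    [A]. The ratios are required on [zr (L + L)] because they are taken at differences of two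
    sites. *)
Lemma E_block_cross n N H gs e : 0 <= e -> all (leq 1) gs -> (sumn gs <= n)%N ->
  (2 * (n + p * N.+1) <= H)%N ->
  (forall x, x \in zr (L + L) -> `|(K N)^-1 * (\sum_(1 <= s < N.+1)
     w (p * s + (n - sumn gs))%N x) - 1| <= e) ->
  `|E H (fun xs => mong R gs xs * block n N xs) 0 - A * E H (mong R gs) 0| <=
    card R L * e.
Proof.
move=> e0 gs0 gsn HH hx.
rewrite E_mong_block// (E_mong Hq th01 thL)//; last by nia.
rewrite mom_momt -momtZ.
set h := (fun z : int => (K N)^-1 * _).
have -> : momt w L th gs h 0 - momt w L th gs (fun=> A * 1) 0 =
    momt w L th gs (fun z => h z + (-1) * (A * 1)) 0.
  by rewrite momtD (momtZ w L th gs (-1) (fun=> A * 1)) mulN1r.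
apply: (momt_norm_le Hw ath); last by rewrite mem_zr.
move=> z zL; rewrite mulr1 mulN1r /h.
have -> : (K N)^-1 * \sum_(1 <= s < N.+1) mom w th L ((p * s + (n - sumn gs))%N :: rs) z
   = \sum_(y <- zr L) ((K N)^-1 * \sum_(1 <= s < N.+1)
       w (p * s + (n - sumn gs))%N (y - z)) * (th y * mom w th L rs y).
  rewrite /= exchange_big/= mulr_sumr; apply: eq_bigr => y _.
  by rewrite -mulrA mulr_suml.
rewrite /total -sumrB.
apply: le_trans (ler_norm_sum _ _ _) _; apply: sum_zr_le_card => y yL.
rewrite -[X in _ - X]mul1r -mulrBl normrM -[leRHS]mulr1.
have m0 := mom_ge0 Hw ath rs y; have m1 := mom_le1 Hw ath rs y.
have /andP[t0 t1] := th01 y.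
apply: ler_pM => //.
  by apply: hx; move: zL yL; rewrite !mem_zr; lia.
by rewrite ger0_norm ?mulr_ge0// mulr_ile1.
Qed.

(** The first window starts after at least [p * s] double steps, and the gap to the second exceeds
    [p * (s' - s - 1)]; the kernel at [0] is nonincreasing in time. *)
Lemma E_windows_le n N H s s' : (1 <= s <= N)%N -> (s < s' <= N)%N ->
  (2 * (n + p * N.+1) <= H)%N ->
  E H (fun xs => mong R (window n s) xs * mong R (window n s') xs) 0 <=
  card R L ^+ 2 * (kp s * kp (s' - s - 1)%N).
Proof.
move=> /andP[s1 sN] /andP[ss sN'] HH.
have ps : (p * s.+1 <= p * s')%N by rewrite leq_mul2l ss orbT.
have ps1 : (p <= p * s)%N by rewrite leq_pmulr.
have psN' : (p * s' <= p * N)%N by rewrite leq_mul2l sN' orbT.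
have pE : (sumn rs).+1 = p by [].
rewrite mulnS in ps HH.
have -> : E H (fun xs => mong R (window n s) xs * mong R (window n s') xs) 0 =
    mom w th L (window n s ++ (n + p * s' - sumn (window n s))%N :: rs) 0.
  rewrite -(E_mong (s2 := s2) Hq th01 thL (n := H)).
  - by apply: E_ext => xs _; rewrite mong_mul// sumn_window; lia.
  - by rewrite all_cat /= rs0 !andbT; lia.
  - by rewrite sumn_cat /= ; lia.
rewrite /window cat_cons.
apply: le_trans (mom_pair_le Hw ath _ _ _ _) _.
rewrite ler_wpM2l ?sqr_ge0//; apply: ler_pM; rewrite ?(u_ge0 Hq)//.
  by apply: (kernel_le Hw); lia.
apply: (kernel_le Hw); rewrite !mulnBr muln1 /=; lia.
Qed.

(** The diagonal contributes at most [N / K^2], hence [c^-1]. Each off-diagonal half is a renewal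
    double sum of at most [K * (1 + K)], comparable to [K^2]. *)
Lemma E_block_sqr c n N H : 0 < c -> (forall N, c * N%:R <= K N ^+ 2) ->
  (0 < N)%N -> (2 * (n + p * N.+1) <= H)%N ->
  E H (fun xs => block n N xs ^+ 2) 0 <= c^-1 + 2 * card R L ^+ 2 * (2 + c^-1).
Proof.
move=> c0 hc N0 HH; have K0 := Ksum_gt0 Hw p0 N0.
have -> : E H (fun xs => block n N xs ^+ 2) 0 = (K N)^-1 ^+ 2 *
    \sum_(1 <= s < N.+1) \sum_(1 <= s' < N.+1)
      E H (fun xs => mong R (window n s) xs * mong R (window n s') xs) 0.
  under [X in _ * X]eq_bigr do rewrite -(E_sum Hq th01).
  rewrite -(E_sum Hq th01) -(EZ Hq th01); apply: E_ext => xs _.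
  rewrite /block exprMn; congr (_ * _); rewrite expr2 mulr_suml.
  by apply: eq_bigr => s _; rewrite mulr_sumr.
set C := card R L ^+ 2; have C0 : 0 <= C by exact: sqr_ge0.
pose F s s' : R := if (s < s')%N then kp s * kp (s' - s - 1)%N else 0.
have F0 s s' : 0 <= F s s'.
  by rewrite /F; case: ifP => // _; rewrite mulr_ge0// (kap_ge0 Hw).
apply: (@le_trans _ _ ((K N)^-1 ^+ 2 * \sum_(1 <= s < N.+1) \sum_(1 <= s' < N.+1)
    ((s == s')%:R + C * (F s s' + F s' s)))).
  rewrite ler_wpM2l ?sqr_ge0// !big_nat; apply: ler_sum => s hs.
  rewrite !big_nat; apply: ler_sum => s' hs'.
  have sum0 : 0 <= C * (F s s' + F s' s) by rewrite mulr_ge0// addr_ge0.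
  case: (ltngtP s s') => h /=.
  - rewrite add0r {2}/F ltnNge (ltnW h)/= addr0 /F h.
    by apply: (@E_windows_le n N) => //; lia.
  - rewrite add0r {1}/F ltnNge (ltnW h)/= add0r /F h.
    rewrite (_ : (fun xs => _) = fun xs => mong R (window n s') xs * mong R (window n s) xs).
      by apply: (@E_windows_le n N) => //; lia.
    by apply/funext => xs; rewrite mulrC.
  - apply: (@le_trans _ _ 1); last by lra.
    rewrite -[leRHS](E_cst th Hq H 1 0); apply: (E_le Hq th01) => xs _.
    apply: (le_trans (ler_norm _)).
    rewrite normrM; apply: mulr_ile1 => //.
      exact: (size_mong_bound R (window n s)).
    exact: (size_mong_bound R (window n s')).
have S1 : \sum_(1 <= s < N.+1) \sum_(1 <= s' < N.+1) (s == s')%:R = N%:R :> R.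
  transitivity (\sum_(1 <= s < N.+1) (1 : R)).
    rewrite !big_nat; apply: eq_bigr => s hs.
    rewrite (bigD1_seq s)/= ?mem_index_iota ?iota_uniq// eqxx big1 ?addr0// => s'.
    by rewrite eq_sym => /negbTE ->.
  by rewrite sumr_const_nat subn1.
have S2 : \sum_(1 <= s < N.+1) \sum_(1 <= s' < N.+1) F s s' <= K N * (1 + K N).
  rewrite {1}/Ksum mulr_suml big_nat [leRHS]big_nat; apply: ler_sum => s hs.
  rewrite /F -big_mkcond/= -mulr_sumr ler_wpM2l ?(kap_ge0 Hw)//.
  by apply: (kap_shift_sum_le Hw); lia.
have S3 : \sum_(1 <= s < N.+1) \sum_(1 <= s' < N.+1) F s' s <= K N * (1 + K N).
  by rewrite exchange_big.
have -> : \sum_(1 <= s < N.+1) \sum_(1 <= s' < N.+1)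
    ((s == s')%:R + C * (F s s' + F s' s)) =
    N%:R + C * (\sum_(1 <= s < N.+1) \sum_(1 <= s' < N.+1) F s s' +
     \sum_(1 <= s < N.+1) \sum_(1 <= s' < N.+1) F s' s).
  rewrite -S1 -big_split/= mulr_sumr -big_split/=; apply: eq_bigr => s _.
  by rewrite -big_split/= mulr_sumr -big_split.
rewrite mulrC exprVn ler_pdivrMr ?exprn_gt0//.
have hN : N%:R <= c^-1 * K N ^+ 2 by rewrite ler_pdivlMl.
have h1 : 1 <= c^-1 * K N ^+ 2.
  by apply: le_trans hN; rewrite ler1n.
have hK : K N * (1 + K N) <= (2 + c^-1) * K N ^+ 2.
  have := sqr_ge0 (1 - K N); set k := K N in h1 *; nra.
set F1 := \sum_(1 <= s < N.+1) _ in S2 *; set F2 := \sum_(1 <= s < N.+1) _ in S3 *.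
set G := (2 + c^-1) * _ in hK.
have : C * (F1 + F2) <= C * (2 * G) by rewrite ler_wpM2l//; lra.
rewrite /G; set k2 := K N ^+ 2 in hN *; lra.
Qed.

End Scenery.

(** A running mean in which the new block gets weight [1 / (k + 2)]. The block starts after all
    tosses already used and is so long that its covariance with the old mean is at most
    [C / (2 (k + 2)^2)]; the factor 2 in the bound absorbs these covariances. *)
Lemma average_estimates C k : 0 < C -> card R L ^+ 2 <= C ->
  (forall th, adm th -> forall n N H, (0 < N)%N -> (2 * (n + p * N.+1) <= H)%N ->
    tossE q th H (fun xs => (block n N xs - total w L th rs) ^+ 2) 0 <= C) ->
  exists n l, goodm n l /\ forall th, adm th -> forall H, (2 * n <= H)%N ->
    tossE q th H (fun xs => (evalm l xs - total w L th rs) ^+ 2) 0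
      <= 2 * C / k.+1%:R.
Proof.
move=> C0 cC hT; elim: k => [|k [n [l [gl hl]]]].
  exists 0%N, [::]; split => // th ath H _.
  rewrite divr1 -[leRHS](E_cst th Hq H _ 0).
  apply: (E_le Hq ath.1) => xs _; rewrite /evalm big_nil sub0r sqrrN.
  have t0 := total_ge0 Hw ath rs; have t1 := total_le Hw ath rs.
  have := ler_sqr (x := total w L th rs) (y := card R L).
  by rewrite !nnegrE => /(_ t0 (card_ge0 R L)); rewrite t1 => /idP; lra.
pose k2 : R := k.+2%:R; have k20 : 0 < k2 by rewrite ltr0n.
(* The covariance expands with the coefficients of [l] and with the centring constant [A <= card];
   the added 1 makes [D] positive. *)
pose D := \sum_(a <- l) `|a.1| + card R L + 1.
have D0 : 0 < D by rewrite ltr_wpDl// addr_ge0// sumr_ge0.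
have cp : 0 < card R L by rewrite /card ltr0n size_zr.
pose e := C / (2 * k2 ^+ 2 * D * card R L).
have e0 : 0 < e by rewrite divr_gt0// !mulr_gt0// exprn_gt0.
(* The extra list [[::]] controls the mean of the block itself. *)
have [N0 hN0] := @eventually_all _ [seq (n - sumn gs, x)%N | gs <- [::] :: [seq a.2 | a <- l], x <- zr (L + L)]
  (fun i N => (0 < N)%N /\ `|(K N)^-1 * (\sum_(1 <= s < N.+1) w (p * s + i.1)%N i.2) - 1| <= e)
  (fun i => avg_ratio Hw p0 i.1 i.2 e0).
have {hN0} hx gs : gs \in [::] :: [seq a.2 | a <- l] -> forall x, x \in zr (L + L) ->
    (0 < N0)%N /\ `|(K N0)^-1 * (\sum_(1 <= s < N0.+1) w (p * s + (n - sumn gs))%N x) - 1| <= e.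
  move=> hgs x xL; apply: (hN0 N0 (leqnn _) (n - sumn gs, x)%N).
  by apply/allpairsP; exists (gs, x).
have N00 : (0 < N0)%N.
  by have [] := hx [::] (mem_head _ _) 0; rewrite ?mem_zr.
pose v := k2^-1.
pose l' := [seq ((1 - v) * a.1, a.2) | a <- l] ++
  [seq (v * (K N0)^-1, window n s) | s <- index_iota 1 N0.+1].
have evl' xs : evalm l' xs = (1 - v) * evalm l xs + v * block n N0 xs.
  rewrite /evalm /l' big_cat !big_map/= mulr_sumr; congr (_ + _).
    by apply: eq_bigr => a _; rewrite mulrA.
  by rewrite /block mulrA mulr_sumr.
exists (n + p * N0.+1)%N, l'; split.
  rewrite /goodm all_cat !all_map; apply/andP; split; apply/allP.
    move=> a al; have /allP/(_ a al)/andP[/= -> h] := gl.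
    by apply: leq_trans h _; exact: leq_addr.
  move=> s; rewrite mem_index_iota /= rs0 andbT => hs.
  have : (p * s <= p * N0)%N by rewrite leq_mul2l; lia.
  have : (p <= p * s)%N by rewrite leq_pmulr//; lia.
  have : (sumn rs).+1 = p by [].
  by rewrite mulnS; lia.
move=> th ath H HH; have th01 := ath.1.
set A := total w L th rs.
have A0 : 0 <= A := total_ge0 Hw ath rs.
have A1 : A <= card R L := total_le Hw ath rs.
have cross gs : gs \in [::] :: [seq a.2 | a <- l] ->
    `|tossE q th H (fun xs => mong R gs xs * block n N0 xs) 0 -
      A * tossE q th H (mong R gs) 0| <= card R L * e.
  move=> hgs; have [gs0 gsn] : all (leq 1) gs /\ (sumn gs <= n)%N.
    move: hgs; rewrite inE => /orP[/eqP->//|/mapP[a al ->]].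
    by have /allP/(_ a al)/andP[] := gl.
  apply: E_block_cross => //; first exact: ltW.
  by move=> x xL; have [] := hx gs hgs x xL.
pose EE f := tossE q th H f 0.
have EEl c f g : EE (fun xs => c * f xs + g xs) = c * EE f + EE g.
  by rewrite /EE (ED Hq th01) (EZ Hq th01).
have mixed : EE (fun xs => (evalm l xs - A) * (block n N0 xs - A)) <= D * (card R L * e).
  have -> : EE (fun xs => (evalm l xs - A) * (block n N0 xs - A)) =
      \sum_(a <- l) a.1 * (EE (fun xs => mong R a.2 xs * block n N0 xs) - A * EE (mong R a.2))
      - A * (EE (fun xs => mong R [::] xs * block n N0 xs) - A * EE (mong R [::])).
    have -> : EE (fun xs => (evalm l xs - A) * (block n N0 xs - A)) =
      EE (fun xs => \sum_(a <- l) a.1 * (mong R a.2 xs * block n N0 xs)) -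
      A * EE (fun xs => \sum_(a <- l) a.1 * mong R a.2 xs) -
      A * (EE (fun xs => mong R [::] xs * block n N0 xs) - A * EE (mong R [::])).
      transitivity (EE (fun xs => (- A) * \sum_(a <- l) a.1 * mong R a.2 xs +
        ((- A) * (mong R [::] xs * block n N0 xs) + ((A * A) * mong R [::] xs +
         \sum_(a <- l) a.1 * (mong R a.2 xs * block n N0 xs))))).
        apply: E_ext => xs _.
        have -> : \sum_(a <- l) a.1 * (mong R a.2 xs * block n N0 xs) =
            evalm l xs * block n N0 xs.
          by rewrite /evalm mulr_suml; apply: eq_bigr => a _; rewrite mulrA.
        by rewrite -/(evalm l xs) /=; ring.
      by rewrite !EEl; ring.
    rewrite /EE !(E_sum Hq th01) mulr_sumr -sumrB; congr (_ - _).
    by apply: eq_bigr => a _; rewrite !(EZ Hq th01); ring.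
  have ce0 : 0 <= card R L * e by rewrite mulr_ge0// ltW.
  have b1 : \sum_(a <- l) a.1 * (EE (fun xs => mong R a.2 xs * block n N0 xs) - A * EE (mong R a.2))
     <= (\sum_(a <- l) `|a.1|) * (card R L * e).
    rewrite mulr_suml big_seq [leRHS]big_seq; apply: ler_sum => a al.
    apply: le_trans (ler_norm _) _; rewrite normrM ler_wpM2l//; apply: cross.
    by rewrite inE map_f ?orbT.
  have := cross [::] (mem_head _ _); rewrite -/(EE _) -/(EE _) ler_norml => /andP[b2 _].
  set Z := EE _ - A * EE _ in b2 *; set Y := \sum_(a <- l) a.1 * _ in b1 *.
  rewrite /D; set X := \sum_(a <- l) `|a.1| in b1 *.
  have : - (A * Z) <= card R L * (card R L * e).
    by set c := card R L in b2 A1 ce0 *; set t := c * e in b2 ce0 *; nra.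
  by nra.
have -> : tossE q th H (fun xs => (evalm l' xs - A) ^+ 2) 0 =
    (1 - v) ^+ 2 * EE (fun xs => (evalm l xs - A) ^+ 2) +
    (v ^+ 2 * EE (fun xs => (block n N0 xs - A) ^+ 2) +
     (2 * v * (1 - v)) * EE (fun xs => (evalm l xs - A) * (block n N0 xs - A))).
  transitivity (EE (fun xs => (1 - v) ^+ 2 * (evalm l xs - A) ^+ 2 +
    (v ^+ 2 * (block n N0 xs - A) ^+ 2 + ((2 * v * (1 - v)) *
       ((evalm l xs - A) * (block n N0 xs - A)) + 0)))).
    by apply: E_ext => xs _; rewrite evl'; ring.
  by rewrite !EEl /EE (E_cst _ Hq) addr0.
have h1 : EE (fun xs => (evalm l xs - A) ^+ 2) <= 2 * C / k.+1%:R.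
  by apply: hl => //; apply: leq_trans HH; rewrite leq_mul2l leq_addr orbT.
have h2 : EE (fun xs => (block n N0 xs - A) ^+ 2) <= C by exact: hT.
have DeE : D * (card R L * e) = C / (2 * k2 ^+ 2).
  by rewrite /e; field; rewrite !gt_eqF.
rewrite DeE in mixed.
set X := EE _ in h1 *; set Y := EE _ in h2 *; set Z := EE _ in mixed *.
have k2E : k2 = k.+1%:R + 1 by rewrite /k2 -natr1.
set k1 : R := k.+1%:R in h1 k2E; have k10 : 0 < k1 by rewrite ltr0n.
have v01 : 0 <= v * (1 - v) <= 1.
  have v0 : 0 < v by rewrite invr_gt0.
  have v1 : v <= 1 by rewrite invf_le1// k2E; lra.
  by apply/andP; split; nra.
have vE : 1 - v = k1 / k2 by rewrite /v k2E; field; lra.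
have bZ : 2 * v * (1 - v) * Z <= C / k2 ^+ 2.
  apply: (@le_trans _ _ (2 * v * (1 - v) * (C / (2 * k2 ^+ 2)))).
    by rewrite ler_wpM2l//; lra.
  have -> : C / k2 ^+ 2 = 2 * (C / (2 * k2 ^+ 2)) by field; rewrite gt_eqF.
  have : 0 <= C / (2 * k2 ^+ 2) by rewrite divr_ge0 ?ltW// mulr_gt0 ?exprn_gt0.
  move: v01 => /andP[a1 a2]; set t := C / _; nra.
have bX : (1 - v) ^+ 2 * X <= 2 * C * k1 / k2 ^+ 2.
  rewrite vE; apply: (@le_trans _ _ ((k1 / k2) ^+ 2 * (2 * C / k1))).
    by rewrite ler_wpM2l// sqr_ge0.
  by apply: ler_eq; field; rewrite !gt_eqF.
have bY : v ^+ 2 * Y <= C / k2 ^+ 2.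
  by rewrite [leRHS]mulrC /v exprVn ler_wpM2l// invr_ge0 exprn_ge0// ltW.
apply: (@le_trans _ _ (2 * C * k1 / k2 ^+ 2 + (C / k2 ^+ 2 + C / k2 ^+ 2))).
  by rewrite !lerD.
apply: ler_eq; rewrite k2E; field.
by rewrite gt_eqF//; lra.
Qed.

Lemma estimable_total : estimable (fun th => total w L th rs).
Proof.
have [c c0 hc] := Ksum_lower Hw p0.
have ci : 0 < c^-1 by rewrite invr_gt0.
have cd := card_ge0 R L; have cd2 := sqr_ge0 (card R L).
pose C0 := c^-1 + 2 * card R L ^+ 2 * (2 + c^-1).
pose C := 2 * C0 + 2 * card R L ^+ 2.
have C00 : 0 < C0 by rewrite ltr_wpDr// mulr_ge0//; [rewrite mulr_ge0|lra].
have Cp : 0 < C by rewrite /C; lra.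
have cC : card R L ^+ 2 <= C by rewrite /C; lra.
have hT th : adm th -> forall n N H, (0 < N)%N -> (2 * (n + p * N.+1) <= H)%N ->
    tossE q th H (fun xs => (block n N xs - total w L th rs) ^+ 2) 0 <= C.
  move=> ath n N H N0 HH; have th01 := ath.1.
  have h := E_block_sqr ath c0 hc N0 HH; rewrite -/C0 in h.
  have t0 := total_ge0 Hw ath rs; have t1 := total_le Hw ath rs.
  apply: (@le_trans _ _ (tossE q th H (fun xs => 2 * block n N xs ^+ 2 +
     2 * card R L ^+ 2) 0)).
    apply: (E_le Hq th01) => xs _.
    set b := block n N xs; set A := total _ _ _ _ in t0 t1 *.
    have := sqr_ge0 (b + A); have : A ^+ 2 <= card R L ^+ 2 by nra.
    nra.
  by rewrite (ED Hq th01) (EZ Hq th01) (E_cst _ Hq) /C; lra.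
move=> e e0; have [k k0 hk] := div_nat_small (2 * C) e0.
have [n [l [gl hl]]] := average_estimates k Cp cC hT.
exists (2 * n)%N, (evalm l) => th ath H HH.
by apply: le_trans (hl th ath H HH) _; apply: hk.
Qed.

End LawOfLargeNumbers.

(** * Sums over chains with prescribed distances *)

Section DistancePatterns.
Variables (R : realType).

(** Each step has its own kernel, so that return kernels and distance indicators can be mixed while
    one is exchanged for the other. *)
Fixpoint kmom (L : nat) (th : int -> R) (ks : seq (int -> R)) (z : int) : R :=
  match ks with
  | [::] => 1
  | k :: ks' => \sum_(y <- zr L) k (y - z) * (th y * kmom L th ks' y)
  end.

Definition ktotal L th ks : R := \sum_(z <- zr L) th z * kmom L th ks z.

Definition at_dist (d : nat) (z : int) : R := (`|z|%N == d)%:R.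

(* The sum of [th z0 * ... * th zk] over all chains of sites with
   [|z_i - z_(i-1)|] equal to the [i]-th entry of [ds]. *)
Definition chains L th (ds : seq nat) : R := ktotal L th (map at_dist ds).

Lemma mom_kmom w th L rs z : mom w th L rs z = kmom L th (map w rs) z.
Proof.
by elim: rs z => //= r rs IH z; apply: eq_bigr => y _; rewrite IH.
Qed.

Lemma kmom_split L th (l : seq (R * nat)) (w : nat -> int -> R) k pre ks z :
  (forall x : int, (`|x| <= L + L)%N -> k x = ev l (fun t => w t x)) ->
  z \in zr L ->
  kmom L th (pre ++ k :: ks) z =
  \sum_(a <- l) a.1 * kmom L th (pre ++ w a.2 :: ks) z.
Proof.
move=> hk; elim: pre z => [|f pre IH] z zL /=.
  under [RHS]eq_bigr do rewrite mulr_sumr.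
  rewrite [RHS]exchange_big/=; rewrite big_seq [RHS]big_seq.
  apply: eq_bigr => y yL; rewrite hk; last by move: zL yL; rewrite !mem_zr; lia.
  by rewrite /ev mulr_suml; apply: eq_bigr => a _; rewrite -mulrA.
under [RHS]eq_bigr do rewrite mulr_sumr.
rewrite [RHS]exchange_big/=; rewrite big_seq [RHS]big_seq.
apply: eq_bigr => y yL; rewrite IH// !mulr_sumr.
by apply: eq_bigr => a _; ring.
Qed.

Lemma ktotal_split L th (l : seq (R * nat)) (w : nat -> int -> R) k pre ks :
  (forall x : int, (`|x| <= L + L)%N -> k x = ev l (fun t => w t x)) ->
  ktotal L th (pre ++ k :: ks) =
  \sum_(a <- l) a.1 * ktotal L th (pre ++ w a.2 :: ks).
Proof.
move=> hk; rewrite /ktotal; under [RHS]eq_bigr do rewrite mulr_sumr.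
rewrite [RHS]exchange_big/=; rewrite big_seq [RHS]big_seq.
apply: eq_bigr => z zL; rewrite (kmom_split _ _ _ hk)// mulr_sumr.
by apply: eq_bigr => a _; ring.
Qed.

Lemma sum_zr_supp L L0 (th f : int -> R) : (L0 <= L)%N ->
  (forall z : int, (L0 < `|z|)%N -> th z = 0) ->
  \sum_(y <- zr L) th y * f y = \sum_(y <- zr L0) th y * f y.
Proof.
move=> LL hth; rewrite (sum_zr_split _ LL) [X in _ + X]big1 ?addr0// => y.
by move=> /hth ->; rewrite mul0r.
Qed.

Lemma kmom_supp L L0 th ks z : (L0 <= L)%N ->
  (forall z : int, (L0 < `|z|)%N -> th z = 0) ->
  kmom L th ks z = kmom L0 th ks z.
Proof.
move=> LL hth; elim: ks z => //= k ks IH z.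
under eq_bigr do rewrite mulrCA IH.
under [RHS]eq_bigr do rewrite mulrCA.
exact: sum_zr_supp.
Qed.

Lemma chains_supp L L0 th ds : (L0 <= L)%N ->
  (forall z : int, (L0 < `|z|)%N -> th z = 0) ->
  chains L th ds = chains L0 th ds.
Proof.
move=> LL hth; rewrite /chains /ktotal (sum_zr_supp _ LL hth).
by apply: eq_bigr => z _; rewrite (kmom_supp _ _ LL hth).
Qed.

Variables (q : int -> R) (s2 : R).
Hypothesis Hq : step_law q s2.
Hypothesis Hw : return_kernel (fun t => u q (t + t)).
Local Notation w := (fun t => u q (t + t)).

Lemma estimable_sum L (l : seq (R * nat)) (Phi : nat -> (int -> R) -> R) :
  pos_times l -> (forall t, (0 < t)%N -> estimable q L (Phi t)) ->
  estimable q L (fun th => \sum_(a <- l) a.1 * Phi a.2 th).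
Proof.
move=> + eP; elim: l => [_|[c t] l IH /andP[/= t0 pl]].
  apply: estimable_ext (estimable0 L Hq) => th _; by rewrite big_nil.
apply: estimable_ext (estimable_lin Hq c (eP t t0) (IH pl)) => th _.
by rewrite big_cons.
Qed.

(** Distance indicators are removed from the left: [rk_span] expands the first one in kernels at
    positive times, each of which joins [pre], until [estimable_total] applies. *)
Lemma estimable_chains_after L ds pre : all (leq 1) pre ->
  estimable q L (fun th => ktotal L th (map w pre ++ map at_dist ds)).
Proof.
elim: ds pre => [|d ds IH] pre pre0.
  apply: estimable_ext (estimable_total L Hq Hw pre0) => th _.
  by rewrite cats0; apply: eq_bigr => z _; rewrite mom_kmom.
have ev_d z : at_dist d (- z) = at_dist d z by rewrite /at_dist abszN.
have [l pl hl] := rk_span Hw (L + L)%N ev_d.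
have := @estimable_sum L l (fun t th =>
  ktotal L th (map w (rcons pre t) ++ map at_dist ds)) pl.
have est t : (0 < t)%N -> estimable q L
    (fun th => ktotal L th (map w (rcons pre t) ++ map at_dist ds)).
  by move=> t0; apply: IH; rewrite all_rcons t0.
move=> /(_ est); apply: estimable_ext => th _.
rewrite /= (@ktotal_split L th l w).
  by apply: eq_bigr => a _; rewrite map_rcons cat_rcons.
by move=> x xL; rewrite hl.
Qed.

Lemma estimable_chains L ds : estimable q L (fun th => chains L th ds).
Proof. exact: (@estimable_chains_after L ds [::]). Qed.

(** The reconstruction reads chains of at most three steps, and a stage can estimate only finitely
    many of them jointly. *)
Definition patterns (j : nat) : seq (seq nat) :=
  [seq [:: a] | a <- iota 0 j.+1] ++
  ([seq [:: a; b] | a <- iota 0 j.+1, b <- iota 0 j.+1] ++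
   [seq [:: ab.1; ab.2; c] | ab <- [seq (a, b) | a <- iota 0 j.+1, b <- iota 0 j.+1],
                           c <- iota 0 j.+1]).

Lemma mem_patterns1 j a : (a <= j)%N -> [:: a] \in patterns j.
Proof.
by move=> aj; rewrite mem_cat; apply/orP; left; apply: map_f; rewrite mem_iota; lia.
Qed.

Lemma mem_patterns2 j a b : (a <= j)%N -> (b <= j)%N -> [:: a; b] \in patterns j.
Proof.
move=> aj bj; rewrite /patterns mem_cat; apply/orP; right; rewrite mem_cat; apply/orP; left.
by apply: (allpairs_f (fun a b => [:: a; b])); rewrite mem_iota; lia.
Qed.

Lemma mem_patterns3 j a b c : (a <= j)%N -> (b <= j)%N -> (c <= j)%N ->
  [:: a; b; c] \in patterns j.
Proof.
move=> aj bj cj; rewrite /patterns mem_cat; apply/orP; right; rewrite mem_cat; apply/orP; right.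
apply: (@allpairs_f _ _ _ (fun (ab : nat * nat) c => [:: ab.1; ab.2; c]) _ _ (a, b) c).
  by apply: (allpairs_f (fun a b => (a, b))); rewrite mem_iota; lia.
by rewrite mem_iota; lia.
Qed.

Lemma joint_estimates L (D : seq (seq nat)) e : 0 < e ->
  exists H (m : seq nat -> seq bool -> R), forall th, admissible L th ->
    tossE q th H (fun xs => \sum_(ds <- D) (m ds xs - chains L th ds) ^+ 2) 0 <= e.
Proof.
move=> e0; suff : exists H0 (m : seq nat -> seq bool -> R), forall th, admissible L th ->
    forall H, (H0 <= H)%N ->
    tossE q th H (fun xs => \sum_(ds <- D) (m ds xs - chains L th ds) ^+ 2) 0 <=
      (size D)%:R * (e / (size D).+1%:R).
  move=> [H [m h]]; exists H, m => th ath; apply: le_trans (h th ath H (leqnn _)) _.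
  rewrite mulrCA ler_piMr ?(ltW e0)// ler_pdivrMr ?ltr0n// mul1r ler_nat; lia.
set c := e / _; have c0 : 0 < c by rewrite divr_gt0.
have /choice[f hf] : forall ds, exists Hm : nat * (seq bool -> R),
    forall th, admissible L th -> forall H, (Hm.1 <= H)%N ->
    tossE q th H (fun xs => (Hm.2 xs - chains L th ds) ^+ 2) 0 <= c.
  by move=> ds; have [H [m h]] := estimable_chains L ds c0; exists (H, m).
exists (\max_(ds <- D) (f ds).1), (fun ds => (f ds).2) => th ath H HH.
rewrite (E_sum Hq ath.1) -[(size D)%:R]/(((size D))%:R) mulr_natl.
rewrite -(count_predT D) -iter_addr_0 -big_const_seq big_seq [leRHS]big_seq.
apply: ler_sum => ds dsD; apply: hf => //; apply: leq_trans HH.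
exact: (@leq_bigmax_seq _ D xpredT (fun ds => (f ds).1)).
Qed.

(** Markov's inequality for the summed squared errors, whose mean is made at most
    [2^-j * (4^-j)^2]. *)
Lemma stage_estimates j : exists H (m : seq nat -> seq bool -> R),
  forall th, admissible j th ->
    tossE q th H (fun xs => (has (fun ds =>
      4^-1 ^+ j < `|m ds xs - chains j th ds|) (patterns j))%:R) 0 <= 2^-1 ^+ j.
Proof.
have d0 : 0 < 4^-1 ^+ j :> R by rewrite exprn_gt0.
have t0 : 0 < 2^-1 ^+ j :> R by rewrite exprn_gt0.
have e0 : 0 < 2^-1 ^+ j * (4^-1 ^+ j) ^+ 2 :> R by rewrite mulr_gt0// exprn_gt0.
have [H [m hm]] := joint_estimates j (patterns j) e0.
exists H, m => th ath; have th01 := ath.1.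
set d : R := 4^-1 ^+ j in d0 e0 hm *.
have d2 : 0 < d ^+ 2 by rewrite exprn_gt0.
apply: (@le_trans _ _ (tossE q th H (fun xs => (d ^+ 2)^-1 *
   \sum_(ds <- patterns j) (m ds xs - chains j th ds) ^+ 2) 0)); last first.
  by rewrite (EZ Hq th01) mulrC ler_pdivrMr//; exact: hm.
apply: (E_le Hq th01) => xs _.
have S0 : 0 <= \sum_(ds <- patterns j) (m ds xs - chains j th ds) ^+ 2.
  by apply: sumr_ge0 => ds _; exact: sqr_ge0.
case: hasP => [[ds dsD hd]|_]; last by rewrite mulr_ge0// invr_ge0 ltW.
rewrite mulrC ler_pdivlMr// mul1r.
apply: (@le_trans _ _ ((m ds xs - chains j th ds) ^+ 2)).
  rewrite -(real_normK (num_real (m ds xs - _))).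
  by rewrite ler_sqr ?nnegrE ?(ltW d0)// ltW.
elim: (patterns j) dsD {S0} => // a D IH; rewrite inE big_cons => /orP[/eqP->|/IH h].
  by rewrite lerDl sumr_ge0// => x _; exact: sqr_ge0.
by apply: (le_trans h); rewrite lerDr sqr_ge0.
Qed.

End DistancePatterns.

(** * Reconstruction of the scenery *)

Section ExtremalChains.
Variables (R : realType) (L : nat) (th : int -> R) (lo : int) (len : nat).
Local Notation hi := (lo + len%:Z).
Hypothesis hlo : (`|lo| <= L)%N.
Hypothesis hhi : (absz (lo + len%:Z)%R <= L)%N.
Hypothesis th_below : forall z : int, z < lo -> th z = 0.
Hypothesis th_above : forall z : int, hi < z -> th z = 0.

(** The other candidate at distance [d] lies below the support. *)
Lemma step_from_lo d (h : int -> R) : (d <= len)%N ->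
  \sum_(y <- zr L) at_dist R d (y - lo) * (th y * h y) =
  th (lo + d%:Z) * h (lo + d%:Z).
Proof.
move=> dl; rewrite -(@sum_zr1 _ L (lo + d%:Z) (fun y => th y * h y)); last by lia.
apply: eq_bigr => y _; rewrite /at_dist.
have [->|yn] := eqVneq y (lo + d%:Z); first by rewrite addrC addKr absz_nat eqxx.
case: eqP => yd; last by [].
by rewrite th_below ?mul0r ?mulr0//; lia.
Qed.

Lemma step_from_hi d (h : int -> R) : (d <= len)%N ->
  \sum_(y <- zr L) at_dist R d (y - hi) * (th y * h y) =
  th (hi - d%:Z) * h (hi - d%:Z).
Proof.
move=> dl; rewrite -(@sum_zr1 _ L (hi - d%:Z) (fun y => th y * h y)); last by lia.
apply: eq_bigr => y _; rewrite /at_dist.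
have [->|yn] := eqVneq y (hi - d%:Z).
  by rewrite (_ : `|_|%N = d) ?eqxx//; lia.
case: eqP => yd; last by [].
by rewrite th_above ?mul0r ?mulr0//; lia.
Qed.

(* For [len = 0] both endpoints are the same site, whence the factor 1/2. *)
Definition endpoint_weight : R := (if len == 0%N then 2^-1 else 1) * (th lo * th hi).

(** Inside the support a step of length [len] can only join the two end points, in either direction;
    [f] and [h] stand for what precedes and follows it in a chain. *)
Lemma longest_step (f h : int -> R) :
  \sum_(z <- zr L) th z * f z *
     (\sum_(y <- zr L) at_dist R len (y - z) * (th y * h y)) =
  endpoint_weight * (f lo * h hi + f hi * h lo).
Proof.
rewrite /endpoint_weight; have [l0|l0] := eqVneq len 0%N.
  have hl : hi = lo by rewrite l0 addr0.
  rewrite (eq_bigr (fun z => (z == lo)%:R * (th lo * f lo * (th lo * h lo)))).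
    by rewrite (@sum_zr1 _ L lo (fun=> _))// hl; field.
  move=> z _; have [->|zn] := eqVneq z lo.
    by rewrite step_from_lo// hl mul1r.
  suff -> : th z = 0 by rewrite !mul0r.
  have [/th_below//|zg|zE] := ltgtP z lo; first by rewrite th_above// hl.
  by rewrite zE eqxx in zn.
rewrite mul1r; transitivity (\sum_(z <- zr L) ((z == lo)%:R * (th lo * f lo * (th hi * h hi)) +
    (z == hi)%:R * (th hi * f hi * (th lo * h lo)))).
  apply: eq_bigr => z _.
  have [->|zlo] := eqVneq z lo.
    rewrite step_from_lo// (_ : (lo == hi) = false) ?mul0r ?addr0 ?mul1r//; lia.
  have [->|zhi] := eqVneq z hi.
    rewrite step_from_hi// mul0r add0r mul1r.
    by have -> : hi - len%:Z = lo by lia.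
  rewrite !mul0r addr0.
  have [zl|zl] := ltP z lo; first by rewrite th_below// !mul0r.
  have [zh|zh] := ltP hi z; first by rewrite th_above// !mul0r.
  rewrite big1 ?mulr0// => y _; rewrite /at_dist.
  case: eqP => yz; last by rewrite mul0r.
  have [yl|yl] := ltP y lo; first by rewrite th_below// mul0r mulr0.
  by rewrite th_above ?mul0r ?mulr0//; lia.
rewrite big_split/= (@sum_zr1 _ L lo (fun=> _))// (@sum_zr1 _ L hi (fun=> _))//.
ring.
Qed.

Lemma chains_far d : (len < d)%N -> chains L th [:: d] = 0.
Proof.
move=> ld; rewrite /chains /ktotal big1// => z _ /=.
have [zl|zl] := ltP z lo; first by rewrite th_below// mul0r.
have [zh|zh] := ltP hi z; first by rewrite th_above// mul0r.
rewrite big1 ?mulr0// => y _; rewrite /at_dist.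
case: eqP => yz; last by rewrite mul0r.
have [yl|yl] := ltP y lo; first by rewrite th_below// mul0r mulr0.
by rewrite th_above ?mul0r ?mulr0//; lia.
Qed.

Lemma chains_len : chains L th [:: len] = 2 * endpoint_weight.
Proof.
have := longest_step (fun=> 1) (fun=> 1); rewrite !mulr1 mulrDr mulr1 => h.
rewrite /chains /ktotal /= -[RHS]/(2 * _) mulr_natl mulr2n -h.
by apply: eq_bigr => z _; rewrite mulr1.
Qed.

Lemma chains_len_step d : (d <= len)%N ->
  chains L th [:: len; d] = endpoint_weight * (th (lo + d%:Z) + th (hi - d%:Z)).
Proof.
move=> dl; have := longest_step (fun=> 1) (kmom L th [:: at_dist R d]).
rewrite /= step_from_lo// step_from_hi// !mulr1 !mul1r addrC => <-.
by rewrite /chains /ktotal /=; apply: eq_bigr => z _; rewrite mulr1.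
Qed.

Lemma at_dist_sym d (x y : int) : at_dist R d (x - y) = at_dist R d (y - x).
Proof. by rewrite /at_dist -abszN opprB. Qed.

(** The chain is cut at its longest step, and its first step is read backwards from the end point by
    the symmetry of [at_dist]. *)
Lemma chains_step_len_step d e : (d <= len)%N -> (e <= len)%N ->
  chains L th [:: d; len; e] = endpoint_weight *
    (th (lo + d%:Z) * th (hi - e%:Z) + th (hi - d%:Z) * th (lo + e%:Z)).
Proof.
move=> dl el; pose f z := \sum_(y <- zr L) at_dist R d (y - z) * (th y * 1).
have := longest_step f (kmom L th [:: at_dist R e]).
rewrite /= {2 3}/f step_from_lo// !step_from_hi// !step_from_lo// !mulr1 => <-.
rewrite /chains /ktotal /=; under eq_bigr do rewrite mulr_sumr.
rewrite exchange_big/=; apply: eq_bigr => z _.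
rewrite /f mulr_sumr mulr_suml; apply: eq_bigr => y _.
by rewrite (at_dist_sym d z y); ring.
Qed.

End ExtremalChains.

Lemma support_ends (R : realType) L (th : int -> R) :
  (forall z : int, (L < `|z|)%N -> th z = 0) -> (exists z, th z != 0) ->
  exists (lo : int) (len : nat),
    [/\ (`|lo| <= L)%N, (absz (lo + len%:Z)%R <= L)%N, th lo != 0, th (lo + len%:Z) != 0 &
     (forall z : int, z < lo -> th z = 0) /\
     (forall z : int, lo + len%:Z < z -> th z = 0)].
Proof.
move=> thL [z0 hz0].
have z0L : (`|z0| <= L)%N by rewrite leqNgt; apply/negP => /thL h; rewrite h eqxx in hz0.
have ex1 : exists i : nat, th (i%:Z - L%:Z) != 0.
  by exists (absz (z0 + L%:Z)%R); have -> : (absz (z0 + L%:Z)%R)%:Z - L%:Z = z0 by lia.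
have ex2 : exists i : nat, th (L%:Z - i%:Z) != 0.
  by exists (absz (L%:Z - z0)%R); have -> : L%:Z - (absz (L%:Z - z0)%R)%:Z = z0 by lia.
have [i1 h1 m1] := ex_minnP ex1; have [i2 h2 m2] := ex_minnP ex2.
have below (z : int) : z < i1%:Z - L%:Z -> th z = 0.
  move=> zl; have [zL|zL] := leP (- L%:Z) z; last by apply: thL; lia.
  apply/eqP/negPn/negP => hz.
  have zE : z = (absz (z + L%:Z)%R)%:Z - L%:Z by lia.
  by have := m1 (absz (z + L%:Z)%R); rewrite -zE => /(_ hz); lia.
have above (z : int) : L%:Z - i2%:Z < z -> th z = 0.
  move=> zl; have [zL|zL] := leP z L%:Z; last by apply: thL; lia.
  apply/eqP/negPn/negP => hz.
  have zE : z = L%:Z - (absz (L%:Z - z)%R)%:Z by lia.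
  by have := m2 (absz (L%:Z - z)%R); rewrite -zE => /(_ hz); lia.
have lohi : i1%:Z - L%:Z <= L%:Z - i2%:Z.
  by rewrite leNgt; apply/negP => /above h; rewrite h eqxx in h1.
have hiE : i1%:Z - L%:Z + (absz (L%:Z - i2%:Z - (i1%:Z - L%:Z))%R)%:Z = L%:Z - i2%:Z by lia.
exists (i1%:Z - L%:Z), (absz (L%:Z - i2%:Z - (i1%:Z - L%:Z))%R); rewrite hiE; split => //.
- by rewrite leqNgt; apply/negP => /thL h; rewrite h eqxx in h1.
- by rewrite leqNgt; apply/negP => /thL h; rewrite h eqxx in h2.
Qed.

(** * Reconstruction from approximate chain sums *)

Section Reconstruction.
Variable R : realType.
Implicit Types (b : seq nat -> R) (j l d e : nat).

(* At stage [j] patterns are known up to [4^-j], and [2^-j] is the threshold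
   above which an estimate is taken to be nonzero. *)
Definition threshold j : R := 2^-1 ^+ j.

Definition span_est j b : nat :=
  \max_(d <- iota 0 j.+1 | threshold j < b [:: d]) d.

(* Estimates [(c f(d)) (c f(e))], where [f] is the antisymmetric part of the
   scenery and [c] the weight of the two end points of its support. *)
Definition antisym b l d e : R := b [:: l; d] * b [:: l; e] - b [:: l] * b [:: d; l; e].

(** If no site shows a nonzero antisymmetric part, [find] returns [l.+1], which [signed_part]
    detects by its test [p <= l]. *)
Definition pivot j b l : nat :=
  find (fun d => threshold j < antisym b l d d) (iota 0 l.+1).

(** With exact data this is [c^2 f(d) f(p)] divided by [c |f(p)|], that is [c f(d)] up to a sign
    common to all [d]. *)
Definition signed_part b l p d : R :=
  if (p <= l)%N then antisym b l d p / Num.sqrt (antisym b l p p) else 0.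

(** With exact data the quotient is [c (fa + fb)] plus or minus [c (fa - fb)], over [2 c], where
    [fa] and [fb] are the profile read from its two ends. The guard sends the null scenery to
    zero. *)
Definition reconstruct j b (z : int) : R :=
  let l := span_est j b in
  if [&& threshold j < b [:: l], 0 <= z & (`|z| <= l)%N] then
    (b [:: l; `|z|%N] + signed_part b l (pivot j b l) `|z|%N) / b [:: l]
  else 0.

Lemma threshold_gt0 j : 0 < threshold j.
Proof. by rewrite exprn_gt0. Qed.

Lemma threshold_le1 j : threshold j <= 1.
Proof. by rewrite exprn_ile1//; lra. Qed.

Lemma threshold_sqr j : 4^-1 ^+ j = threshold j ^+ 2.
Proof. by rewrite -exprM mulnC exprM; congr (_ ^+ _); field. Qed.

Lemma near_threshold (e : R) : 0 < e -> \forall j \near \oo, threshold j < e.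
Proof.
move=> e0; have e2 : 0 < e / 2 by lra.
have [N N0 hN] := div_nat_small 1 e2; exists N => // j /= Nj.
have j0 : 0 < j%:R :> R by rewrite ltr0n; lia.
apply: (@le_lt_trans _ _ (e / 2)); last by lra.
apply: le_trans (hN j Nj); rewrite /threshold exprVn mul1r lef_pV2 ?posrE ?exprn_gt0//.
by rewrite -natrX ler_nat ltnW// ltn_expl.
Qed.

Lemma mul_near_le (x y x' y' s : R) : 0 <= s <= 1 -> `|x' - x| <= s -> `|y' - y| <= s ->
  `|x' * y' - x * y| <= s * (`|x| + `|y| + 1).
Proof.
move=> /andP[s0 s1] hx hy.
have -> : x' * y' - x * y = (x' - x) * (y' - y) + (x' - x) * y + x * (y' - y) by ring.
apply: (le_trans (ler_normD _ _)); rewrite normrM.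
have h1 : `|x| * `|y' - y| <= `|x| * s by rewrite ler_wpM2l.
apply: (@le_trans _ _ (s * s + s * `|y| + `|x| * s)); last by nra.
rewrite lerD//; apply: (le_trans (ler_normD _ _)); rewrite !normrM lerD//.
  by rewrite ler_pM.
by rewrite ler_wpM2r.
Qed.

Variables (L0 : nat) (th : int -> R) (b : nat -> seq nat -> R) (J : nat).
Hypothesis ath : admissible L0 th.
Hypothesis hb : forall j, (J <= j)%N -> forall ds, ds \in patterns j ->
  `|b j ds - chains j th ds| <= 4^-1 ^+ j.
Local Notation B := (chains L0 th).
Local Notation thr := threshold.

Lemma est_error ds : (forall j, (size ds + sumn ds <= j)%N -> ds \in patterns j) ->
  \forall j \near \oo, `|b j ds - B ds| <= thr j ^+ 2.
Proof.
move=> hds; exists (maxn (maxn J L0) (size ds + sumn ds)) => // j /=.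
rewrite !geq_max => /andP[/andP[Jj Lj] dj].
rewrite -threshold_sqr -(chains_supp ds Lj ath.2); apply: hb => //; exact: hds.
Qed.

Lemma est_error1 a : \forall j \near \oo, `|b j [:: a] - B [:: a]| <= thr j ^+ 2.
Proof. by apply: est_error => j /= h; apply: mem_patterns1; lia. Qed.

Lemma est_error2 a a' : \forall j \near \oo,
  `|b j [:: a; a'] - B [:: a; a']| <= thr j ^+ 2.
Proof. by apply: est_error => j /= h; apply: mem_patterns2; lia. Qed.

Lemma est_error3 a a' a'' : \forall j \near \oo,
  `|b j [:: a; a'; a''] - B [:: a; a'; a'']| <= thr j ^+ 2.
Proof. by apply: est_error => j /= h; apply: mem_patterns3; lia. Qed.

Lemma cvg_of_error (f : nat -> R) (x C : R) :
  (\forall j \near \oo, `|f j - x| <= C * thr j) -> f j @[j --> \oo] --> x.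
Proof.
move=> h; apply/cvgrPdist_le => e e0.
have C1 : 0 < `|C| + 1 by have := normr_ge0 C; lra.
have e1 : 0 < e / (`|C| + 1) by exact: divr_gt0.
have ht := near_threshold e1.
near=> j; rewrite distrC.
have h1 : `|f j - x| <= C * thr j by near: j.
have h2 : thr j < e / (`|C| + 1) by near: j.
apply: (le_trans h1); rewrite ltr_pdivlMr// in h2.
have := threshold_gt0 j; have := ler_norm C; nra.
Unshelve. all: by end_near. Qed.

Lemma thr_sqr_le j : thr j ^+ 2 <= thr j.
Proof. by have := threshold_gt0 j; have := threshold_le1 j; nra. Qed.

Lemma cvg_est1 a : b j [:: a] @[j --> \oo] --> B [:: a].
Proof.
apply: (@cvg_of_error _ _ 1); near=> j; rewrite mul1r.
apply: le_trans (thr_sqr_le j); near: j; exact: est_error1.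
Unshelve. all: by end_near. Qed.

Lemma cvg_est2 a a' : b j [:: a; a'] @[j --> \oo] --> B [:: a; a'].
Proof.
apply: (@cvg_of_error _ _ 1); near=> j; rewrite mul1r.
apply: le_trans (thr_sqr_le j); near: j; exact: est_error2.
Unshelve. all: by end_near. Qed.

(** The error is quadratic in the threshold, so the estimate of a vanishing quantity eventually
    falls below the threshold whatever [C] is. *)
Lemma antisym_error l d e : exists2 C, 0 < C &
  \forall j \near \oo, `|antisym (b j) l d e - antisym B l d e| <= C * thr j ^+ 2.
Proof.
pose C := `|B [:: l; d]| + `|B [:: l; e]| + 1 + (`|B [:: l]| + `|B [:: d; l; e]| + 1).
exists C.
  have := normr_ge0 (B [:: l; d]); have := normr_ge0 (B [:: l; e]).
  have := normr_ge0 (B [:: l]); have := normr_ge0 (B [:: d; l; e]); rewrite /C; lra.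
near=> j.
have t01 : 0 <= thr j ^+ 2 <= 1.
  by rewrite sqr_ge0 exprn_ile1// ?threshold_le1// ltW// threshold_gt0.
have h1 := @mul_near_le (B [:: l; d]) (B [:: l; e]) (b j [:: l; d]) (b j [:: l; e]) _ t01.
have h2 := @mul_near_le (B [:: l]) (B [:: d; l; e]) (b j [:: l]) (b j [:: d; l; e]) _ t01.
rewrite /antisym.
set X := b j _ * _ in h1 *; set Y := b j _ * _ in h2 *.
set X0 := B _ * _ in h1 *; set Y0 := B _ * _ in h2 *.
have -> : X - Y - (X0 - Y0) = (X - X0) - (Y - Y0) by ring.
apply: (le_trans (ler_normB _ _)); rewrite /C mulrDl [_ * thr j ^+ 2]mulrC.
rewrite [(_ + _ + 1) * thr j ^+ 2]mulrC lerD//.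
  by apply: h1; near: j; exact: est_error2.
by apply: h2; near: j; [exact: est_error1|exact: est_error3].
Unshelve. all: by end_near. Qed.

Lemma cvg_antisym l d e : antisym (b j) l d e @[j --> \oo] --> antisym B l d e.
Proof.
have [C C0 hC] := antisym_error l d e.
apply: (@cvg_of_error _ _ C); near=> j.
apply: (@le_trans _ _ (C * thr j ^+ 2)); first by near: j.
by rewrite ler_wpM2l ?thr_sqr_le// ltW.
Unshelve. all: by end_near. Qed.

Lemma cvg_gt_threshold (f : nat -> R) (x : R) : f j @[j --> \oo] --> x -> 0 < x ->
  \forall j \near \oo, thr j < f j.
Proof.
move=> fx x0; have x2 : 0 < x / 2 by lra.
have h1 := near_threshold x2.
have h2 : \forall j \near \oo, x / 2 < f j by apply: (cvgr_gt x) => //; lra.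
near=> j; apply: (@lt_trans _ _ (x / 2)); by near: j.
Unshelve. all: by end_near. Qed.

Lemma reconstruct_null : (forall z, th z = 0) ->
  forall z, reconstruct j (b j) z @[j --> \oo] --> (0 : R).
Proof.
move=> th0 z; apply: cvg_near_cst; exists J => // j /= Jj.
rewrite /reconstruct ifF//; apply/negbTE; rewrite negb_and -leNgt.
apply/orP; left; apply: le_trans (thr_sqr_le j).
have lj : (span_est j (b j) <= j)%N.
  rewrite /span_est big_seq_cond; elim/big_ind: _ => [//|x y hx hy|i].
    by rewrite geq_max hx hy.
  by rewrite mem_iota; lia.
have := hb Jj (mem_patterns1 lj).
have -> : chains j th [:: span_est j (b j)] = 0.
  by rewrite /chains /ktotal big1// => y _; rewrite th0 mul0r.
rewrite subr0 -threshold_sqr; exact: le_trans (ler_norm _).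
Qed.

Variables (lo : int) (len : nat).
Hypothesis hlo : (`|lo| <= L0)%N.
Hypothesis hhi : (absz (lo + len%:Z)%R <= L0)%N.
Hypothesis tlo : th lo != 0.
Hypothesis thi : th (lo + len%:Z) != 0.
Hypothesis below : forall z : int, z < lo -> th z = 0.
Hypothesis above : forall z : int, lo + len%:Z < z -> th z = 0.

Let c := endpoint_weight th lo len.
Let fa d := th (lo + d%:Z).
Let fb d := th (lo + len%:Z - d%:Z).

Let c0 : 0 < c.
Proof.
have pos z : th z != 0 -> 0 < th z.
  by move=> tz; rewrite lt_neqAle eq_sym tz; have /andP[] := ath.1 z.
by rewrite /c /endpoint_weight mulr_gt0 ?mulr_gt0 ?pos//; case: ifP.
Qed.

Let Blen : B [:: len] = 2 * c.
Proof. exact: chains_len. Qed.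

Let Blen_gt0 : 0 < B [:: len].
Proof. by rewrite Blen mulr_gt0. Qed.

Let Blend d : (d <= len)%N -> B [:: len; d] = c * (fa d + fb d).
Proof. exact: chains_len_step. Qed.

(** Expanding [(fa d + fb d) * (fa e + fb e)] and removing the mixed products twice leaves the
    product of differences. *)
Let antisymE d e : (d <= len)%N -> (e <= len)%N ->
  antisym B len d e = c ^+ 2 * ((fa d - fb d) * (fa e - fb e)).
Proof.
move=> dl el; rewrite /antisym !Blend// Blen (@chains_step_len_step _ _ _ lo len)//.
by rewrite -/c -!/(fa _) -!/(fb _); ring.
Qed.

(** At the true length the chain sum is positive. Beyond it the sum vanishes, and its estimate is at
    most the squared threshold. *)
Lemma near_span : \forall j \near \oo, span_est j (b j) = len.
Proof.
have h1 := cvg_gt_threshold (@cvg_est1 len) Blen_gt0.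
near=> j.
have t1 : thr j < b j [:: len] by near: j.
have jl : (len <= j)%N by near: j; exact: nbhs_infty_ge.
have jJ : (J <= j)%N by near: j; exact: nbhs_infty_ge.
have jL : (L0 <= j)%N by near: j; exact: nbhs_infty_ge.
apply/eqP; rewrite eqn_leq; apply/andP; split; last first.
  apply: (@leq_bigmax_seq _ (iota 0 j.+1) (fun d => thr j < b j [:: d]) id len) => //.
  by rewrite mem_iota; lia.
rewrite /span_est big_seq_cond; elim/big_ind: _ => [//|x y hx hy|i].
  by rewrite geq_max hx hy.
rewrite mem_iota => /andP[ij ti]; rewrite leqNgt; apply/negP => li.
have ij' : (i <= j)%N by lia.
have := hb jJ (mem_patterns1 ij').
rewrite (chains_supp _ jL ath.2) (@chains_far _ _ _ lo len)// subr0 threshold_sqr.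
move=> h; move: ti; apply/negP; rewrite -leNgt.
exact: le_trans (le_trans (ler_norm _) h) (thr_sqr_le j).
Unshelve. all: by end_near. Qed.

Lemma near_pivot_none : (forall d, (d <= len)%N -> fa d = fb d) ->
  \forall j \near \oo, (len < pivot j (b j) len)%N.
Proof.
move=> hf.
have h : \forall j \near \oo, forall d, (d < len.+1)%N ->
    antisym (b j) len d d <= thr j.
  suff : forall n, (n <= len.+1)%N -> \forall j \near \oo, forall d, (d < n)%N ->
      antisym (b j) len d d <= thr j by apply.
  elim=> [|m IH] ml; first exact: nearW.
  have [C C0 hC] := antisym_error len m m.
  have ml' : (m <= len)%N by rewrite -ltnS.
  have a0 : antisym B len m m = 0 by rewrite antisymE// hf// subrr mul0r mulr0.
  rewrite a0 in hC.
  have Ci : 0 < C^-1 by rewrite invr_gt0.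
  have ht := near_threshold Ci; have IH' := IH (ltnW ml).
  near=> j => d; rewrite ltnS leq_eqVlt => /orP[/eqP->|dm]; last first.
    have : forall d, (d < m)%N -> antisym (b j) len d d <= thr j by near: j.
    exact.
  have h1 : `|antisym (b j) len m m - 0| <= C * thr j ^+ 2 by near: j.
  have h2 : thr j < C^-1 by near: j.
  rewrite subr0 in h1; apply: (le_trans (ler_norm _)); apply: (le_trans h1).
  have h3 : C * thr j <= 1 by rewrite -ler_pdivlMl// mulr1 ltW.
  by have := threshold_gt0 j; nra.
near=> j; rewrite /pivot.
have hj : forall d, (d < len.+1)%N -> antisym (b j) len d d <= thr j by near: j.
rewrite ltnNge; apply/negP => hp.
have hs : has (fun d => thr j < antisym (b j) len d d) (iota 0 len.+1).
  by rewrite has_find size_iota.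
have /hasP[d] := hs; rewrite mem_iota => dl; rewrite ltNge hj//.
Unshelve. all: by end_near. Qed.

Lemma near_pivot d0 : (d0 <= len)%N -> fa d0 != fb d0 ->
  (forall d, (d < d0)%N -> fa d = fb d) ->
  \forall j \near \oo, pivot j (b j) len = d0.
Proof.
move=> d0l hd0 hf.
have h : \forall j \near \oo, forall d, (d < d0)%N ->
    antisym (b j) len d d <= thr j.
  elim: d0 d0l {hd0} hf => [|m IH] ml hf; first exact: nearW.
  have [C C0 hC] := antisym_error len m m.
  have a0 : antisym B len m m = 0.
    by rewrite antisymE ?(ltnW ml)// hf// subrr mul0r mulr0.
  rewrite a0 in hC.
  have Ci : 0 < C^-1 by rewrite invr_gt0.
  have ht := near_threshold Ci.
  have IH' := IH (ltnW ml) (fun d dm => hf d (ltnW dm)).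
  near=> j => d; rewrite ltnS leq_eqVlt => /orP[/eqP->|dm]; last first.
    have : forall d, (d < m)%N -> antisym (b j) len d d <= thr j by near: j.
    exact.
  have h1 : `|antisym (b j) len m m - 0| <= C * thr j ^+ 2 by near: j.
  have h2 : thr j < C^-1 by near: j.
  rewrite subr0 in h1; apply: (le_trans (ler_norm _)); apply: (le_trans h1).
  have h3 : C * thr j <= 1 by rewrite -ler_pdivlMl// mulr1 ltW.
  by have := threshold_gt0 j; nra.
have pos : 0 < antisym B len d0 d0.
  rewrite antisymE// -expr2; apply: mulr_gt0; first exact: exprn_gt0.
  by rewrite lt_neqAle sqr_ge0 andbT eq_sym sqrf_eq0 subr_eq0.
have hp := cvg_gt_threshold (@cvg_antisym len d0 d0) pos.
near=> j; rewrite /pivot.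
have hj : forall d, (d < d0)%N -> antisym (b j) len d d <= thr j by near: j.
have tj : thr j < antisym (b j) len d0 d0 by near: j.
set P := fun d => _.
have fl : (find P (iota 0 len.+1) <= d0)%N.
  rewrite leqNgt; apply/negP => /(before_find 0%N).
  by rewrite nth_iota; [rewrite add0n /P tj|lia].
apply/eqP; rewrite eqn_leq fl /= leqNgt; apply/negP => fd.
have hs : has P (iota 0 len.+1) by rewrite has_find size_iota; lia.
have := nth_find 0%N hs; rewrite nth_iota; last by lia.
by rewrite add0n /P ltNge hj.
Unshelve. all: by end_near. Qed.

Lemma reconstruct_limit (s g : nat -> R) :
  (forall d, (d <= len)%N -> signed_part (b j) len (pivot j (b j) len) d @[j --> \oo] --> s d) ->
  (forall d, (d <= len)%N -> c * (fa d + fb d) + s d = 2 * c * g d) ->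
  forall z, reconstruct j (b j) z @[j --> \oo] -->
    (if (0 <= z) && (`|z| <= len)%N then g `|z|%N else 0).
Proof.
move=> hs hg z.
have h1 := cvg_gt_threshold (@cvg_est1 len) Blen_gt0.
have h2 := near_span.
case: ifP => hz; last first.
  apply: cvg_near_cst; near=> j.
  have e : span_est j (b j) = len by near: j.
  by rewrite /reconstruct e hz andbF.
have zl : (`|z| <= len)%N by case/andP: hz.
have -> : g `|z|%N = (B [:: len; `|z|%N] + s `|z|%N) / B [:: len].
  rewrite Blend// Blen hg// mulrAC divff ?mul1r//; apply: lt0r_neq0; exact: mulr_gt0.
have hc : (b j [:: len; `|z|%N] + signed_part (b j) len (pivot j (b j) len) `|z|%N) /
    b j [:: len] @[j --> \oo] --> (B [:: len; `|z|%N] + s `|z|%N) / B [:: len].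
  apply: cvgM; last by apply: cvgV; [exact: lt0r_neq0|exact: (@cvg_est1 len)].
  by apply: cvgD; [exact: (@cvg_est2 len `|z|%N)|exact: (hs _ zl)].
apply: cvg_trans hc; apply: near_eq_cvg; near=> j.
have e : span_est j (b j) = len by near: j.
have t : thr j < b j [:: len] by near: j.
by rewrite /reconstruct e t hz.
Unshelve. all: by end_near. Qed.

Lemma shifted_limit z : (if (0 <= z) && (`|z| <= len)%N then fa `|z|%N else 0) = th (z + lo).
Proof.
rewrite /fa; case: ifP => hz; first by congr th; lia.
have [z0|z0] := ltP z 0; first by rewrite below//; lia.
by rewrite above//; move: hz; rewrite z0 /=; lia.
Qed.

Lemma reflected_limit z : (if (0 <= z) && (`|z| <= len)%N then fb `|z|%N else 0) =
  th (- z + (lo + len%:Z)).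
Proof.
rewrite /fb; case: ifP => hz; first by congr th; lia.
have [z0|z0] := ltP z 0; first by rewrite above//; lia.
by rewrite below//; move: hz; rewrite z0 /=; lia.
Qed.

(** A profile with [fa = fb] needs no sign. Otherwise the sign of [fa - fb] at the pivot decides
    from which end the limit reads the profile. *)
Lemma reconstruct_support : exists (t : int) (refl : bool), forall z,
  reconstruct j (b j) z @[j --> \oo] --> th ((if refl then - z else z) + t).
Proof.
have [hf|hf] := pselect (forall d, (d <= len)%N -> fa d = fb d).
  exists lo, false => z; rewrite -shifted_limit.
  apply: (@reconstruct_limit (fun=> 0)) => [d dl|d dl]; last by rewrite hf//; ring.
  apply: cvg_near_cst; have hp := near_pivot_none hf.
  near=> j; have pj : (len < pivot j (b j) len)%N by near: j.
  by rewrite /signed_part ifF// leqNgt pj.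
have ex : exists d, (d <= len)%N && (fa d != fb d).
  apply: contrapT => hn; apply: hf => d dl; apply/eqP/negPn/negP => hd.
  by apply: hn; exists d; rewrite dl.
have [d0 /andP[d0l hd0] dmin] := ex_minnP ex.
have hmin d : (d < d0)%N -> fa d = fb d.
  move=> dd; apply/eqP/negPn/negP => hd.
  have := dmin d; rewrite hd andbT => /(_ (leq_trans (ltnW dd) d0l)); lia.
have hp := near_pivot d0l hd0 hmin.
have v0 : fa d0 - fb d0 != 0 by rewrite subr_eq0.
have sq : Num.sqrt (antisym B len d0 d0) = c * `|fa d0 - fb d0|.
  by rewrite antisymE// -expr2 -exprMn sqrtr_sqr normrM gtr0_norm.
have lim d : (d <= len)%N -> signed_part (b j) len (pivot j (b j) len) d @[j --> \oo] -->
    antisym B len d d0 / (c * `|fa d0 - fb d0|).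
  move=> dl; rewrite -sq.
  have hc : antisym (b j) len d d0 / Num.sqrt (antisym (b j) len d0 d0) @[j --> \oo] -->
      antisym B len d d0 / Num.sqrt (antisym B len d0 d0).
    apply: cvgM; first exact: (@cvg_antisym len d d0).
    apply: cvgV; first by rewrite sq mulf_neq0 ?normr_eq0// gt_eqF.
    apply: (@cvg_comp _ _ _ (fun j => antisym (b j) len d0 d0) (@Num.sqrt R));
      [exact: (@cvg_antisym len d0 d0)|exact: sqrt_continuous].
  apply: cvg_trans hc; apply: near_eq_cvg; near=> j.
  have pj : pivot j (b j) len = d0 by near: j.
  by rewrite /signed_part pj d0l.
have [pos|neg] := ltP 0 (fa d0 - fb d0).
  exists lo, false => z; rewrite -shifted_limit; apply: (reconstruct_limit lim) => d dl.
  by rewrite antisymE// gtr0_norm//; field; rewrite v0 gt_eqF.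
have {}neg : fa d0 - fb d0 < 0 by rewrite lt_neqAle v0.
exists (lo + len%:Z), true => z; rewrite -reflected_limit.
apply: (reconstruct_limit lim) => d dl.
by rewrite antisymE// ltr0_norm//; field; rewrite v0 gt_eqF.
Unshelve. all: by end_near. Qed.

End Reconstruction.

Lemma reconstruct_cvg (R : realType) L0 (th : int -> R) (b : nat -> seq nat -> R) J :
  admissible L0 th ->
  (forall j, (J <= j)%N -> forall ds, ds \in patterns j ->
    `|b j ds - chains j th ds| <= 4^-1 ^+ j) ->
  exists (t : int) (refl : bool), forall z,
    reconstruct j (b j) z @[j --> \oo] --> th ((if refl then - z else z) + t).
Proof.
move=> ath hb; have [th0|/existsNP[z /eqP hz]] := pselect (forall z, th z = 0).
  by exists 0, false => z; rewrite th0; exact: (reconstruct_null hb th0).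
have ex : exists z, th z != 0 by exists z.
have [lo [len [h1 h2 h3 h4 [h5 h6]]]] := support_ends ath.2 ex.
exact: (reconstruct_support ath hb h1 h2 h3 h4 h5 h6).
Qed.

(** * Almost sure convergence *)

Section StandingAssumptions.
Variables (R : realType) (q : int -> R).
Hypothesis Hq : standing_assumptions q.

Lemma step_law_of_standing : exists s2, step_law q s2.
Proof.
have [q0 [q1 [qv [_ [qs _]]]]] := Hq.
have v0 z : 0 <= z%:~R ^+ 2 * q z by rewrite mulr_ge0 ?sqr_ge0.
pose V := (\esum_(z in [set: int]) ((z%:~R ^+ 2) * q z)%R%:E)%E.
have V0 : (0 <= V)%E by apply: esum_ge0 => z _; rewrite lee_fin.
have Vfin : V \is a fin_num by rewrite ge0_fin_numE.
exists (fine V); split => //.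
- have le1 n : \sum_(y <- zr n) q y <= 1.
    by rewrite -lee_fin -q1; exact: esum_ge_zr.
  have nd : {homo (fun n => \sum_(y <- zr n) q y) : m n / (m <= n)%N >-> m <= n}.
    by move=> m n mn; exact: le_sum_zr.
  have cv : cvgn (fun n => \sum_(y <- zr n) q y).
    by apply: nondecreasing_is_cvgn => //; exists 1 => _ [n _ <-].
  suff E : limn (fun n => \sum_(y <- zr n) q y) = 1 by rewrite -E.
  apply/eqP; rewrite eq_le; apply/andP; split.
    by apply: limr_le => //; exact: nearW.
  by rewrite -lee_fin -q1; apply: esum_le_zr => // n; exact: nondecreasing_cvgn_le.
- by move=> n; rewrite -lee_fin fineK//; exact: esum_ge_zr.
Qed.

Lemma conv_pow_path n z : (0 < conv_pow q n z)%E -> exists l : seq int,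
  [/\ size l = n, (forall x, x \in l -> 0 < q x) & \sum_(x <- l) x = z].
Proof.
have q0 := Hq.1.
have cp0 m x : (0 <= conv_pow q m x)%E.
  case: m => [|m] /=; first by rewrite lee_fin.
  elim: m x => [|m IH] x; apply: esum_ge0 => y _; apply: mule_ge0; rewrite ?lee_fin//.
  exact: IH.
elim: n z => [|n IH] z /=.
  rewrite lte_fin; have [->|] := eqVneq z 0; last by rewrite ltxx.
  by exists [::]; rewrite big_nil.
move=> h; have [y hy] : exists y, (0 < conv_pow q n y * (q (z - y))%:E)%E.
  apply: contrapT => hn; move: h; rewrite esum1 ?ltxx// => y _.
  apply/eqP; rewrite eq_le mule_ge0 ?lee_fin// andbT leNgt; apply/negP => hy.
  by apply: hn; exists y.
have qy : 0 < q (z - y).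
  rewrite lt_neqAle q0 andbT eq_sym; apply/eqP => qz.
  by rewrite qz mule0 ltxx in hy.
have cy : (0 < conv_pow q n y)%E.
  rewrite lt_neqAle cp0 andbT eq_sym; apply/eqP => qz.
  by rewrite qz mul0e ltxx in hy.
have [l [sl ql El]] := IH _ cy.
exists ((z - y) :: l); split => [|x|]; first by rewrite /= sl.
  by rewrite inE => /orP[/eqP->//|/ql].
by rewrite big_cons El subrK.
Qed.

(** Otherwise 2 would divide every return time of positive probability, against the gcd
    condition. *)
Lemma odd_closed_path : exists l : seq int,
  [/\ odd (size l), (forall x, x \in l -> 0 < q x) & \sum_(x <- l) x = 0].
Proof.
have [_ [_ [_ [_ [_ [qg _]]]]]] := Hq.
apply: contrapT => hn; suff : 2%N = 1%N by [].
apply: qg => n _ /conv_pow_path[l [sl ql El]].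
rewrite dvdn2; apply/negP => on; apply: hn; exists l; split => //.
by rewrite sl.
Qed.

Lemma return_kernel_of_standing s2 : step_law q s2 ->
  return_kernel (fun t => u q (t + t)).
Proof.
move=> Hs; apply: (return_kernel_u2 Hs odd_closed_path).
by have [_ [_ [_ [_ [_ [_ qG]]]]]] := Hq.
Qed.

End StandingAssumptions.

Lemma borel_cantelli_geometric (R : realType) (d : measure_display)
    (Omega : measurableType d) (P : probability Omega R) (F : nat -> set Omega) N :
  (forall j, measurable (F j)) ->
  (forall j, (N <= j)%N -> (P (F j) <= (2^-1 ^+ j)%:E)%E) ->
  P.-negligible (lim_sup_set F).
Proof.
move=> mF hF.
pose G j := F (j + N)%N.
have mG j : measurable (G j) by exact: mF.
have G0 : P (lim_sup_set G) = 0.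
  apply: lim_sup_set_cvg0 => //.
  apply: (@le_lt_trans _ _ (\sum_(0 <= j <oo) ((2 : R) / (2 ^ (j + 1))%:R)%:E)%E).
    apply: lee_nneseries => // j _; apply: le_trans (hF (j + N)%N (leq_addl _ _)) _.
    rewrite lee_fin exprD; apply: (@le_trans _ _ (2^-1 ^+ j)).
      by rewrite ler_piMr ?exprn_ge0// exprn_ile1//; lra.
    by apply: ler_eq; rewrite natrX exprD expr1 exprVn; field; rewrite expf_neq0.
  have := @cvg_geometric_eseries_half R 2 0; rewrite expr0 divr1 => /cvg_lim h.
  by rewrite -/(eseries _) h// ltry.
exists (lim_sup_set G); split => //.
  by apply: bigcap_measurable => // k _; exact: bigcup_measurable.
move=> w hw n _; have [j /= nj Fj] := hw (n + N)%N I.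
by exists (j - N)%N; [rewrite /=; lia|rewrite /G subnK//; lia].
Qed.

Theorem theorem1p1 (R : realType) (q : int -> R) :
  standing_assumptions q ->
  exists thetan : forall n : nat, n.-tuple bool -> int -> R,
  forall theta : int -> R,
    (forall z, 0 <= theta z <= 1) ->
    finite_set [set z | theta z != 0] ->
  forall (d : measure_display) (Omega : measurableType d) (P : probability Omega R)
         (S : Omega -> nat -> int) (X : Omega -> nat -> bool),
    walk_coin_law P q theta S X ->
    {ae P, forall w, exists (c : int) (refl : bool),
       forall z : int,
         thetan n [tuple X w i.+1 | i < n] z @[n --> \oo] -->
           theta ((if refl then - z else z) + c)}.
Proof.
move=> hq; have [s2 Hs] := step_law_of_standing hq.
have Hw := return_kernel_of_standing hq Hs.
have /choice[Hm hHm] : forall j, exists Hm : nat * (seq nat -> seq bool -> R),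
    forall th, admissible j th ->
    tossE q th Hm.1 (fun xs => (has (fun ds =>
      4^-1 ^+ j < `|Hm.2 ds xs - chains j th ds|) (patterns j))%:R) 0 <= 2^-1 ^+ j.
  by move=> j; have [H [m h]] := stage_estimates Hs Hw j; exists (H, m).
pose len j := (Hm j).1; pose m j := (Hm j).2.
(* The last stage whose tosses have all been observed by time [n]. *)
pose stage n := \max_(j <- iota 0 n.+1 | (len j <= n)%N) j.
have stage_ge j n : (j <= n)%N -> (len j <= n)%N -> (j <= stage n)%N.
  move=> jn ln; apply: (@leq_bigmax_seq _ (iota 0 n.+1) (fun j => len j <= n)%N id) => //.
  by rewrite mem_iota; lia.
(* An empty maximum is 0, hence the condition on [len 0]. *)
have stage_len n : (len 0%N <= n)%N -> (len (stage n) <= n)%N.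
  move=> l0; rewrite /stage; elim/big_ind: _ => // x y hx hy.
  by rewrite /maxn; case: ifP.
exists (fun n x z => reconstruct (stage n)
  (fun ds => m (stage n) ds (take (len (stage n)) x)) z).
move=> th th01 fth d Omega P S X HP.
have [L hL] : exists L, admissible L th.
  move/finite_seqP: fth => [s hs].
  exists (\max_(z <- s) `|z|%N); split => // z zL; apply/eqP/negPn/negP => hz.
  have zs : z \in s by have : [set z | th z != 0] z by []; rewrite hs.
  by move: zL; rewrite ltnNge (@leq_bigmax_seq _ s xpredT (fun z : int => `|z|%N)).
pose bad j (xs : seq bool) := has (fun ds =>
  4^-1 ^+ j < `|m j ds xs - chains j th ds|) (patterns j).
pose F j := [set w | bad j [seq X w i | i <- iota 1 (len j)]].
have mF j : measurable (F j) := measurable_tosses HP 1 (len j) (bad j).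
(* From stage [L] on the window of the stage contains the support, so the uniform bound covers this
   scenery. *)
have hF j : (L <= j)%N -> (P (F j) <= (2^-1 ^+ j)%:E)%E.
  move=> Lj; rewrite (prob_tosses Hs th01 HP) lee_fin; apply: hHm.
  by split => // z zj; apply: hL.2; exact: leq_ltn_trans zj.
apply: negligibleS (borel_cantelli_geometric mF hF) => w /= hw.
apply: contrapT => hlim; apply: hw.
have [J hJ] : exists J, forall j, (J <= j)%N -> ~ F j w.
  apply: contrapT => hn; apply: hlim => n _; apply: contrapT => hn'.
  by apply: hn; exists n => j nj Fj; apply: hn'; exists j.
pose b j ds := m j ds [seq X w i | i <- iota 1 (len j)].
have hb j : (J <= j)%N -> forall ds, ds \in patterns j ->
    `|b j ds - chains j th ds| <= 4^-1 ^+ j.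
  move=> Jj ds dsj; rewrite leNgt; apply/negP => hd.
  by apply: (hJ j Jj); apply/hasP; exists ds.
have [c [refl hc]] := reconstruct_cvg hL hb.
exists c, refl => z.
have stage_oo : stage n @[n --> \oo] --> \oo.
  move=> A [k _ hk]; exists (maxn k (len k)) => // n /=; rewrite geq_max => /andP[kn lkn].
  by apply: hk => /=; exact: stage_ge.
have := cvg_comp _ _ stage_oo (hc z); apply: cvg_trans; apply: near_eq_cvg.
exists (len 0%N) => // n /= ln; rewrite /comp /=.
congr (reconstruct _ _ z); apply/funext => ds; rewrite /b; congr (m _ _ _).
have sl := stage_len n ln.
have -> : [tuple X w i.+1 | i < n] = [seq X w i | i <- iota 1 n] :> seq bool.
  apply: (@eq_from_nth _ false); first by rewrite size_tuple size_map size_iota.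
  move=> i; rewrite size_tuple => hi; rewrite (nth_map 0%N) ?size_iota// nth_iota//.
  by rewrite -(tnth_nth false _ (Ordinal hi)) tnth_mktuple add1n.
by rewrite -map_take take_iota (minn_idPl sl).
Qed.
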